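(* Let $\eta$ be the one-dimensional simple exclusion process with parameter $p$ started from the Bernoulli product measure of density $\rho$, and let $X$ be the random walk with jump-rate functions $\alpha,\beta:\{0,1\}\to\mathbb R_+$ driven by $\eta$, as in the context. Suppose that $$\inf_{\xi\in\{0,1\}}\{\alpha(\xi)-\beta(\xi)\}>1.$$ Then there exists a function $v:[0,1]\times[0,1]\to(1,\infty)$ such that, for every $p,\rho\in[0,1]$, $$\lim_{t\to\infty}\frac{X_t}{t}=v(p,\rho)\qquad P^{p,\rho}\text{-almost surely}.$$
   Context: Notation: $\mathbb{R}_+=[0,\infty)$, $\mathbb{L}=\mathbb{Z}\times\mathbb{R}_+$. Simple exclusion process. For $p\in[0,1]$, $\eta=(\eta_t)_{t\ge0}$ is the Feller process on $\{0,1\}^{\mathbb Z}$ in which each particle (site $x$ with $\eta(x)=1$) attempts to jump to $x+1$ at rate $p$ and to $x-1$ at rate $1-p$, attempts to jump to occupied sites being suppressed; i.e. with generator acting on bounded local functions as $Lf(\eta)=\sum_{x,y\in\mathbb Z}p(x,y)\,\eta(x)(1-\eta(y))\,[f(\eta^{xy})-f(\eta)]$, where $p(x,x+1)=p$, $p(x,x-1)=1-p$, $p(x,y)=0$ otherwise, and $\eta^{xy}$ is obtained from $\eta$ by exchanging the values $\eta(x)$ and $\eta(y)$. For $\rho\in[0,1]$, $\mu_\rho$ is the product measure with Bernoulli$(\rho)$ marginals, which is invariant. $P^{p,\rho}$ denotes the probability measure on a space supporting both this process with initial law $\mu_\rho$ and the random walk $X$ below. Random walk. $\alpha,\beta:\{0,1\}\to\mathbb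 R_+$; let $\Lambda\in[1,\infty)$ satisfy $\alpha(\xi)+\beta(\xi)\le\Lambda$ for $\xi\in\{0,1\}$. Let $\Pi$ be a Poisson point process on $\mathbb L\times[0,\Lambda]$, independent of $\eta$, with intensity (counting measure on $\mathbb Z$)$\otimes dt\otimes du$. Put $\Pi_\alpha=\{(x,t):\exists u,\ (x,t,u)\in\Pi,\ u\le\alpha(\eta_t(x))\}$ and $\Pi_\beta=\{(x,t):\exists u,\ (x,t,u)\in\Pi,\ \alpha(\eta_t(x))<u\le\alpha(\eta_t(x))+\beta(\eta_t(x))\}$. $X=(X_t)_{t\ge0}$ is the unique càdlàg path with $X_0=0$ and, for all $t>0$: $X_t=X_{t-}+1$ if $(X_{t-},t)\in\Pi_\alpha$; $X_t=X_{t-}-1$ if $(X_{t-},t)\in\Pi_\beta$; $X_t=X_{t-}$ otherwise. *)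

(* Defs.v *)
From HB Require Import structures.
From mathcomp Require Import all_boot all_order all_algebra.
From mathcomp Require Import finmap.
From mathcomp Require Import all_classical all_reals all_analysis.
From mathcomp Require Import measurable_realfun.

Set Implicit Arguments.
Unset Strict Implicit.
Unset Printing Implicit Defensive.

Import Order.TTheory GRing.Theory Num.Theory.
Import numFieldNormedType.Exports.

Local Open Scope classical_set_scope.
Local Open Scope ring_scope.

(* Processes indexed by [0, oo) are represented by functions of a real time
   whose values at negative times are irrelevant. *)

(* Z has the discrete sigma-algebra and the discrete topology. *)
HB.instance Definition _ := isPointed.Build int 0.
HB.instance Definition _ := @isMeasurable.Build default_measure_display
  int discrete_measurable discrete_measurable0
  discrete_measurableC discrete_measurableU.
HB.instance Definition _ := hasNbhs.Build int principal_filter.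
HB.instance Definition _ := Discrete_ofNbhs.Build int erefl.

(* {0,1}^Z with the product topology; eta x = true means that x is occupied. *)
Definition config : Type := prod_topology (fun _ : int => bool).

HB.instance Definition _ := Pointed.on config.
HB.instance Definition _ := Nbhs.on config.
HB.instance Definition _ := Topological.on config.
HB.instance Definition _ := Uniform.on config.

Definition cadlag (R : realType) (T : topologicalType) (f : R -> T) : Prop :=
  (forall t, 0 <= t -> f s @[s --> t^'+] --> f t) /\
  (forall t, 0 < t -> exists l : T, f s @[s --> t^'-] --> l).

Section exclusion_generator.
Context {R : realType}.
Implicit Types (s t : R) (f g : config -> R).

Definition jump_kernel (p : R) (x y : int) : R :=
  if y == x + 1 then p else if y == x - 1 then 1 - p else 0.

Definition exchange (x y : int) (eta : config) : config :=
  fun z => if z == x then eta y else if z == y then eta x else eta z.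

(* Functions of finitely many coordinates; they are bounded and continuous. *)
Definition local_fun f : Prop :=
  exists F : {fset int}, forall eta zeta : config,
    (forall x, x \in F -> eta x = zeta x) -> f eta = f zeta.

(* The sum over Z * Z has finitely many nonzero terms when f is local. *)
Definition exclusion_generator (p : R) f (eta : config) : R :=
  \sum_(xy \in [set: int * int])
    jump_kernel p xy.1 xy.2 * (eta xy.1)%:R * (1 - (eta xy.2)%:R) *
    (f (exchange xy.1 xy.2 eta) - f eta).

(* A Feller (Markov) semigroup on the continuous functions on config, which is
   compact; the values of S t on discontinuous functions are irrelevant. *)
Record feller_semigroup (S : R -> (config -> R) -> (config -> R)) : Prop := {
  feller_continuous : forall t f, 0 <= t -> continuous f -> continuous (S t f) ;
  feller_linear : forall t (a : R) f g, 0 <= t -> continuous f -> continuous g ->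
    S t (fun eta => a * f eta + g eta) = (fun eta => a * S t f eta + S t g eta) ;
  feller_ge0 : forall t f, 0 <= t -> continuous f ->
    (forall eta, 0 <= f eta) -> forall eta, 0 <= S t f eta ;
  feller_cst1 : forall t, 0 <= t -> S t (fun=> 1) = (fun=> 1) ;
  feller_at0 : forall f, continuous f -> S 0 f = f ;
  fellerD : forall s t f, 0 <= s -> 0 <= t -> continuous f ->
    S (s + t) f = S s (S t f) ;
  feller_cvg0 : forall f, continuous f -> {uniform, S t f @[t --> 0^'+] --> f}
}.

(* f is in the domain of the generator of S, which maps it to g. *)
Definition generator_graph (S : R -> (config -> R) -> (config -> R)) f g :
    Prop :=
  continuous f /\
  {uniform, (fun eta => t^-1 * (S t f eta - f eta)) @[t --> 0^'+] --> g}.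

(* The local functions form a core, so that this determines S on the
   continuous functions. *)
Definition exclusion_semigroup (p : R)
    (S : R -> (config -> R) -> (config -> R)) : Prop :=
  feller_semigroup S /\
  forall f, local_fun f -> generator_graph S f (exclusion_generator p f).

End exclusion_generator.

Section processes.
Context {R : realType} {d : measure_display} {Omega : measurableType d}.
Variable P : probability Omega R.
Implicit Types (eta : R -> Omega -> config) (s t : R) (f : config -> R).

Definition config_sigma eta (I : set R) : set (set Omega) :=
  <<s [set [set w | eta z.1 w z.2 = true] | z in I `*` [set: int]] >>.

(* The conditional expectation of f (eta (s + t)) given the past up to time s
   is S t f (eta s), written out with the defining property of conditional
   expectations. *)
Definition markov_process (S : R -> (config -> R) -> (config -> R)) eta :
    Prop :=
  forall s t f A, 0 <= s -> 0 <= t -> continuous f ->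
    config_sigma eta `[0, s] A ->
    (\int[P]_(w in A) (f (eta (s + t) w))%:E =
     \int[P]_(w in A) (S t f (eta s w))%:E)%E.

(* zeta has law mu_rho, the product of the Bernoulli(rho) measures. *)
Definition bernoulli_product_law (rho : R) (zeta : Omega -> config) : Prop :=
  forall (F : {fset int}) (B : int -> set bool),
    P [set w | forall x, x \in F -> B x (zeta w x)] =
    (\prod_(x <- F) bernoulli_prob rho (B x))%E.

Record simple_exclusion (p rho : R) eta : Prop := {
  exclusion_measurable : forall t x, 0 <= t ->
    measurable_fun [set: Omega] (fun w => eta t w x) ;
  exclusion_cadlag : {ae P, forall w, cadlag (eta ^~ w)} ;
  exclusion_initial : bernoulli_product_law rho (eta 0) ;
  exclusion_markov : exists S, exclusion_semigroup p S /\ markov_process S eta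
}.

Definition point_count (T : choiceType) (Pi : Omega -> set T) (B : set T)
    (w : Omega) : \bar R := counting (Pi w `&` B).

(* A Poisson point process on D with intensity the restriction of mu to D; the
   second argument of poisson_prob is not used by its definition. *)
Record poisson_process (d' : measure_display) (T : measurableType d')
    (D : set T) (mu : set T -> \bar R) (Pi : Omega -> set T) : Prop := {
  poisson_sub : forall w, Pi w `<=` D ;
  poisson_measurable : forall B, measurable B ->
    measurable_fun [set: Omega] (point_count Pi B) ;
  poisson_law : forall B, measurable B -> B `<=` D -> (mu B < +oo)%E ->
    forall k : nat, P [set w | point_count Pi B w = k%:R%:E] =
      poisson_prob (fine (mu B)) k [set k] ;
  poisson_indep : forall n (B : 'I_n -> set T), (forall i, measurable (B i)) ->
    (forall i, B i `<=` D) -> trivIset [set: 'I_n] B ->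
    forall C : 'I_n -> set (\bar R), (forall i, measurable (C i)) ->
    P (\bigcap_(i in [set: 'I_n]) (point_count Pi (B i) @^-1` C i)) =
    (\prod_(i < n) P (point_count Pi (B i) @^-1` C i))%E
}.

Definition points_sigma (d' : measure_display) (T : measurableType d')
    (Pi : Omega -> set T) : set (set Omega) :=
  <<s [set A | exists (B : set T) (C : set (\bar R)),
        [/\ measurable B, measurable C & A = point_count Pi B @^-1` C]] >>.

Definition independent_sigma (F G : set (set Omega)) : Prop :=
  forall A B, F A -> G B -> P (A `&` B) = (P A * P B)%E.

End processes.

Section random_walk.
Context {R : realType}.

(* Points ((x, t), u) of L * [0, Lambda], and the intensity measure. *)
Definition driving_space (Lambda : R) : set (int * R * R) :=
  [set z | 0 <= z.1.2 /\ 0 <= z.2 <= Lambda].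

Definition driving_intensity : set (int * R * R) -> \bar R :=
  ((counting : set int -> \bar R) \x @lebesgue_measure R
     \x @lebesgue_measure R)%E.

Definition right_points (alpha : bool -> R) (eta : R -> config)
    (pi : set (int * R * R)) : set (int * R) :=
  [set z | exists u, pi (z, u) /\ u <= alpha (eta z.2 z.1)].

Definition left_points (alpha beta : bool -> R) (eta : R -> config)
    (pi : set (int * R * R)) : set (int * R) :=
  [set z | exists u, pi (z, u) /\
    alpha (eta z.2 z.1) < u <= alpha (eta z.2 z.1) + beta (eta z.2 z.1)].

Definition left_limit (X : R -> int) (t : R) : int :=
  lim (X s @[s --> t^'-]).

Record walk_path (alpha beta : bool -> R) (eta : R -> config)
    (pi : set (int * R * R)) (X : R -> int) : Prop := {
  walk_cadlag : cadlag X ;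
  walk_at0 : X 0 = 0 ;
  walk_right : forall t, 0 < t ->
    right_points alpha eta pi (left_limit X t, t) ->
    X t = left_limit X t + 1 ;
  walk_left : forall t, 0 < t ->
    left_points alpha beta eta pi (left_limit X t, t) ->
    X t = left_limit X t - 1 ;
  walk_stay : forall t, 0 < t ->
    ~ right_points alpha eta pi (left_limit X t, t) ->
    ~ left_points alpha beta eta pi (left_limit X t, t) ->
    X t = left_limit X t
}.

(* The walk is only defined almost surely: there is no path at all when some
   (x, t) belongs both to the right and to the left points. *)
Record exclusion_walk (alpha beta : bool -> R) (Lambda p rho : R)
    (d : measure_display) (Omega : measurableType d) (P : probability Omega R)
    (eta : R -> Omega -> config) (Pi : Omega -> set (int * R * R))
    (X : R -> Omega -> int) : Prop := {
  walk_environment : simple_exclusion P p rho eta ;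
  walk_driving : poisson_process P (driving_space Lambda) driving_intensity Pi ;
  walk_independent : independent_sigma P
    (config_sigma eta `[0, +oo[) (points_sigma (R := R) Pi) ;
  walk_paths : {ae P, forall w,
    walk_path alpha beta (eta ^~ w) (Pi w) (X ^~ w)}
}.

End random_walk.

(* Main.v *)
(** The walk is approximated by Euler schemes on dyadic meshes, whose step in
    (i h, (i + 1) h] is decided by the Poisson points in two boxes above the
    current site and by the occupation of that site at time i h.  As h tends to
    0 these schemes coincide with the walk with high probability, and the Markov
    property and the generator identify the limit of their laws with that of a
    Markov chain (environment, walker) in a large window whose right end is
    resampled from the Bernoulli law.

    In this chain two walkers driven by the same environment never cross, and
    everything that the walk has learned about the environment lies to the left
    of a frontier that moves with speed at most 1.  Since alpha - beta > 1, the
    frontier is ahead of the walker by a distance with exponential tails.  So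
    restarting the walk 2 k sites further to the right in a fresh Bernoulli
    environment increases its law up to an error of order r^k, that is
      E g(X_(s+t)) <= E g(X_s + X'_t + 2 k) + C r^k
    for g nondecreasing with values in [0, 1] and X' an independent copy of X.

    Hammersley's argument for subadditive laws, with k = j, makes the variances
    of X_t / t along t = 2^j l summable in j and yields limits of the means that
    do not depend on l.  The Borel-Cantelli lemma gives almost sure convergence
    along these times, and the exponential tails of the number of jumps fill the
    gaps between 2^j l and 2^j (l + 1).  The drift of the walk is at least
    1 + delta for some delta > 0, hence so is the limit. *)

Require Import Defs.
From HB Require Import structures.
From mathcomp Require Import all_boot all_order all_algebra.
From mathcomp Require Import finmap.
From mathcomp Require Import all_classical all_reals all_analysis.
From mathcomp Require Import measurable_realfun.
From mathcomp Require Import zify ring lra.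

Set Implicit Arguments.
Unset Strict Implicit.
Unset Printing Implicit Defensive.

Import Order.TTheory GRing.Theory Num.Theory.
Import numFieldNormedType.Exports.

Local Open Scope classical_set_scope.
Local Open Scope ring_scope.

(** * Resampling sites *)

(** The record [exclusion_walk] does not make [X t] measurable, and the speed has to be the same on
    all probability spaces. So the law of the walk is defined as the limit of the laws of its Euler
    schemes, which are measurable with finitely many values, and laws on different spaces are
    identified by comparing both with the finite-window chain, which mentions no space. The chain is
    never built as a process. It is the operator f + h [gen] f on functions of environment and
    position, and each coupling (two walkers, two environments, walker and frontier) becomes an
    inequality preserved by this operator. The threshold 1 for alpha - beta is the largest rate,
    over all p, at which a discrepancy of two environments or the frontier crosses a bond. The shift
    is 2 k because k sites are spent twice: once to keep the frontier behind the sites that are read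
    later, once to make the walk insensitive to what lies behind these sites. Each costs an error of
    order r^k. *)

Definition upd (z : config) (y : int) (v : bool) : config :=
  fun x => if x == y then v else z x.

Definition swap (i : int) (z : config) : config := exchange i (i + 1) z.

Lemma swapE i z y :
  swap i z y = if y == i then z (i + 1) else if y == i + 1 then z i else z y.
Proof. by []. Qed.

Lemma updE z y v x : upd z y v x = if x == y then v else z x.
Proof. by []. Qed.

Lemma eq_addr1 (i : int) : (i == i + 1) = false.
Proof. by lia. Qed.

Lemma upd_swap i z y v : y != i -> y != i + 1 ->
  upd (swap i z) y v = swap i (upd z y v).
Proof.
move=> /negbTE yi /negbTE yi1; apply/funext => x; rewrite updE !swapE !updE.
rewrite (eq_sym i) yi (eq_sym (i + 1)) yi1.
by case: (eqVneq x y) => // ->; rewrite yi yi1.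
Qed.

Lemma updC z y y' v v' : y != y' -> upd (upd z y v) y' v' = upd (upd z y' v') y v.
Proof.
move=> yy'; apply/funext => x; rewrite !updE.
by case: (eqVneq x y') => [->|//]; rewrite eq_sym (negbTE yy').
Qed.

Lemma upd_upd z y v v' : upd (upd z y v) y v' = upd z y v'.
Proof. by apply/funext => x; rewrite !updE; case: eqP. Qed.

Section average.
Context {R : realType}.
Variable rho : R.
Implicit Types (f g : config -> R) (z : config).

(** Sites that are not averaged are read off [z], so [avgs] plays the role of a conditional
    expectation under the product law. *)
Definition avg (y : int) f z : R :=
  rho * f (upd z y true) + (1 - rho) * f (upd z y false).

Definition avgs (l : seq int) f : config -> R := foldr avg f l.

Lemma avgC y y' f : avg y (avg y' f) = avg y' (avg y f).
Proof.
have [->//|yy'] := eqVneq y y'; apply/funext => z; rewrite /avg.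
by rewrite !(updC _ _ _ yy'); ring.
Qed.

Lemma avgs_avg l y f : avgs l (avg y f) = avg y (avgs l f).
Proof. by elim: l => //= x l ->; rewrite avgC. Qed.

Lemma avg_avg y f : avg y (avg y f) = avg y f.
Proof. by apply/funext => z; rewrite /avg !upd_upd; ring. Qed.

Lemma avgs_absorb l y f : y \in l -> avgs l (avg y f) = avgs l f.
Proof.
move=> yl; rewrite avgs_avg; elim: l yl => //= x l IH.
rewrite inE; have [->|_ /= yl] := eqVneq y x; first by rewrite avg_avg.
by rewrite avgC IH.
Qed.

(** The tower property: averages over single sites commute and are idempotent. *)
Lemma avgs_absorbs l l' f : {subset l' <= l} -> avgs l (avgs l' f) = avgs l f.
Proof.
elim: l' => //= y l' IH sl; rewrite avgs_absorb; last by rewrite sl ?mem_head.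
by apply: IH => x xl'; rewrite sl// inE xl' orbT.
Qed.

Lemma avgs_lin l c f d g :
  avgs l (fun z => c * f z + d * g z) = (fun z => c * avgs l f z + d * avgs l g z).
Proof.
by elim: l => //= y l ->; apply/funext => z; rewrite /avg; ring.
Qed.

Lemma avgsB l f g :
  avgs l (fun z => f z - g z) = (fun z => avgs l f z - avgs l g z).
Proof.
transitivity (avgs l (fun z => 1 * f z + (-1) * g z)).
  by congr avgs; apply/funext => z; ring.
by rewrite avgs_lin; apply/funext => z; ring.
Qed.

Lemma avgsD l f g :
  avgs l (fun z => f z + g z) = (fun z => avgs l f z + avgs l g z).
Proof.
transitivity (avgs l (fun z => 1 * f z + 1 * g z)).
  by congr avgs; apply/funext => z; ring.
by rewrite avgs_lin; apply/funext => z; ring.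
Qed.

Lemma avgs_pull l u f : (forall z y v, y \in l -> u (upd z y v) = u z) ->
  avgs l (fun z => u z * f z) = (fun z => u z * avgs l f z).
Proof.
elim: l => //= y l IH lu; rewrite IH; last first.
  by move=> z x v xl; rewrite lu// inE xl orbT.
by apply/funext => z; rewrite /avg !lu ?mem_head//; ring.
Qed.

Lemma avgs_const l (c : R) : avgs l (fun=> c) = (fun=> c).
Proof. by elim: l => //= y l ->; apply/funext => z; rewrite /avg; ring. Qed.

Lemma avgsM l c f : avgs l (fun z => c * f z) = (fun z => c * avgs l f z).
Proof. exact: avgs_pull. Qed.

Lemma avgs_sum l (I : Type) (s : seq I) (F : I -> config -> R) :
  avgs l (fun z => \sum_(i <- s) F i z) = (fun z => \sum_(i <- s) avgs l (F i) z).
Proof.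
elim: s => [|i s IH].
  have -> : (fun z => \sum_(i <- [::]) F i z) = (fun=> 0).
    by apply/funext => z; rewrite big_nil.
  by rewrite avgs_const; apply/funext => z; rewrite big_nil.
under eq_fun do rewrite big_cons.
by rewrite avgsD IH; apply/funext => z; rewrite big_cons.
Qed.

Lemma avgs_swap l i f : i \notin l -> i + 1 \notin l ->
  avgs l (fun z => f (swap i z)) = (fun z => avgs l f (swap i z)).
Proof.
elim: l => //= y l IH; rewrite !inE !negb_or => /andP[iy il] /andP[i1y i1l].
rewrite IH//; apply/funext => z; rewrite /avg.
by rewrite !upd_swap// eq_sym.
Qed.

Lemma avgs_dep (S : pred int) l f :
  (forall z z', (forall y, S y || (y \in l) -> z y = z' y) -> f z = f z') ->
  forall z z', (forall y, S y -> z y = z' y) -> avgs l f z = avgs l f z'.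
Proof.
elim: l S f => [|x l IH] S f fS z z' zz' /=.
  by apply: fS => y; rewrite in_nil orbF; exact: zz'.
have H v : avgs l f (upd z x v) = avgs l f (upd z' x v).
  apply: (IH (fun y => S y || (y == x))).
    by move=> w w' ww'; apply: fS => y; rewrite inE orbA => /ww'.
  by move=> y /orP[Sy|/eqP->]; rewrite !updE ?eqxx// zz'.
by rewrite /avg !H.
Qed.

Hypothesis rho01 : 0 <= rho <= 1.

Lemma avgs_le l f g : (forall z, f z <= g z) -> forall z, avgs l f z <= avgs l g z.
Proof.
have /andP[r0 r1] := rho01.
elim: l => //= y l IH fg z; rewrite /avg.
have Ht := IH fg (upd z y true); have Hf := IH fg (upd z y false).
by rewrite lerD// ler_wpM2l// subr_ge0.
Qed.

End average.

(** * The finite-volume chain *)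

(* Agreement on one side of m, and the signed distance from m to x into the
   agreement region. *)
Definition agree (s : bool) (m : int) (z z' : config) : Prop :=
  forall y, (if s then m < y else y < m) -> z y = z' y.

Definition depth (s : bool) (m x : int) : int := if s then x - m else m - x.

Lemma agree_sym s m z z' : agree s m z z' -> agree s m z' z.
Proof. by move=> H y ys; rewrite H. Qed.

Lemma depthS s m x : depth s m (if s then x + 1 else x - 1) = depth s m x + 1.
Proof. by case: s; rewrite /depth; lia. Qed.

Lemma depthP s m x : depth s m (if s then x - 1 else x + 1) = depth s m x - 1.
Proof. by case: s; rewrite /depth; lia. Qed.

Definition shift_side (s : bool) (m : int) : int := if s then m + 1 else m - 1.

(* The left endpoint of the bond across the boundary of the agreement region *)
Definition edge (s : bool) (m : int) : int := if s then m else m - 1.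

Lemma depth_shift s m x : depth s (shift_side s m) x = depth s m x - 1.
Proof. by case: s; rewrite /depth /shift_side; lia. Qed.

Lemma depth_gt0 s m x : 0 < depth s m x -> (if s then m < x else x < m).
Proof. by case: s; rewrite /depth; lia. Qed.

Lemma agree_swap_in s m k z z' : (if s then m < k else k + 1 < m) ->
  agree s m z z' ->
  [/\ z k = z' k, z (k + 1) = z' (k + 1) & agree s m (swap k z) (swap k z')].
Proof.
move=> ks zz'.
have zk : z k = z' k by apply: zz'; case: s ks; lia.
have zk1 : z (k + 1) = z' (k + 1) by apply: zz'; case: s ks; lia.
split=> // y ys; rewrite !swapE zk zk1; case: ifP => // _; case: ifP => // _.
exact: zz'.
Qed.

Lemma agree_swap_out s m k z z' : k != edge s m ->
  ~~ (if s then m < k else k + 1 < m) -> agree s m z z' -> agree s m (swap k z) z'.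
Proof.
move=> ke ks zz' y ys; rewrite swapE.
have -> : (y == k) = false by move: ke ks ys; rewrite /edge; case: s zz'; lia.
have -> : (y == k + 1) = false by move: ke ks ys; rewrite /edge; case: s zz'; lia.
exact: zz'.
Qed.

Lemma agree_shift s m z z' : agree s m z z' -> agree s (shift_side s m) z z'.
Proof. by rewrite /shift_side => zz' y ys; apply: zz'; case: s ys; lia. Qed.

(** The bond across the boundary is the only one that can carry a discrepancy into the region, and
    it shrinks the region by one site. *)
Lemma agree_swap_edge s m z z' : agree s m z z' ->
  agree s (shift_side s m) (swap (edge s m) z) z'.
Proof.
move=> zz' y ys; rewrite swapE.
have -> : (y == edge s m) = false by move: ys; rewrite /edge /shift_side; case: s zz'; lia.
have -> : (y == edge s m + 1) = false.
  by move: ys; rewrite /edge /shift_side; case: s zz'; lia.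
by apply: agree_shift zz' _ ys.
Qed.

Lemma agree_edge s m z z' : agree s m z z' ->
  if s then z (edge s m + 1) = z' (edge s m + 1) else z (edge s m) = z' (edge s m).
Proof. by case: s => zz'; apply: zz' => /=; lia. Qed.

Section chain.
Context {R : realType}.
Variables (alpha beta : bool -> R) (Lambda p rho : R).
Variables (a : int) (n : nat) (h : R).
Implicit Types (f g : config -> int -> R) (z : config) (x y : int).

Local Notation b := (a + n%:Z).

Definition bond_rate z i : R :=
  if z i then (if z (i + 1) then 0 else p) else (if z (i + 1) then 1 - p else 0).

Definition bond (i : int) (f : config -> R) z : R :=
  bond_rate z i * (f (swap i z) - f z).

(* The bond (b, b + 1) seen from the window when site b + 1 is resampled from
   the Bernoulli(rho) law. *)
Definition end_rate z : R := if z b then p * (1 - rho) else (1 - p) * rho.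

Definition resv (f : config -> R) z : R :=
  end_rate z * (f (upd z b (~~ z b)) - f z).

Definition in_window x : bool := (a <= x <= b).

(** Outside the window the walker only jumps to the right, at the largest rate [Lambda], so that the
    bound on the total rate and the drift condition hold everywhere. *)
Definition right_rate z x : R := if in_window x then alpha (z x) else Lambda.
Definition left_rate z x : R := if in_window x then beta (z x) else 0.

(** The left end of the window is closed, so the Bernoulli law is in general not invariant. What is
    preserved is the Bernoulli law ahead of the frontier introduced below, for which the resampled
    right end is essential. *)
Definition gen f z x : R :=
  right_rate z x * (f z (x + 1) - f z x) + left_rate z x * (f z (x - 1) - f z x) +
  \sum_(i < n) bond (a + i%:Z) (f^~ x) z + resv (f^~ x) z.

Definition chain_step f z x : R := f z x + h * gen f z x.

Lemma bond_lin i (c d : R) (f g : config -> R) z :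
  bond i (fun z => c * f z + d * g z) z = c * bond i f z + d * bond i g z.
Proof. by rewrite /bond; ring. Qed.

Lemma step_lin (c d : R) f g :
  chain_step (fun z x => c * f z x + d * g z x) =
  (fun z x => c * chain_step f z x + d * chain_step g z x).
Proof.
apply/funext => z; apply/funext => x; rewrite /chain_step /gen /resv.
under eq_bigr do rewrite bond_lin.
by rewrite big_split/= -!mulr_sumr; ring.
Qed.

Lemma stepB f g :
  chain_step (fun z x => f z x - g z x) = (fun z x => chain_step f z x - chain_step g z x).
Proof.
transitivity (chain_step (fun z x => 1 * f z x + (-1) * g z x)).
  by congr chain_step; apply/funext => z; apply/funext => x; ring.
by rewrite step_lin; apply/funext => z; apply/funext => x; ring.
Qed.

Lemma stepN f : chain_step (fun z x => - f z x) = (fun z x => - chain_step f z x).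
Proof.
transitivity (chain_step (fun z x => (-1) * f z x + 0 * f z x)).
  by congr chain_step; apply/funext => z; apply/funext => x; ring.
by rewrite step_lin; apply/funext => z; apply/funext => x; ring.
Qed.

Hypothesis p01 : 0 <= p <= 1.
Hypothesis rho01 : 0 <= rho <= 1.
Hypothesis alpha_ge0 : forall xi, 0 <= alpha xi.
Hypothesis beta_ge0 : forall xi, 0 <= beta xi.
Hypothesis Lambda_ge1 : 1 <= Lambda.
Hypothesis rates_le : forall xi, alpha xi + beta xi <= Lambda.
Hypothesis h_ge0 : 0 <= h.
(** The factor 2 leaves room for two coupled copies, whose rates add up when they do not move
    together. *)
Hypothesis h_small : h * (2 * (n%:R + 1 + Lambda)) <= 1.

Lemma bond_rate01 z i : 0 <= bond_rate z i <= 1.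
Proof.
have /andP[p0 p1] := p01.
by rewrite /bond_rate; case: (z i); case: (z (i + 1)); rewrite ?lexx ?ler01 ?p0 ?p1//; lra.
Qed.

(** With one end in common, different rates force the other ends to differ, and then only one of the
    two configurations can exchange. *)
Lemma bond_rate_edge z z' k : z (k + 1) = z' (k + 1) \/ z k = z' k ->
  bond_rate z k != bond_rate z' k -> bond_rate z k + bond_rate z' k <= 1.
Proof.
have /andP[p0 p1] := p01; rewrite /bond_rate.
by case=> ->; [case: (z k); case: (z' k); case: (z' (k + 1))|
  case: (z (k + 1)); case: (z' k); case: (z' (k + 1))]; rewrite ?eqxx//=; lra.
Qed.

Lemma end_rate01 z : 0 <= end_rate z <= 1.
Proof.
have /andP[p0 p1] := p01; have /andP[r0 r1] := rho01.
by rewrite /end_rate; case: (z b); rewrite mulr_ge0 ?mulr_ile1//; lra.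
Qed.

Lemma right_rate_ge0 z x : 0 <= right_rate z x.
Proof. by rewrite /right_rate; case: ifP => // _; have := Lambda_ge1; lra. Qed.

Lemma left_rate_ge0 z x : 0 <= left_rate z x.
Proof. by rewrite /left_rate; case: ifP. Qed.

Lemma rates_sum_le z x : right_rate z x + left_rate z x <= Lambda.
Proof. by rewrite /right_rate /left_rate; case: ifP => // _; rewrite addr0. Qed.

(** The maximum principle in discrete time: [S] stands for a generator of total rate [C] acting on
    values below [M], and [h * C <= 1]. *)
Lemma step_bound (v M S C : R) : v <= M -> S <= C * (M - v) ->
  C <= 2 * (n%:R + 1 + Lambda) -> v + h * S <= M.
Proof.
move=> vM SC C2.
have H1 : h * S <= h * (C * (M - v)) by rewrite ler_wpM2l.
have H2 : h * (C * (M - v)) <= h * ((2 * (n%:R + 1 + Lambda)) * (M - v)).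
  by rewrite ler_wpM2l// ler_wpM2r// subr_ge0.
have H3 : (h * (2 * (n%:R + 1 + Lambda))) * (M - v) <= 1 * (M - v).
  by rewrite ler_wpM2r// subr_ge0.
by lra.
Qed.

Lemma sum_ord_le (F : 'I_n -> R) c : (forall i, F i <= c) -> \sum_i F i <= n%:R * c.
Proof.
move=> Fc; apply: (le_trans (ler_sum _ (fun i _ => Fc i))).
by rewrite sumr_const card_ord mulr_natl.
Qed.

Lemma step_ub f M : (forall z x, f z x <= M) -> forall z x, chain_step f z x <= M.
Proof.
have L1 := Lambda_ge1.
move=> fM z x; apply: (@step_bound _ _ _ (n%:R + 1 + Lambda)) => //; last first.
  by have : 0 <= n%:R :> R by []; lra.
have tt (c : R) z' x' : 0 <= c -> c * (f z' x' - f z x) <= c * (M - f z x).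
  by move=> c0; rewrite ler_wpM2l// lerB.
have bb (c : R) z' x' : 0 <= c <= 1 -> c * (f z' x' - f z x) <= M - f z x.
  move=> /andP[c0 c1]; apply: (le_trans (tt _ _ _ c0)).
  by rewrite ler_piMl// subr_ge0.
rewrite /gen.
have H1 := tt _ z (x + 1) (right_rate_ge0 z x).
have H2 := tt _ z (x - 1) (left_rate_ge0 z x).
have H3 : \sum_(i < n) bond (a + i%:Z) (f^~ x) z <= n%:R * (M - f z x).
  by apply: sum_ord_le => i; apply: bb; exact: bond_rate01.
have H4 : resv (f^~ x) z <= M - f z x by apply: bb; exact: end_rate01.
have H5 : (right_rate z x + left_rate z x) * (M - f z x) <= Lambda * (M - f z x).
  by rewrite ler_wpM2r ?subr_ge0 ?rates_sum_le.
by lra.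
Qed.

Lemma step_lb f M : (forall z x, M <= f z x) -> forall z x, M <= chain_step f z x.
Proof.
move=> fM z x; rewrite -lerN2.
have := @step_ub (fun z x => - f z x) (- M); rewrite stepN; apply.
by move=> z' x'; rewrite lerN2.
Qed.

Lemma step_le f g : (forall z x, f z x <= g z x) ->
  forall z x, chain_step f z x <= chain_step g z x.
Proof.
move=> fg z x; have := @step_lb (fun z x => g z x - f z x) 0.
rewrite stepB => H; rewrite -subr_ge0; apply: H.
by move=> z' x'; rewrite subr_ge0.
Qed.

Lemma step_norm f M : (forall z x, `|f z x| <= M) ->
  forall z x, `|chain_step f z x| <= M.
Proof.
move=> fM z x; rewrite ler_norml; apply/andP; split.
  by apply: step_lb => z' x'; have := fM z' x'; rewrite ler_norml => /andP[].
by apply: step_ub => z' x'; have := fM z' x'; rewrite ler_norml => /andP[].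
Qed.

Definition incr f := forall z x, f z x <= f z (x + 1).

(* Two walkers in the same environment coalesce and never cross. *)
Lemma step_incr f : incr f -> incr (chain_step f).
Proof.
have L1 := Lambda_ge1.
move=> fi z x; rewrite /chain_step -subr_ge0 -oppr_le0.
set D := fun z x => f z (x + 1) - f z x.
have D0 z' x' : 0 <= D z' x' by rewrite subr_ge0.
(* [S] is minus the generator, applied to [D], of two walkers at x and x + 1 that jump independently
   and see the same exchanges; when one jumps onto the other the difference becomes 0. *)
pose S : R := right_rate z x * D z x - right_rate z (x + 1) * D z (x + 1)
  + left_rate z (x + 1) * D z x - left_rate z x * D z (x - 1)
  + \sum_(i < n) (bond_rate z (a + i%:Z) * (D z x - D (swap (a + i%:Z) z) x))
  + end_rate z * (D z x - D (upd z b (~~ z b)) x).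
have -> : - (f z (x + 1) + h * gen f z (x + 1) - (f z x + h * gen f z x)) =
   - D z x + h * S.
  rewrite /gen /S /resv /D /bond.
  have -> : x - 1 + 1 = x by lia.
  have -> : x + 1 - 1 = x by lia.
  have -> : \sum_(i < n) bond_rate z (a + i%:Z) * (f z (x + 1) - f z x -
      (f (swap (a + i%:Z) z) (x + 1) - f (swap (a + i%:Z) z) x)) =
    \sum_(i < n) bond_rate z (a + i%:Z) * (f (swap (a + i%:Z) z) x - f z x) -
    \sum_(i < n) bond_rate z (a + i%:Z) * (f (swap (a + i%:Z) z) (x + 1) - f z (x + 1)).
    by rewrite -sumrB; apply: eq_bigr => i _; ring.
  by ring.
apply: (@step_bound _ _ _ (n%:R + 1 + 2 * Lambda)); rewrite ?oppr_le0//; last first.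
  by have : 0 <= n%:R :> R by []; lra.
rewrite sub0r opprK /S.
have bb (c : R) (z' : config) x' : 0 <= c <= 1 -> c * (D z x - D z' x') <= D z x.
  move=> c01; have := D0 z x; have := D0 z' x'; nra.
have H3 : \sum_(i < n) (bond_rate z (a + i%:Z) * (D z x - D (swap (a + i%:Z) z) x))
   <= n%:R * D z x.
  by apply: sum_ord_le => i; apply: bb; exact: bond_rate01.
have H4 := bb _ (upd z b (~~ z b)) x (end_rate01 z).
have H1 := mulr_ge0 (right_rate_ge0 z (x + 1)) (D0 z (x + 1)).
have H2 := mulr_ge0 (left_rate_ge0 z x) (D0 z (x - 1)).
have H5 : (right_rate z x + left_rate z (x + 1)) * D z x <= 2 * Lambda * D z x.
  rewrite ler_wpM2r//; have := rates_sum_le z x; have := rates_sum_le z (x + 1).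
  by have := right_rate_ge0 z (x + 1); have := left_rate_ge0 z x; lra.
by lra.
Qed.

Definition loc f := forall z z' x, (forall y, in_window y -> z y = z' y) -> f z x = f z' x.

Lemma in_window_bond (i : 'I_n) : in_window (a + i%:Z) && in_window (a + i%:Z + 1).
Proof. by rewrite /in_window; have := ltn_ord i; lia. Qed.

Lemma in_window_end : in_window b.
Proof. by rewrite /in_window; lia. Qed.

Lemma step_loc f : loc f -> loc (chain_step f).
Proof.
move=> fl z z' x zz'; rewrite /chain_step /gen.
have E : forall x, f z x = f z' x by move=> x'; exact: fl.
have -> : right_rate z x = right_rate z' x by rewrite /right_rate; case: ifP => // xw; rewrite zz'.
have -> : left_rate z x = left_rate z' x by rewrite /left_rate; case: ifP => // xw; rewrite zz'.
rewrite !E; congr (_ + _ * (_ + _ + _)).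
  apply: eq_bigr => i _; rewrite /bond.
  have /andP[i1 i2] := in_window_bond i.
  have -> : bond_rate z (a + i%:Z) = bond_rate z' (a + i%:Z) by rewrite /bond_rate !zz'.
  rewrite E (fl (swap _ z) (swap (a + i%:Z) z'))// => y yw.
  by rewrite !swapE !zz'.
rewrite /resv /end_rate E (zz' _ in_window_end) (fl (upd z _ _) (upd z' b (~~ z' b)))//.
by move=> y yw; rewrite !updE zz'.
Qed.

Definition influence s (u D : R) f : Prop := forall m z z' x, agree s m z z' ->
  f z x - f z' x <= D * u ^ depth s m x.

(** Both environments carry the same walker. Its jumps change the depth by one, and the boundary of
    the agreement region approaches it at rate at most 1, whence the extra term [u^-1 - 1]. So [G]
    bounds the relative growth rate of the weight [u ^ depth]. *)
Lemma step_influence s (u D M G : R) f :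
  0 < u <= 1 -> 0 <= G -> 2 * M <= D -> (forall z x, `|f z x| <= M) ->
  (forall z x,
    (if s then right_rate z x * (u - 1) + left_rate z x * (u^-1 - 1)
     else right_rate z x * (u^-1 - 1) + left_rate z x * (u - 1)) + (u^-1 - 1) <= G) ->
  influence s u D f -> influence s u (D * (1 + h * G)) (chain_step f).
Proof.
have L1 := Lambda_ge1.
move=> /andP[u0 u1] G0 MD fM uG fi m z z' x zz'.
have M0 : 0 <= M by exact: le_trans (normr_ge0 _) (fM z x).
have D0 : 0 <= D by lra.
have iu1 : 1 <= u^-1 by rewrite invf_ge1.
have un0 : u != 0 by rewrite gt_eqF.
have hG : 1 <= 1 + h * G by rewrite lerDl mulr_ge0.
(* Outside the agreement region the weight is at least 1, and the trivial bound 2 M is dominated by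
   [D]. *)
have [e0|e0] := lerP (depth s m x) 0.
  have w1 : 1 <= u ^ depth s m x.
    case: (depth s m x) e0 => // k; first by case: k.
    by move=> _; rewrite /exprz invf_ge1 ?exprn_gt0// exprn_ile1// ltW.
  have H : chain_step f z x - chain_step f z' x <= 2 * M.
    have := step_norm fM z x; have := step_norm fM z' x.
    rewrite !ler_norml => /andP[? ?] /andP[? ?]; lra.
  apply: (le_trans H); apply: (le_trans MD); rewrite -mulrA ler_peMr//.
  by rewrite mulr_ege1.
set w := u ^ depth s m x.
have w0 : 0 < w by rewrite exprz_gt0.
have wS e : e = depth s m x + 1 -> u ^ e = w * u.
  by move=> ->; rewrite expfzDr// expr1z.
have wP e : e = depth s m x - 1 -> u ^ e = w * u^-1.
  by move=> ->; rewrite expfzDr// exprN1.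
have sx : (if s then m < x else x < m) by exact: depth_gt0.
set Dl := f z x - f z' x.
have Dlw : Dl <= D * w by exact: fi.
have zx : z x = z' x by exact: zz'.
have rr (q q' c1 c2 W : R) : 0 <= q -> 0 <= q' -> c1 <= W -> c2 <= W ->
   q * c1 + q' * c2 <= (q + q') * W.
  by move=> q0 q'0 H1 H2; rewrite mulrDl lerD// ler_wpM2l.
pose T1 := right_rate z x * (f z (x + 1) - f z' (x + 1) - Dl) +
           left_rate z x * (f z (x - 1) - f z' (x - 1) - Dl).
pose T2 := \sum_(i < n) (bond (a + i%:Z) (f^~ x) z - bond (a + i%:Z) (f^~ x) z').
pose T3 := resv (f^~ x) z - resv (f^~ x) z'.
have -> : chain_step f z x - chain_step f z' x = Dl + h * (T1 + T2 + T3).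
  rewrite /chain_step /gen /T1 /T2 /T3 /Dl sumrB.
  have -> : right_rate z' x = right_rate z x by rewrite /right_rate zx.
  have -> : left_rate z' x = left_rate z x by rewrite /left_rate zx.
  by ring.
have HT1 : T1 <= Lambda * (D * w - Dl) + D * w *
    (if s then right_rate z x * (u - 1) + left_rate z x * (u^-1 - 1)
     else right_rate z x * (u^-1 - 1) + left_rate z x * (u - 1)).
  have H1 := fi m z z' (x + 1) zz'; have H2 := fi m z z' (x - 1) zz'.
  have HL : (right_rate z x + left_rate z x) * (D * w - Dl) <= Lambda * (D * w - Dl).
    by rewrite ler_wpM2r ?subr_ge0 ?rates_sum_le.
  have ra0 := right_rate_ge0 z x; have rb0 := left_rate_ge0 z x.
  have {}wS := wS _ (depthS s m x); have {}wP := wP _ (depthP s m x).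
  rewrite /T1; move: H1 H2; case: (s) wS wP => wS wP; rewrite wS wP => H1 H2.
    have K1 := ler_wpM2l ra0 H1; have K2 := ler_wpM2l rb0 H2; lra.
  have K1 := ler_wpM2l ra0 H1; have K2 := ler_wpM2l rb0 H2; lra.
have HT3 : T3 <= 2 * (D * w - Dl).
  rewrite /T3 /resv.
  have := end_rate01 z; have := end_rate01 z' => /andP[q'0 q'1] /andP[q0 q1].
  have [sb|sb] := boolP (if s then m < b else b < m).
    have zb : z b = z' b by exact: zz'.
    have -> : end_rate z' = end_rate z by rewrite /end_rate zb.
    have H : f (upd z b (~~ z b)) x - f (upd z' b (~~ z' b)) x <= D * w.
      by apply: fi => y ys; rewrite !updE -zb; case: eqP => // _; exact: zz'.
    have K1 := ler_wpM2l q0 H.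
    have K2 : end_rate z * (D * w - Dl) <= 2 * (D * w - Dl).
      by rewrite ler_wpM2r ?subr_ge0//; lra.
    by rewrite /Dl in K2 *; lra.
  have H v : agree s m (upd z b v) z' /\ agree s m z (upd z' b v).
    split=> y ys; rewrite updE; case: eqP => [yb|_]; try exact: zz'.
    - by move: ys; rewrite yb (negbTE sb).
    - by move: ys; rewrite yb (negbTE sb).
  have H1 := fi m _ _ x (H (~~ z b)).1; have H2 := fi m _ _ x (H (~~ z' b)).2.
  have K := rr _ _ _ _ _ q0 q'0 H1 H2.
  have K2 : (end_rate z + end_rate z') * (D * w - Dl) <= 2 * (D * w - Dl).
    by rewrite ler_wpM2r ?subr_ge0//; lra.
  by rewrite -/w in K; rewrite /Dl in K2 *; lra.
pose m0 := edge s m.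
(* Inside the region the exchanges are made together, outside it separately, and neither moves the
   boundary. Only the bond [m0] across the boundary costs a factor [u^-1], at total rate at most
   1. *)
have HT2 (i : 'I_n) : bond (a + i%:Z) (f^~ x) z - bond (a + i%:Z) (f^~ x) z' <=
    2 * (D * w - Dl) + (a + i%:Z == m0)%:R * (D * w * (u^-1 - 1)).
  move: (a + i%:Z) => k; rewrite /bond.
  have := bond_rate01 z k; have := bond_rate01 z' k => /andP[q'0 q'1] /andP[q0 q1].
  have Dw0 : 0 <= D * w * (u^-1 - 1).
    by rewrite mulr_ge0 ?subr_ge0// mulr_ge0// ltW.
  have eqc m' W : D * u ^ depth s m' x <= W -> bond_rate z k = bond_rate z' k ->
      agree s m' (swap k z) (swap k z') ->
      bond_rate z k * (f (swap k z) x - f z x) - bond_rate z' k * (f (swap k z') x - f z' x)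
      <= bond_rate z k * (W - Dl).
    move=> HW <- sa; have := fi m' _ _ x sa => H.
    by rewrite -mulrBr ler_wpM2l// /Dl; lra.
  have nec m' W : D * u ^ depth s m' x <= W ->
      agree s m' (swap k z) z' -> agree s m' z (swap k z') ->
      bond_rate z k * (f (swap k z) x - f z x) - bond_rate z' k * (f (swap k z') x - f z' x)
      <= (bond_rate z k + bond_rate z' k) * (W - Dl).
    move=> HW sa sb; have H1 := fi m' _ _ x sa; have H2 := fi m' _ _ x sb.
    have := rr _ _ _ _ _ q0 q'0 (le_trans H1 HW) (le_trans H2 HW).
    by rewrite /Dl; lra.
  have le2 c : 0 <= c <= 2 -> c * (D * w - Dl) <= 2 * (D * w - Dl).
    by move=> /andP[c0 c2]; rewrite ler_wpM2r ?subr_ge0.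
  have [km0|km0] := eqVneq k m0.
    have HW : D * u ^ depth s (shift_side s m) x = D * w * u^-1.
      by rewrite (wP _ (depth_shift s m x)) mulrA.
    have sa : agree s (shift_side s m) (swap k z) z'.
      by rewrite km0; exact: agree_swap_edge.
    have sb : agree s (shift_side s m) z (swap k z').
      by apply: agree_sym; rewrite km0; apply: agree_swap_edge; exact: agree_sym.
    have sab : agree s (shift_side s m) (swap k z) (swap k z').
      move=> y ys; rewrite sa// [RHS](_ : _ = z y); last by rewrite -sb.
      by rewrite (agree_shift zz' ys).
    have fin c : 0 <= c <= 1 -> c * (D * w * u^-1 - Dl) <=
        2 * (D * w - Dl) + 1 * (D * w * (u^-1 - 1)).
      move=> /andP[c0 c1].
      have H1 : c * (D * w - Dl) <= 2 * (D * w - Dl) by apply: le2; lra.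
      have H2 : c * (D * w * (u^-1 - 1)) <= 1 * (D * w * (u^-1 - 1)).
        by rewrite ler_wpM2r.
      by lra.
    have HW' : D * u ^ depth s (shift_side s m) x <= D * w * u^-1 by rewrite HW.
    have zk : if s then z (k + 1) = z' (k + 1) else z k = z' k.
      by rewrite km0; exact: agree_edge.
    have [zz|zz] := eqVneq (bond_rate z k) (bond_rate z' k).
      exact: le_trans (eqc _ _ HW' zz sab) (fin _ (bond_rate01 z k)).
    apply: (le_trans (nec _ _ HW' sa sb)); apply: fin.
    by rewrite addr_ge0 ?q0//=; apply: bond_rate_edge zz; case: (s) zk; [left|right].
  rewrite mul0r addr0.
  have [ks|ks] := boolP (if s then m < k else k + 1 < m).
    have [zk zk1 zzs] := agree_swap_in ks zz'.
    apply: le_trans (eqc m (D * w) _ _ zzs) (le2 _ _) => //.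
      by rewrite /bond_rate zk zk1.
    by rewrite q0 (le_trans q1)// ler1n.
  have sa := agree_swap_out km0 ks zz'.
  have sb := agree_sym (agree_swap_out km0 ks (agree_sym zz')).
  apply: le_trans (nec m (D * w) _ sa sb) (le2 _ _) => //.
  lra.
have HT2s : T2 <= n%:R * (2 * (D * w - Dl)) + D * w * (u^-1 - 1).
  apply: (le_trans (ler_sum _ (fun i _ => HT2 i))).
  rewrite big_split/= sumr_const card_ord -[_ *+ n]mulr_natl lerD2l -mulr_suml.
  rewrite ler_piMl ?mulr_ge0 ?subr_ge0 ?(ltW w0)//.
  have [[i im]|noi] := pselect (exists i : 'I_n, a + i%:Z == m0).
    rewrite (bigD1 i)//= im big1 ?addr0// => j ji.
    case: eqP => // jm; exfalso; move/eqP: ji; apply; apply/val_inj => /=.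
    by move/eqP : im; rewrite -jm => /addrI [] /esym.
  by rewrite big1// => i _; case: eqP => // im; exfalso; apply: noi; exists i; apply/eqP.
have Hsum : T1 + T2 + T3 <= (2 * (n%:R + 1 + Lambda)) * (D * w - Dl) + D * w * G.
  have H := uG z x; have Dw0 : 0 <= D * w by rewrite mulr_ge0// ltW.
  have H' := ler_wpM2l Dw0 H.
  have HL : 0 <= Lambda * (D * w - Dl) by rewrite mulr_ge0 ?subr_ge0// (le_trans ler01).
  rewrite mulrDr in H'.
  lra.
have HM : Dl + h * (T1 + T2 + T3 - D * w * G) <= D * w.
  apply: (@step_bound _ _ _ (2 * (n%:R + 1 + Lambda))) => //; lra.
lra.
Qed.

End chain.

(** * The frontier of the past *)

Section frontier.
Context {R : realType}.
Variables (alpha beta : bool -> R) (Lambda p rho : R).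
Variables (a : int) (n : nat) (h : R).
Implicit Types (f g : config -> int -> R) (z : config) (x y : int) (d : nat).
Implicit Types (F G : config -> int -> nat -> R).

Local Notation b := (a + n%:Z).
Local Notation ra := (right_rate alpha Lambda a n).
Local Notation rb := (left_rate beta a n).
Local Notation brate := (bond_rate p).
Local Notation rrate := (end_rate p rho a n).
Local Notation step := (chain_step alpha beta Lambda p rho a n h).

(* The frontier is at site x + d. Its rate across the bond (i, i + 1) dominates
   the rate of an exchange there and is chosen so that the law to the right of
   the frontier remains Bernoulli: the config-dependent part compensates the
   boundary term of the half-line exclusion process. *)
Definition frontier_rate z (i : int) : R := if z (i + 1) then 1 - p else p.

Definition fbond x d i F z : R :=
  if i == x + d%:Z then
    brate z i * (F (swap i z) x d.+1 - F z x d) +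
    (frontier_rate z i - brate z i) * (F z x d.+1 - F z x d)
  else brate z i * (F (swap i z) x d - F z x d).

(** A right jump of a walker that sits on the frontier, where [d.-1 = 0], takes the frontier along;
    all other jumps leave x + d unchanged. *)
Definition fgen F z x d : R :=
  ra z x * (F z (x + 1) d.-1 - F z x d) + rb z x * (F z (x - 1) d.+1 - F z x d) +
  \sum_(i < n) fbond x d (a + i%:Z) F z +
  rrate z * (F (upd z b (~~ z b)) x d - F z x d).

Definition frontier_step F z x d : R := F z x d + h * fgen F z x d.

Lemma frontier_step_lin (c e : R) F G :
  frontier_step (fun z x d => c * F z x d + e * G z x d) =
  (fun z x d => c * frontier_step F z x d + e * frontier_step G z x d).
Proof.
apply/funext => z; apply/funext => x; apply/funext => d; rewrite /frontier_step /fgen.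
have -> : \sum_(i < n) fbond x d (a + i%:Z) (fun z x d => c * F z x d + e * G z x d) z =
   c * (\sum_(i < n) fbond x d (a + i%:Z) F z) + e * \sum_(i < n) fbond x d (a + i%:Z) G z.
  rewrite !mulr_sumr -big_split/=; apply: eq_bigr => i _.
  by rewrite /fbond; case: ifP => _; ring.
by ring.
Qed.

Lemma frontier_stepB F G :
  frontier_step (fun z x d => F z x d - G z x d) = (fun z x d => frontier_step F z x d - frontier_step G z x d).
Proof.
transitivity (frontier_step (fun z x d => 1 * F z x d + (-1) * G z x d)).
  by congr frontier_step; apply/funext => z; apply/funext => x; apply/funext => d; ring.
by rewrite frontier_step_lin; apply/funext => z; apply/funext => x; apply/funext => d; ring.
Qed.

Lemma frontier_step_proj f : frontier_step (fun z x _ => f z x) = (fun z x _ => step f z x).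
Proof.
apply/funext => z; apply/funext => x; apply/funext => d; rewrite /frontier_step /fgen /chain_step /gen.
congr (_ + _ * (_ + _ + _)); apply: eq_bigr => i _.
by rewrite /fbond /bond; case: ifP => // _; ring.
Qed.

Hypothesis p01 : 0 <= p <= 1.
Hypothesis rho01 : 0 <= rho <= 1.
Hypothesis alpha_ge0 : forall xi, 0 <= alpha xi.
Hypothesis beta_ge0 : forall xi, 0 <= beta xi.
Hypothesis Lambda_ge1 : 1 <= Lambda.
Hypothesis rates_le : forall xi, alpha xi + beta xi <= Lambda.
Hypothesis h_ge0 : 0 <= h.
Hypothesis h_small : h * (2 * (n%:R + 1 + Lambda)) <= 1.

Lemma frontier_bond_rate z i : 0 <= brate z i <= frontier_rate z i.
Proof.
have /andP[p0 p1] := p01; rewrite /bond_rate /frontier_rate.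
by case: (z i); case: (z (i + 1)); lra.
Qed.

Lemma frontier_rate_le1 z i : frontier_rate z i <= 1.
Proof. by have /andP[p0 p1] := p01; rewrite /frontier_rate; case: (z (i + 1)); lra. Qed.

Lemma frontier_step_ge0 F : (forall z x d, 0 <= F z x d) -> forall z x d, 0 <= frontier_step F z x d.
Proof.
have L1 := Lambda_ge1.
move=> F0 z x d; rewrite -oppr_le0 /frontier_step opprD -mulrN.
have ra0 : 0 <= ra z x by exact: right_rate_ge0.
have rb0 : 0 <= rb z x by exact: left_rate_ge0.
have rab : ra z x + rb z x <= Lambda by exact: rates_sum_le.
have /andP[q0 q1] : 0 <= rrate z <= 1 by exact: end_rate01.
apply: (@step_bound R Lambda n h h_ge0 h_small _ 0 _ (n%:R + 1 + Lambda)).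
- by rewrite oppr_le0.
- rewrite sub0r opprK /fgen.
  have H1 : 0 <= ra z x * F z (x + 1) d.-1 by rewrite mulr_ge0.
  have H2 : 0 <= rb z x * F z (x - 1) d.+1 by rewrite mulr_ge0.
  have H3 : (ra z x + rb z x) * F z x d <= Lambda * F z x d by rewrite ler_wpM2r.
  have H4 : 0 <= rrate z * F (upd z b (~~ z b)) x d by rewrite mulr_ge0.
  have H5 : rrate z * F z x d <= 1 * F z x d by rewrite ler_wpM2r.
  have H6 : \sum_(i < n) - fbond x d (a + i%:Z) F z <= n%:R * F z x d.
    apply: sum_ord_le => i; move: (a + i%:Z) => k.
    have /andP[b0 bc] := frontier_bond_rate z k; have c1 := frontier_rate_le1 z k.
    have F1 : frontier_rate z k * F z x d <= 1 * F z x d by rewrite ler_wpM2r.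
    have F2 : brate z k * F z x d <= frontier_rate z k * F z x d by rewrite ler_wpM2r.
    rewrite /fbond; case: ifP => _.
      have G1 : 0 <= brate z k * F (swap k z) x d.+1 by rewrite mulr_ge0.
      have G2 : 0 <= (frontier_rate z k - brate z k) * F z x d.+1 by rewrite mulr_ge0 ?subr_ge0.
      by lra.
    have G1 : 0 <= brate z k * F (swap k z) x d by rewrite mulr_ge0.
    by lra.
  by rewrite sumrN in H6; lra.
- by have : 0 <= n%:R :> R by []; lra.
Qed.

Lemma frontier_step_le F G : (forall z x d, F z x d <= G z x d) ->
  forall z x d, frontier_step F z x d <= frontier_step G z x d.
Proof.
move=> FG z x d; have := @frontier_step_ge0 (fun z x d => G z x d - F z x d).
rewrite frontier_stepB => H; rewrite -subr_ge0; apply: H.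
by move=> z' x' d'; rewrite subr_ge0.
Qed.

Lemma iter_frontier_le t F G : (forall z x d, F z x d <= G z x d) ->
  forall z x d, iter t frontier_step F z x d <= iter t frontier_step G z x d.
Proof. by elim: t => //= t IH FG; apply: frontier_step_le; exact: IH. Qed.

Lemma iter_frontier_lin t (c e : R) F G :
  iter t frontier_step (fun z x d => c * F z x d + e * G z x d) =
  (fun z x d => c * iter t frontier_step F z x d + e * iter t frontier_step G z x d).
Proof. by elim: t => //= t ->; rewrite frontier_step_lin. Qed.

Lemma iter_frontier_proj t f :
  iter t frontier_step (fun z x _ => f z x) = (fun z x _ => iter t step f z x).
Proof. by elim: t => //= t ->; rewrite frontier_step_proj. Qed.

Section lyapunov.
Variables r delta : R.
Hypothesis r01 : 0 < r < 1.
Hypothesis delta_gt0 : 0 < delta.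
Hypothesis r_drift : forall xi, beta xi + 1 + delta <= r * alpha xi.

Let right_rate_drift z x : rb z x + 1 + delta <= r * ra z x.
Proof.
rewrite /right_rate /left_rate; case: ifP => // _; have := r_drift true.
have H : r * alpha true <= r * Lambda.
  rewrite ler_wpM2l//; first by case/andP: r01 => /ltW.
  by have := rates_le true; have := beta_ge0 true; lra.
by have := beta_ge0 true; lra.
Qed.

(** [lam] is the rate of decay of r^-d for d > 0, and [kap] is an equilibrium level: lam (kap - 1)
    bounds the gain at d = 0. *)
Let lam : R := delta * (r^-1 - 1).
Let kap : R := (Lambda + 1) * (r^-1 - 1) / lam + 1.

(* r^-d is a Lyapunov function: the distance to the frontier has drift at most
   beta + 1 - alpha < 0 as long as it is positive. *)
Lemma frontier_tail t z x d :
  iter t frontier_step (fun _ _ d => r^-1 ^+ d) z x d <= r^-1 ^+ d + kap.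
Proof.
have L1 := Lambda_ge1.
have /andP[r0 r1] := r01.
have ir1 : 1 < r^-1 by rewrite invf_gt1.
have lam0 : 0 < lam by rewrite mulr_gt0// subr_gt0.
have kap1 : 1 <= kap.
  rewrite lerDr divr_ge0 ?(ltW lam0)// mulr_ge0 ?subr_ge0 ?(ltW ir1)//; lra.
have W1 e : 1 <= r^-1 ^+ e by rewrite exprn_ege1// ltW.
have lamL : h * lam <= 1.
  have Lr : lam <= Lambda.
    have H := right_rate_drift z x; have H' : ra z x <= Lambda.
      by have := rates_sum_le a n rates_le z x; have := left_rate_ge0 a n beta_ge0 z x; lra.
    have H2 : r * ra z x <= r * Lambda by rewrite ler_wpM2l// ltW.
    have H3 : delta <= r * Lambda by have := left_rate_ge0 a n beta_ge0 z x; lra.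
    have : delta * (r^-1 - 1) <= r * Lambda * (r^-1 - 1).
      by rewrite ler_wpM2r// subr_ge0 ltW.
    rewrite -/lam => /le_trans; apply.
    rewrite mulrBr mulr1 mulrAC divff ?gt_eqF// mul1r gerBl.
    by rewrite mulr_ge0 ?(ltW r0)//; lra.
  apply: le_trans h_small; rewrite ler_wpM2l//.
  by have : 0 <= n%:R :> R by []; lra.
(* For d = 0 a right jump no longer decreases the distance, and the constant [kap] pays for the
   increase. *)
have one : forall z x d, frontier_step (fun _ _ d => r^-1 ^+ d) z x d <=
    (1 - h * lam) * r^-1 ^+ d + h * lam * kap.
  move=> {}z {}x {}d; rewrite /frontier_step.
  suff : fgen (fun _ _ e => r^-1 ^+ e) z x d <= lam * (kap - r^-1 ^+ d).
    by move=> /(ler_wpM2l h_ge0); lra.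
  have ra0 : 0 <= ra z x by exact: right_rate_ge0.
  have rb0 : 0 <= rb z x by exact: left_rate_ge0.
  have rab : ra z x + rb z x <= Lambda by exact: rates_sum_le.
  rewrite /fgen subrr mulr0 addr0.
  have HS : \sum_(i < n) fbond x d (a + i%:Z) (fun _ _ d => r^-1 ^+ d) z <=
      (r^-1 - 1) * r^-1 ^+ d.
    have H0 : 0 <= (r^-1 - 1) * r^-1 ^+ d.
      by rewrite mulr_ge0 ?subr_ge0 ?(ltW ir1)// (le_trans ler01).
    rewrite (eq_bigr (fun i : 'I_n => if a + i%:Z == x + d%:Z then
        frontier_rate z (a + i%:Z) * ((r^-1 - 1) * r^-1 ^+ d) else 0)); last first.
      by move=> i _; rewrite /fbond exprS; case: ifP => _; ring.
    have [[i im]|noi] := pselect (exists i : 'I_n, a + i%:Z == x + d%:Z).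
      rewrite (bigD1 i)//= im big1 ?addr0.
        by rewrite ler_piMl// frontier_rate_le1.
      move=> j ji; case: eqP => // jm; exfalso; move/eqP: ji; apply; apply/val_inj.
      by move/eqP : im; rewrite -jm => /addrI [] /esym.
    rewrite big1// => i _; case: eqP => // im; exfalso; apply: noi.
    by exists i; apply/eqP.
  have KE : lam * kap = (Lambda + 1) * (r^-1 - 1) + lam.
    by rewrite /kap mulrDr mulr1 mulrCA divff ?gt_eqF// mulr1.
  have RB : rb z x * (r^-1 - 1) <= Lambda * (r^-1 - 1).
    by rewrite ler_wpM2r ?subr_ge0 ?(ltW ir1)//; lra.
  case: d HS => [|d] HS /=.
    rewrite !expr0 subrr mulr0 add0r expr1 mulr1 in HS *.
    rewrite [lam * _]mulrBr KE; lra.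
  have DR := right_rate_drift z x.
  have w0 : 0 < r^-1 ^+ d by rewrite exprn_gt0// invr_gt0.
  have HL : 0 <= Lambda * (r^-1 - 1).
    by rewrite mulr_ge0 ?subr_ge0 ?(ltW ir1)//; lra.
  have E1 : ra z x * (r^-1 ^+ d - r^-1 ^+ d.+1) + rb z x * (r^-1 ^+ d.+2 - r^-1 ^+ d.+1)
     + (r^-1 - 1) * r^-1 ^+ d.+1 = (r^-1 - 1) * r^-1 ^+ d.+1 * (rb z x + 1 - r * ra z x).
    by rewrite !exprS; field; rewrite ?gt_eqF.
  have E2 : (r^-1 - 1) * r^-1 ^+ d.+1 * (rb z x + 1 - r * ra z x) <=
     (r^-1 - 1) * r^-1 ^+ d.+1 * (- delta).
    rewrite ler_wpM2l//; last by lra.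
    by rewrite mulr_ge0 ?subr_ge0 ?(ltW ir1)// (le_trans ler01).
  rewrite [lam * _]mulrBr KE.
  have E3 : (r^-1 - 1) * r^-1 ^+ d.+1 * (- delta) = - (lam * r^-1 ^+ d.+1).
    by rewrite /lam; ring.
  lra.
pose u := 1 - h * lam.
have u01 : 0 <= u <= 1 by rewrite /u subr_ge0 lamL gerBl mulr_ge0 ?(ltW lam0).
have main : forall t z x d, iter t frontier_step (fun _ _ d => r^-1 ^+ d) z x d <=
    u ^+ t * r^-1 ^+ d + (1 - u ^+ t) * kap.
  elim=> [|s IH] z' x' d'; first by rewrite expr0 mul1r subrr mul0r addr0.
  rewrite iterS.
  apply: (le_trans (frontier_step_le IH z' x' d')).
  have -> : (fun (_ : config) (_ : int) (d : nat) => u ^+ s * r^-1 ^+ d + (1 - u ^+ s) * kap) =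
     (fun z x d => u ^+ s * (fun _ _ d => r^-1 ^+ d) z x d + (1 - u ^+ s) * kap * (fun _ _ _ => 1) z x d).
    by apply/funext => ?; apply/funext => ?; apply/funext => ?; rewrite mulr1.
  rewrite (frontier_step_lin _ _ (fun _ _ d => r^-1 ^+ d)).
  have -> : frontier_step (fun _ _ _ => 1) z' x' d' = 1.
    rewrite /frontier_step /fgen !subrr !mulr0 big1 ?addr0 ?mulr0 ?addr0//.
    by move=> i _; rewrite /fbond !subrr !mulr0 addr0; case: ifP.
  have H := one z' x' d'.
  have us : 0 <= u ^+ s by rewrite exprn_ge0//; case/andP: u01.
  have := ler_wpM2l us H; rewrite -/u exprSr.
  have -> : h * lam = 1 - u by rewrite /u; ring.
  by lra.
apply: (le_trans (main t z x d)).
have /andP[u0 u1] := u01.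
have ut : 0 <= u ^+ t <= 1 by rewrite exprn_ge0// exprn_ile1.
have /andP[ut0 ut1] := ut.
have := W1 d => Wd.
have K1 : u ^+ t * r^-1 ^+ d <= 1 * r^-1 ^+ d by rewrite ler_wpM2r//; lra.
have K2 : 0 <= u ^+ t * kap by rewrite mulr_ge0//; lra.
by lra.
Qed.

End lyapunov.

End frontier.

(** * The Bernoulli law ahead of the frontier *)

Section bernoulli.
Context {R : realType}.
Variables (alpha beta : bool -> R) (Lambda p rho : R).
Variables (a : int) (n : nat) (h : R).
Implicit Types (f g : config -> R) (z : config) (x y : int) (d : nat).
Implicit Types (F G : config -> int -> nat -> R).

Local Notation b := (a + n%:Z).
Local Notation inw := (in_window a n).
Local Notation ra := (right_rate alpha Lambda a n).
Local Notation rb := (left_rate beta a n).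
Local Notation brate := (bond_rate p).
Local Notation rrate := (end_rate p rho a n).
Local Notation crate := (frontier_rate p).
Local Notation step := (chain_step alpha beta Lambda p rho a n h).
Local Notation fstep := (frontier_step alpha beta Lambda p rho a n h).

Definition win : seq int := [seq a + i%:Z | i <- iota 0 n.+1].
Definition right (m : int) : seq int := [seq y <- win | m < y].

Lemma mem_win y : (y \in win) = inw y.
Proof.
rewrite /in_window; apply/mapP/idP => [[i]|/andP[ay yb]].
  by rewrite mem_iota => /andP[_ i_n] ->; move: i_n; lia.
by exists `|y - a|%N; [rewrite mem_iota; lia | lia].
Qed.

Lemma mem_right m y : (y \in right m) = (m < y) && inw y.
Proof. by rewrite mem_filter mem_win. Qed.

Local Notation AV m := (avgs rho (right m)).

(** The Bernoulli weight is symmetric under the exchange, so a change of variables moves the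
    exchange onto the rate. What remains is the rate of the exchanged configuration minus the rate
    of the original one. *)
Lemma avg2_bond i g : avg rho i (avg rho (i + 1) (bond p i g)) =
  avg rho i (avg rho (i + 1) (fun z => (2 * p - 1) * (((z (i + 1))%:R - (z i)%:R) * g z))).
Proof.
apply/funext => z.
have E v w : swap i (upd (upd z i v) (i + 1) w) = upd (upd z i w) (i + 1) v.
  apply/funext => y; rewrite swapE !updE eqxx eq_addr1 eqxx.
  by have [->|_] := eqVneq y i; rewrite ?eq_addr1; case: (_ == i + 1).
by rewrite /avg /bond /bond_rate !E !updE !eqxx !eq_addr1 ?eqxx /=; ring.
Qed.

(** The same computation at the right end, with rho in place of the occupation of site b + 1. *)
Lemma avg_resv g : avg rho b (resv p rho a n g) =
  avg rho b (fun z => (2 * p - 1) * ((rho - (z b)%:R) * g z)).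
Proof.
apply/funext => z; rewrite /avg /resv /end_rate !updE !eqxx !upd_upd /=.
by ring.
Qed.

Section killed.
Variable G : config -> int -> nat -> R.
Hypothesis GA : forall x d z, a <= x + d%:Z -> AV (x + d%:Z) (fun z => G z x d) z = 0.

Let GA' m x d z : a <= m -> m <= x + d%:Z -> AV m (fun z => G z x d) z = 0.
Proof.
move=> am mx; rewrite -(@avgs_absorbs _ _ _ (right (x + d%:Z))); last first.
  by move=> y; rewrite !mem_right => /andP[xy ->]; rewrite andbT (le_lt_trans mx).
have -> : AV (x + d%:Z) (fun z => G z x d) = (fun=> 0).
  by apply/funext => z'; apply: GA; lia.
by rewrite avgs_const.
Qed.

Lemma killed_fbond_left m x d i : a <= m -> m = x + d%:Z -> i < m ->
  AV m (fbond p x d i G) = (fun=> 0).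
Proof.
move=> am mE im.
have -> : fbond p x d i G = (fun z => brate z i * (G (swap i z) x d - G z x d)).
  by apply/funext => z; rewrite /fbond -mE lt_eqF.
have nin : i \notin right m by rewrite mem_right; lia.
have nin1 : i + 1 \notin right m by rewrite mem_right; lia.
rewrite avgs_pull; last first.
  move=> z y v; rewrite mem_right => /andP[my _].
  rewrite /bond_rate !updE.
  have -> : (i == y) = false by lia.
  by have -> : (i + 1 == y) = false by lia.
apply/funext => z; rewrite avgsB (avgs_swap rho (fun z => G z x d) nin nin1).
by rewrite !GA' ?subrr ?mulr0// mE.
Qed.

(** After a move of the frontier the mean over the sites beyond m + 1 vanishes, so only the loss at
    rate [frontier_rate] survives. This rate is p - (2 p - 1) z(m + 1), and its constant part meets
    the mean of [G], which is 0. *)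
Lemma killed_fbond_edge m x d : a <= m -> m = x + d%:Z ->
  AV m (fbond p x d m G) =
  AV m (fun z => (2 * p - 1) * ((z (m + 1))%:R * G z x d)).
Proof.
move=> am mE.
have -> : fbond p x d m G = (fun z =>
   (brate z m * G (swap m z) x d.+1 + (crate z m - brate z m) * G z x d.+1)
   - crate z m * G z x d).
  by apply/funext => z; rewrite /fbond -mE eqxx; ring.
have sub : {subset right (m + 1) <= right m}.
  by move=> y; rewrite !mem_right => /andP[my ->]; rewrite andbT; lia.
have nin : m \notin right (m + 1) by rewrite mem_right; lia.
have nin1 : m + 1 \notin right (m + 1) by rewrite mem_right; lia.
have up z y v : y \in right (m + 1) -> upd z y v m = z m /\ upd z y v (m + 1) = z (m + 1).
  rewrite mem_right => /andP[my _]; rewrite !updE.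
  have -> : (m == y) = false by lia.
  by have -> : (m + 1 == y) = false by lia.
have Z : AV (m + 1) (fun z => G z x d.+1) = (fun=> 0).
  by apply/funext => z; rewrite GA'//; lia.
have P1 : AV (m + 1) (fun z => brate z m * G (swap m z) x d.+1) = (fun=> 0).
  rewrite avgs_pull; last first.
    by move=> z y v yin; have [e1 e2] := up z y v yin; rewrite /bond_rate e1 e2.
  rewrite (avgs_swap rho (fun z => G z x d.+1) nin nin1) Z.
  by apply/funext => z; rewrite mulr0.
have P2 : AV (m + 1) (fun z => (crate z m - brate z m) * G z x d.+1) = (fun=> 0).
  rewrite avgs_pull; last first.
    by move=> z y v yin; have [e1 e2] := up z y v yin; rewrite /bond_rate /frontier_rate e1 e2.
  by rewrite Z; apply/funext => z; rewrite mulr0.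
rewrite avgsB -(avgs_absorbs _ _ sub) avgsD P1 P2.
have -> : (fun=> 0 + 0 : R) = (fun (_ : config) => 0 : R).
  by apply/funext => z; rewrite addr0.
rewrite avgs_const.
have -> : (fun z => crate z m * G z x d) =
   (fun z => p * G z x d - (2 * p - 1) * ((z (m + 1))%:R * G z x d)).
  by apply/funext => z; rewrite /frontier_rate; case: (z (m + 1)) => /=; ring.
rewrite avgsB avgsM; apply/funext => z.
rewrite GA'//; first by ring.
by rewrite mE.
Qed.

Lemma killed_fbond_right m x d (k : nat) : m = x + d%:Z ->
  m < a + k%:Z -> (k < n)%N ->
  AV m (fbond p x d (a + k%:Z) G) = (fun z =>
    AV m (fun z => (2 * p - 1) * ((z (a + k.+1%:Z))%:R * G z x d)) z -
    AV m (fun z => (2 * p - 1) * ((z (a + k%:Z))%:R * G z x d)) z).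
Proof.
move=> mE mk kn.
have -> : fbond p x d (a + k%:Z) G = bond p (a + k%:Z) (fun z => G z x d).
  by apply/funext => z; rewrite /fbond -mE gt_eqF.
rewrite -avgsB.
have i1 : a + k%:Z \in right m by rewrite mem_right mk /in_window; lia.
have i2 : a + k%:Z + 1 \in right m by rewrite mem_right /in_window; lia.
rewrite -(avgs_absorb _ _ i2) -(avgs_absorb _ _ i1) avg2_bond.
rewrite (avgs_absorb _ _ i1) (avgs_absorb _ _ i2); congr avgs.
have -> : a + k%:Z + 1 = a + k.+1%:Z by lia.
by apply/funext => z; ring.
Qed.

(** The bonds ahead of the frontier contribute the differences [s k.+1 - s k], the frontier bond the
    first value [s mu.+1] and the right end [- s n], so the sum telescopes to 0. This is dual to the
    preservation of the Bernoulli law ahead of the frontier. *)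
Lemma killed_frontier_step x d z : a <= x + d%:Z ->
  AV (x + d%:Z) (fun z => fstep G z x d) z = 0.
Proof.
move=> am; set m := x + d%:Z in am *.
rewrite /frontier_step /fgen !(avgsD, avgsM) avgs_sum.
pose s k := AV m (fun z => (2 * p - 1) * ((z (a + k%:Z))%:R * G z x d)) z.
have -> : AV m (fun z => ra z x * (G z (x + 1) d.-1 - G z x d)) z = 0.
  rewrite avgs_pull; last first.
    move=> w y v; rewrite mem_right => /andP[my _]; rewrite /right_rate updE.
    by have -> : (x == y) = false by rewrite /m in my; lia.
  by rewrite avgsB !GA' ?subrr ?mulr0//; rewrite /m; lia.
have -> : AV m (fun z => rb z x * (G z (x - 1) d.+1 - G z x d)) z = 0.
  rewrite avgs_pull; last first.
    move=> w y v; rewrite mem_right => /andP[my _]; rewrite /left_rate updE.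
    by have -> : (x == y) = false by rewrite /m in my; lia.
  by rewrite avgsB !GA' ?subrr ?mulr0//; rewrite /m; lia.
have [mu mE] : exists mu : nat, m = a + mu%:Z by exists `|m - a|%N; lia.
have -> : \sum_(i < n) AV m (fbond p x d (a + i%:Z) G) z = if (mu < n)%N then s n else 0.
  have : forall k, (k <= n)%N -> \sum_(i < k) AV m (fbond p x d (a + i%:Z) G) z
      = if (mu < k)%N then s k else 0.
    elim=> [|k IH] kn; first by rewrite big_ord0.
    rewrite big_ord_recr/= IH ?(ltnW kn)// ltnS.
    case: (ltngtP mu k) => muk.
    - rewrite killed_fbond_right ?mE//; last by lia.
      by rewrite -mE /s addrC subrK.
    - by rewrite killed_fbond_left ?addr0//; lia.
    - rewrite -muk -mE killed_fbond_edge// /s.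
      have -> : a + mu.+1%:Z = m + 1 by lia.
      by rewrite add0r.
  exact.
have -> : AV m (fun z => rrate z * (G (upd z b (~~ z b)) x d - G z x d)) z =
    if (mu < n)%N then - s n else 0.
  case: ifPn => mun.
    have ib : b \in right m by rewrite mem_right /in_window; lia.
    rewrite -[LHS](_ : AV m (resv p rho a n (fun z => G z x d)) z = _)//.
    rewrite -(avgs_absorb _ _ ib) avg_resv (avgs_absorb _ _ ib).
    have -> : (fun z => (2 * p - 1) * ((rho - (z b)%:R) * G z x d)) =
      (fun z => (2 * p - 1) * rho * G z x d - (2 * p - 1) * ((z b)%:R * G z x d)).
      by apply/funext => w; ring.
    by rewrite avgsB avgsM GA' ?mulr0 ?sub0r//; rewrite /m; lia.
  rewrite avgs_pull; last first.
    move=> w y v; rewrite mem_right => /andP[my iy]; rewrite /end_rate updE.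
    by have -> : (b == y) = false by rewrite /in_window in iy *; lia.
  (* The frontier has reached the right end: nothing is averaged, and [G] itself vanishes. *)
  have r0 : right m = [::].
    apply/eqP; rewrite -[_ == _]negbK; apply/negP => rn0.
    have : head 0 (right m) \in right m by case: (right m) rn0 => // y l _; rewrite mem_head.
    by rewrite mem_right /in_window; lia.
  have G0 w : G w x d = 0.
    by have := GA' w am (lexx m); rewrite r0.
  by rewrite r0 /= !G0 subrr mulr0.
rewrite GA'//; case: ifP => _; ring.
Qed.

End killed.

Definition condF F z x d := AV (x + d%:Z) (fun z => F z x d) z.

(* Conditionally on the frontier and on what lies to its left, the environment
   to the right of the frontier is Bernoulli at all times. *)
Lemma iter_frontier_cond t F x d z : a <= x + d%:Z ->
  AV (x + d%:Z) (fun z => iter t fstep F z x d) z =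
  AV (x + d%:Z) (fun z => iter t fstep (condF F) z x d) z.
Proof.
move=> am; apply/eqP; rewrite -subr_eq0; apply/eqP.
pose G z x d := 1 * F z x d + (-1) * condF F z x d.
have key s : forall x d z, a <= x + d%:Z ->
    AV (x + d%:Z) (fun z => iter s fstep G z x d) z = 0.
  elim: s => [|s IH] x' d' z' am' /=; last exact: killed_frontier_step.
  rewrite /G avgs_lin /condF avgs_absorbs//; ring.
have := key t x d z am; rewrite /G iter_frontier_lin avgs_lin => <-; ring.
Qed.

Section decoupling.
Variables (r delta : R).
Hypothesis p01 : 0 <= p <= 1.
Hypothesis rho01 : 0 <= rho <= 1.
Hypothesis alpha_ge0 : forall xi, 0 <= alpha xi.
Hypothesis beta_ge0 : forall xi, 0 <= beta xi.
Hypothesis Lambda_ge1 : 1 <= Lambda.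
Hypothesis rates_le : forall xi, alpha xi + beta xi <= Lambda.
Hypothesis h_ge0 : 0 <= h.
Hypothesis h_small : h * (2 * (n%:R + 1 + Lambda)) <= 1.
Hypothesis r01 : 0 < r < 1.
Hypothesis delta_gt0 : 0 < delta.
Hypothesis r_drift : forall xi, beta xi + 1 + delta <= r * alpha xi.
Hypothesis a_le0 : a <= 0.

Definition window_mean f : R := avgs rho win f (fun=> false).

Lemma window_mean_le f g : (forall z, f z <= g z) -> window_mean f <= window_mean g.
Proof. by move=> fg; apply: avgs_le. Qed.

Lemma window_mean_cst c : window_mean (fun=> c) = c.
Proof. by rewrite /window_mean avgs_const. Qed.

Lemma window_meanDcst f c : window_mean (fun z => f z + c) = window_mean f + c.
Proof. by rewrite /window_mean avgsD avgs_const. Qed.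

Lemma avgs_window_mean m f : loc a n (fun z (_ : int) => f z) ->
  (forall z z', (forall y, m < y -> z y = z' y) -> f z = f z') ->
  forall z, AV m f z = window_mean f.
Proof.
move=> fl fm z.
have cst z1 z2 : AV m f z1 = AV m f z2.
  apply: (@avgs_dep _ _ pred0) => // z' z'' zz /=.
  pose w y := if m < y then z' y else z'' y.
  transitivity (f w).
    by apply: fm => y my; rewrite /w my.
  apply: (fl _ _ 0) => y iy; rewrite /w; case: ifP => // my.
  by apply: zz => /=; rewrite mem_right my iy.
rewrite /window_mean -(@avgs_absorbs _ _ win (right m)); last first.
  by move=> y; rewrite mem_filter => /andP[].
have -> : AV m f = (fun=> AV m f z) by apply/funext => z'; exact: cst.
by rewrite avgs_const.
Qed.

Let lam : R := delta * (r^-1 - 1).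
(** The constant [kap] of [frontier_tail]. *)
Definition tail_cst : R := (Lambda + 1) * (r^-1 - 1) / lam + 1.

Lemma tail_cst_ge0 : 0 <= tail_cst.
Proof.
have L1 := Lambda_ge1; have /andP[r0 r1] := r01.
have ir1 : 1 < r^-1 by rewrite invf_gt1.
rewrite addr_ge0// divr_ge0 ?mulr_ge0 ?subr_ge0 ?(ltW ir1) ?(ltW delta_gt0)//; lra.
Qed.

(* The environment at distance at least j in front of the walker is almost
   Bernoulli and independent of the past of the walker. *)
Lemma fresh_environment t (H : config -> int -> R) (M : R) (j : nat) :
  (forall z x, `|H z x| <= M) -> loc a n H ->
  (forall z z' x, (forall y, x + j%:Z <= y -> z y = z' y) -> H z x = H z' x) ->
  window_mean (fun z => iter t step H z 0) <=
  window_mean (fun z => iter t step (fun _ x => window_mean (fun z => H z x)) z 0) +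
  2 * M * r ^+ j * (1 + tail_cst).
Proof.
move=> HM Hl Hj; have /andP[r0 r1] := r01.
have M0 : 0 <= M by apply: le_trans (HM (fun=> false) 0).
(* Once the frontier has come as far as the sites read by [H], [H] is replaced by its upper
   bound. *)
pose F1 z x d := if (d < j)%N then H z x else M.
pose Hbar (z : config) x := window_mean (fun z => H z x).
have HbarM z x : `|Hbar z x| <= M.
  rewrite ler_norml -{1}[- M]window_mean_cst -{2}[M]window_mean_cst; apply/andP; split.
    by apply: window_mean_le => z'; have := HM z' x; rewrite ler_norml => /andP[].
  by apply: window_mean_le => z'; have := HM z' x; rewrite ler_norml => /andP[].
have HF z x d : H z x <= F1 z x d.
  by rewrite /F1; case: ifP => // _; have := HM z x; rewrite ler_norml => /andP[].
have W0 d : 0 < r^-1 ^+ d by rewrite exprn_gt0// invr_gt0.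
(* For d < j all sites read by [H] lie beyond the frontier and the conditional mean is [Hbar]; for d
   >= j the weight [r ^+ j * r^-1 ^+ d] is at least 1. *)
have FH z x d : condF F1 z x d <= 1 * Hbar z x + 2 * M * r ^+ j * r^-1 ^+ d.
  rewrite /condF /F1; case: ltnP => dj.
    rewrite avgs_window_mean ?mul1r ?lerDl//.
    - by rewrite mulr_ge0 ?(ltW (W0 d))// mulr_ge0 ?exprn_ge0 ?(ltW r0)// mulr_ge0.
    - by move=> z1 z2 _ zz; apply: Hl.
    - by move=> z1 z2 zz; apply: Hj => y xy; apply: zz; move: dj xy; clear; lia.
  rewrite avgs_const -mulrA.
  have H1 : 1 <= r ^+ j * r^-1 ^+ d.
    rewrite -(subnK dj) exprD mulrCA -exprMn divff ?gt_eqF// expr1n mulr1.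
    by rewrite exprn_ege1// invf_ge1// ltW.
  have H2 : 2 * M * 1 <= 2 * M * (r ^+ j * r^-1 ^+ d) by rewrite ler_wpM2l ?mulr_ge0.
  by have := HbarM z x; rewrite ler_norml => /andP[? ?]; lra.
have fle := @iter_frontier_le R alpha beta Lambda p rho a n h p01 rho01 alpha_ge0 beta_ge0
  Lambda_ge1 rates_le h_ge0 h_small t.
have S1 z : iter t step H z 0 <= iter t fstep F1 z 0 0%N.
  rewrite -[leLHS](_ : iter t fstep (fun z x _ => H z x) z 0 0%N = _); last first.
    by rewrite iter_frontier_proj.
  by apply: fle.
have S2 z : iter t fstep (condF F1) z 0 0%N <=
    iter t step Hbar z 0 + 2 * M * r ^+ j * (1 + tail_cst).
  apply: (le_trans (fle _ _ FH z 0 0%N)).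
  rewrite (iter_frontier_lin _ _ _ _ _ _ _ _ t 1 _ (fun z x d => Hbar z x)
     (fun _ _ d => r^-1 ^+ d)) iter_frontier_proj mul1r lerD2l ler_wpM2l//.
    by rewrite ?mulr_ge0// exprn_ge0// ltW.
  have := frontier_tail a p01 rho01 alpha_ge0 beta_ge0 Lambda_ge1 rates_le h_ge0
    h_small r01 delta_gt0 r_drift t z 0 0%N.
  by rewrite expr0 /tail_cst.
have sub : {subset right 0 <= win} by move=> y; rewrite mem_filter => /andP[].
rewrite -window_meanDcst.
apply: (@le_trans _ _ (window_mean (fun z => iter t fstep F1 z 0 0%N))); first exact: window_mean_le.
rewrite /window_mean -(avgs_absorbs _ _ sub).
(* The frontier starts at the walker, at site 0, and the sites beyond it are averaged from the
   start. *)
have -> : AV 0 (fun z => iter t fstep F1 z 0 0%N) =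
    AV 0 (fun z => iter t fstep (condF F1) z 0 0%N).
  by apply/funext => z; have := @iter_frontier_cond t F1 0 0%N z; rewrite addr0; apply.
rewrite (avgs_absorbs _ _ sub).
exact: window_mean_le.
Qed.

End decoupling.
End bernoulli.

(* r is such that r^x is a supermartingale for the walk relative to a frontier
   of speed at most 1; the walk outruns any such frontier since alpha - beta > 1. *)
Record model {R : realType} (alpha beta : bool -> R) (Lambda p rho r delta : R) :
    Prop := Model {
  model_p : 0 <= p <= 1 ;
  model_rho : 0 <= rho <= 1 ;
  model_alpha : forall xi, 0 <= alpha xi ;
  model_beta : forall xi, 0 <= beta xi ;
  model_Lambda : 1 <= Lambda ;
  model_rates : forall xi, alpha xi + beta xi <= Lambda ;
  model_r : 0 < r < 1 ;
  model_delta : 0 < delta ;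
  model_drift : forall xi, beta xi + 1 + delta <= r * alpha xi
}.

(** * Decoupling *)

Section finite_volume.
Context {R : realType}.
Variables (alpha beta : bool -> R) (Lambda p rho r delta : R).
Hypothesis mod : model alpha beta Lambda p rho r delta.
Implicit Types (f : config -> int -> R) (g : int -> R) (z : config) (x y a : int).
Implicit Types (h : R) (n : nat).
Local Notation step := (chain_step alpha beta Lambda p rho).
Local Notation emu := (window_mean rho).

Definition small_step n h : Prop := 0 <= h /\ h * (2 * (n%:R + 1 + Lambda)) <= 1.

Definition evolve a n h t g : config -> int -> R := iter t (step a n h) (fun=> g).

Let p01 := model_p mod.
Let rho01 := model_rho mod.
Let alpha_ge0 := model_alpha mod.
Let beta_ge0 := model_beta mod.
Let Lambda_ge1 := model_Lambda mod.
Let rates_le := model_rates mod.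
Let r01 := model_r mod.
Let delta_gt0 := model_delta mod.
Let r_drift := model_drift mod.

Lemma evolve_norm a n h t g M : small_step n h ->
  (forall x, `|g x| <= M) -> forall z x, `|evolve a n h t g z x| <= M.
Proof.
move=> [h0 h1] gM; elim: t => [|t IH] z x; first exact: gM.
by rewrite /evolve iterS; apply: step_norm.
Qed.

Lemma evolve_loc a n h t g : small_step n h -> loc a n (evolve a n h t g).
Proof.
move=> [h0 h1]; elim: t => [|t IH] z z' x zz'; first by [].
by rewrite /evolve iterS; apply: (step_loc alpha beta (Lambda := Lambda)).
Qed.

Lemma evolve_incr a n h t g : small_step n h -> (forall x, g x <= g (x + 1)) ->
  forall z x, evolve a n h t g z x <= evolve a n h t g z (x + 1).
Proof.
move=> [h0 h1] gi; elim: t => [|t IH] z x; first exact: gi.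
rewrite /evolve iterS; apply: (@step_incr _ alpha beta Lambda) => //.
Qed.

Lemma evolve_incrn a n h t g (k : nat) : small_step n h -> (forall x, g x <= g (x + 1)) ->
  forall z x, evolve a n h t g z x <= evolve a n h t g z (x + k%:Z).
Proof.
move=> hs gi z x; elim: k => [|k IH]; first by rewrite addr0.
apply: (le_trans IH); have -> : x + k.+1%:Z = x + k%:Z + 1 by lia.
exact: evolve_incr.
Qed.

(** For u = r the growth rate in [step_influence] is at most 0 by the drift condition, so the
    influence of what lies behind the walker is bounded uniformly in time. *)
Lemma evolve_left a n h t g M : small_step n h -> (forall x, `|g x| <= M) ->
  influence true r (2 * M) (evolve a n h t g).
Proof.
move=> hs gM; have [h0 h1] := hs.
have /andP[r0 r1] := r01.
have M0 : 0 <= M by apply: le_trans (gM 0).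
elim: t => [|t IH].
  move=> m z z' x _; rewrite /evolve /= subrr.
  by rewrite mulr_ge0 ?mulr_ge0// exprz_ge0// ltW.
have := @step_influence R alpha beta Lambda p rho a n h p01 rho01 alpha_ge0 beta_ge0
  Lambda_ge1 rates_le h0 h1 true r (2 * M) M 0 (evolve a n h t g).
rewrite mulr0 addr0 mulr1; apply=> //.
- by rewrite r0 ltW.
- by move=> z x; exact: evolve_norm.
- move=> z x.
  have D : left_rate beta a n z x + 1 + delta <= r * right_rate alpha Lambda a n z x.
    rewrite /right_rate /left_rate; case: ifP => // _; have H1 := r_drift true.
    have H : r * alpha true <= r * Lambda.
      rewrite ler_wpM2l ?(ltW r0)//.
      by have H2 := rates_le true; have H3 := beta_ge0 true; lra.
    by have H3 := beta_ge0 true; lra.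
  have -> : right_rate alpha Lambda a n z x * (r - 1) + left_rate beta a n z x * (r^-1 - 1) + (r^-1 - 1)
     = r^-1 * ((1 - r) * (left_rate beta a n z x + 1 - r * right_rate alpha Lambda a n z x)).
    by field; rewrite gt_eqF.
  rewrite pmulr_rle0 ?invr_gt0// pmulr_rle0 ?subr_gt0//.
  by have d0 := delta_gt0; lra.
Qed.

(** The drift towards the sites ahead makes their influence grow with time, here at rate
    [Lambda + 1] for the convenient value u = 1 / 2. This suffices for a fixed time in a large
    window. *)
Lemma evolve_right a n h t g M : small_step n h -> (forall x, `|g x| <= M) ->
  influence false 2^-1 (2 * M * (1 + h * (Lambda + 1)) ^+ t) (evolve a n h t g).
Proof.
move=> hs gM; have [h0 h1] := hs; have L1 := Lambda_ge1.
have M0 : 0 <= M by apply: le_trans (gM 0).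
elim: t => [|t IH].
  move=> m z z' x _; rewrite /evolve /= subrr.
  by rewrite mulr_ge0 ?mulr_ge0// exprz_ge0// ltW.
rewrite exprSr mulrA.
apply: (step_influence p01 rho01 alpha_ge0 beta_ge0 Lambda_ge1 rates_le h0 h1 (M := M)) => //.
- by apply/andP; split; lra.
- lra.
- rewrite ler_peMr ?mulr_ge0// exprn_ege1// lerDl mulr_ge0//; lra.
- by move=> z x; exact: evolve_norm.
- move=> z x; rewrite invrK.
  have H1 := rates_sum_le a n rates_le z x.
  have H2 := left_rate_ge0 a n beta_ge0 z x.
  lra.
Qed.

(* Subadditivity: restarting the walk 2 j sites ahead of its current position
   can only help, and there the environment is fresh. *)
Lemma evolve_decouple a n h s t g M (j : nat) : a <= 0 -> small_step n h ->
  (forall x, `|g x| <= M) -> (forall x, g x <= g (x + 1)) ->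
  emu a n (fun z => evolve a n h (s + t) g z 0) <=
  emu a n (fun z => evolve a n h s
    (fun x => emu a n (fun z => evolve a n h t g z (x + (2 * j)%:Z))) z 0) +
  2 * M * r ^+ j * (3 + tail_cst Lambda r delta).
Proof.
move=> a0 hs gM gi; have [h0 h1] := hs; have /andP[r0 r1] := r01.
have M0 : 0 <= M by apply: le_trans (gM 0).
pose G := evolve a n h t g.
(* The configuration is erased behind x + j so that [fresh_environment] applies. The walker restarts
   another j sites ahead, where the erased part hardly matters by [evolve_left]. *)
pose tr x z : config := fun y => if x + j%:Z <= y then z y else false.
pose H z x := G (tr x z) (x + (2 * j)%:Z).
have GM z x : `|G z x| <= M by exact: evolve_norm.
have close z z' x : (forall y, x + j%:Z <= y -> z y = z' y) ->
    G z (x + (2 * j)%:Z) <= G z' (x + (2 * j)%:Z) + 2 * M * r ^+ j.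
  move=> zz'; rewrite -lerBlDl.
  have ag : agree true (x + j%:Z - 1) z z' by move=> y /= ys; apply: zz'; move: ys; clear; lia.
  have IG : influence true r (2 * M) G by exact: evolve_left.
  apply: (le_trans (IG _ _ _ _ ag)); rewrite ler_wpM2l ?mulr_ge0//.
  rewrite /depth; have -> : x + (2 * j)%:Z - (x + j%:Z - 1) = j.+1%:Z by clear; lia.
  by rewrite -exprnP exprS ler_piMl ?exprn_ge0 ?ltW.
have trE z x y : x + j%:Z <= y -> tr x z y = z y by rewrite /tr => ->.
have le_it f f' : (forall z x, f z x <= f' z x) ->
    forall z x, iter s (step a n h) f z x <= iter s (step a n h) f' z x.
  move=> ff'; elim: s => //= s' IH z x; apply: step_le => //; exact: h1.
have it_cst f c z x : iter s (step a n h) (fun z x => f z x + c) z x =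
    iter s (step a n h) f z x + c.
  elim: {le_it} s z x => //= s' IH z x.
  have -> : iter s' (step a n h) (fun z x => f z x + c) =
     (fun z x => 1 * iter s' (step a n h) f z x + c * (fun _ _ => 1) z x).
    by apply/funext => ?; apply/funext => ?; rewrite IH mul1r mulr1.
  rewrite step_lin mul1r; congr (_ + _).
  rewrite /chain_step /gen /resv /bond !subrr !mulr0 big1 ?addr0 ?mulr0 ?addr0 ?mulr1//.
  by move=> i _; rewrite ?subrr ?mulr0.
have S1 : emu a n (fun z => evolve a n h (s + t) g z 0) <=
    emu a n (fun z => iter s (step a n h) H z 0) + 2 * M * r ^+ j.
  rewrite -window_meanDcst; apply: window_mean_le => // z; rewrite /evolve iterD -it_cst.
  apply: le_it => {}z x; apply: (le_trans (evolve_incrn _ _ (2 * j) hs gi z x)).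
  by apply: close => y xy; rewrite trE.
have S2 := @fresh_environment R alpha beta Lambda p rho a n h r delta p01 rho01 alpha_ge0
  beta_ge0 Lambda_ge1 rates_le h0 h1 r01 delta_gt0 r_drift a0 s H M j.
have {}S2 := S2 (fun z x => GM _ _).
(* The constant [3 + tail_cst]: one error [close] for erasing, one for restoring the configuration,
   and [1 + tail_cst] from [fresh_environment]. *)
apply: (le_trans S1); apply: (@le_trans _ _ (emu a n (fun z => evolve a n h s
    (fun x => emu a n (fun z => evolve a n h t g z (x + (2 * j)%:Z))) z 0) +
    2 * M * r ^+ j + 2 * M * r ^+ j * (1 + tail_cst Lambda r delta) + 2 * M * r ^+ j)); last first.
  by lra.
rewrite lerD2r; apply: (le_trans (S2 _ _)).
- move=> z z' x zz'; apply: evolve_loc => // y yw; rewrite /tr; case: ifP => // _; exact: zz'.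
- move=> z z' x zz'; rewrite /H; congr G; apply/funext => y; rewrite /tr.
  by case: ifP => // xy; rewrite zz'.
rewrite lerD2r -window_meanDcst; apply: window_mean_le => // z; rewrite -it_cst.
apply: le_it => {}z x; rewrite -window_meanDcst; apply: window_mean_le => // {}z.
by apply: close => y xy; rewrite trE.
Qed.

Definition shift_cfg (y : int) z : config := fun v => z (v - y).

Lemma shift_swap y i z : shift_cfg y (swap i z) = swap (i + y) (shift_cfg y z).
Proof.
apply/funext => v; rewrite /shift_cfg !swapE.
have -> : (v - y == i) = (v == i + y) by lia.
have -> : (v - y == i + 1) = (v == i + y + 1) by lia.
have -> : i + y + 1 - y = i + 1 by lia.
by have -> : i + y - y = i by lia.
Qed.

Lemma shift_upd y z v b : shift_cfg y (upd z v b) = upd (shift_cfg y z) (v + y) b.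
Proof.
apply/funext => x; rewrite /shift_cfg !updE.
by have -> : (x - y == v) = (x == v + y) by lia.
Qed.

Lemma step_shift a n h y f :
  step a n h (fun z x => f (shift_cfg y z) (x + y)) =
  (fun z x => step (a + y) n h f (shift_cfg y z) (x + y)).
Proof.
apply/funext => z; apply/funext => x.
have Sz v : shift_cfg y z (v + y) = z v.
  by rewrite /shift_cfg; congr z; lia.
rewrite /chain_step /gen; congr (_ + _ * (_ + _ + _)).
- have iw : in_window (a + y) n (x + y) = in_window a n x by rewrite /in_window; lia.
  have -> : x + 1 + y = x + y + 1 by rewrite addrAC.
  have -> : x - 1 + y = x + y - 1 by rewrite addrAC.
  by rewrite /right_rate /left_rate iw Sz.
- apply: eq_bigr => i _; rewrite /bond shift_swap.
  have -> : a + i%:Z + y = a + y + i%:Z by lia.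
  congr (_ * _); rewrite /bond_rate.
  have -> : a + y + i%:Z = a + i%:Z + y by lia.
  rewrite Sz; have -> : a + i%:Z + y + 1 = a + i%:Z + 1 + y by lia.
  by rewrite Sz.
- rewrite /resv shift_upd /end_rate.
  have -> : a + y + n%:Z = a + n%:Z + y by lia.
  by rewrite Sz.
Qed.

(** Reduces a walk started away from 0 to a walk started from 0 in a translated window. *)
Lemma evolve_shift a n h t g y z x :
  evolve a n h t (fun x => g (x + y)) z x =
  evolve (a + y) n h t g (shift_cfg y z) (x + y).
Proof.
suff -> : evolve a n h t (fun x => g (x + y)) =
    (fun z x => evolve (a + y) n h t g (shift_cfg y z) (x + y)) by [].
elim: t => // t IH.
by rewrite /evolve iterS -/(evolve a n h t _) IH step_shift.
Qed.

Lemma window_mean_shift a n y (f : config -> R) :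
  emu a n (fun z => f (shift_cfg y z)) = emu (a + y) n f.
Proof.
rewrite /window_mean.
suff H l z : avgs rho l (fun z => f (shift_cfg y z)) z =
    avgs rho [seq v + y | v <- l] f (shift_cfg y z).
  rewrite H; congr (avgs _ _ _ _).
  rewrite /win -map_comp; apply: eq_map => i /=; lia.
elim: l z => //= v l IH z.
by rewrite /avg !IH !shift_upd.
Qed.

End finite_volume.

(** * Poisson points and the exclusion process *)

Section real_probability.
Context {R : realType} {dd : measure_display} {Omega : measurableType dd}.
Variable P : probability Omega R.
Implicit Types A B : set Omega.

Definition prob A : R := fine (P A).

Lemma prE A : measurable A -> P A = (prob A)%:E.
Proof. by move=> mA; rewrite /prob fineK// fin_num_measure. Qed.

Lemma pr_ge0 A : 0 <= prob A.
Proof. exact: fine_ge0. Qed.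

Lemma pr_le1 A : measurable A -> prob A <= 1.
Proof. by move=> mA; rewrite -lee_fin -prE// probability_le1. Qed.

Lemma pr_setT : prob setT = 1.
Proof. by rewrite /prob probability_setT. Qed.

Lemma pr_set0 : prob set0 = 0.
Proof. by rewrite /prob measure0. Qed.

Lemma prU A B : measurable A -> measurable B -> A `&` B = set0 ->
  prob (A `|` B) = prob A + prob B.
Proof.
move=> mA mB AB; apply: EFin_inj; rewrite EFinD -!prE//; last exact: measurableU.
exact: measureU.
Qed.

Lemma pr_le A B : measurable A -> measurable B -> A `<=` B -> prob A <= prob B.
Proof. by move=> mA mB AB; rewrite -lee_fin -!prE// le_measure// inE. Qed.

Lemma pr_setC A : measurable A -> prob (~` A) = 1 - prob A.
Proof.
by move=> mA; apply: EFin_inj; rewrite EFinB -!prE ?probability_setC//; exact: measurableC.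
Qed.

Lemma pr_split A B : measurable A -> measurable B ->
  prob A = prob (A `&` B) + prob (A `&` ~` B).
Proof.
move=> mA mB; rewrite -prU.
- by rewrite -setIUr setUv setIT.
- exact: measurableI.
- by apply: measurableI => //; exact: measurableC.
- by rewrite setIACA setICr setI0.
Qed.

Lemma pr_leU A B : measurable A -> measurable B -> prob (A `|` B) <= prob A + prob B.
Proof.
move=> mA mB; have -> : A `|` B = A `|` (B `&` ~` A).
  by rewrite setUIr setUv setIT.
have mBA : measurable (B `&` ~` A) by apply: measurableI => //; exact: measurableC.
rewrite prU//; last by rewrite setICA setICr setI0.
by rewrite lerD2l pr_le.
Qed.

Lemma pr_bigU (I : Type) (s : seq I) (F : I -> set Omega) :
  (forall i, measurable (F i)) ->
  prob (\big[setU/set0]_(i <- s) F i) <= \sum_(i <- s) prob (F i).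
Proof.
move=> mF; elim: s => [|i s IH]; first by rewrite !big_nil pr_set0.
rewrite !big_cons; apply: (le_trans (pr_leU _ _)) => //.
  exact: bigsetU_measurable.
by rewrite lerD2l.
Qed.

Lemma pr_le_cases A B C : measurable A -> measurable B -> measurable C ->
  A `<=` B `|` C -> prob A <= prob B + prob C.
Proof.
move=> mA mB mC ABC; apply: le_trans (pr_leU mB mC).
by apply: pr_le => //; exact: measurableU.
Qed.

End real_probability.

Section poisson_boxes.
Context {R : realType} {dd : measure_display} {Omega : measurableType dd}.
Variable P : probability Omega R.
Variables (Lambda : R) (Pi : Omega -> set (int * R * R)).
Hypothesis PP : poisson_process P (driving_space Lambda) driving_intensity Pi.
Local Notation pr := (prob P).

Definition box (y : int) (s t : R) (U : interval R) : set (int * R * R) :=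
  ([set y] `*` [set` `]s, t]]) `*` [set` U].

Definition point_in (B : set (int * R * R)) (w : Omega) : bool :=
  point_count (R := R) Pi B w != 0%E.

Lemma measurable_box y s t U : measurable (box y s t U).
Proof. by apply: measurableX => //; apply: measurableX. Qed.

Lemma intensity_box y s t u v (c : bool) : s <= t -> u <= v ->
  driving_intensity (box y s t (Interval (BSide c u) (BRight v))) = ((t - s) * (v - u))%:E.
Proof.
move=> st uv; rewrite /driving_intensity /box product_measure1E//; last exact: measurableX.
rewrite [X in (X * _)%E]product_measure1E//.
have cE : counting [set y] = 1%E :> \bar R.
  rewrite /counting; case: asboolP => [_|/(_ (finite_set1 _))//].
  by rewrite fset_set1 cardfs1.
rewrite [X in (X * _ * _)%E](_ : _ = 1%E)// mul1e.
rewrite [X in (X * _)%E]lebesgue_measure_itv [X in (_ * X)%E]lebesgue_measure_itv /= !lte_fin.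
have D (x y' : R) : x <= y' -> (if x < y' then (y'%:E - x%:E)%E else 0%E) = (y' - x)%:E.
  by move=> xy; case: ltgtP xy => // -> _; rewrite subrr.
by rewrite !D.
Qed.

Lemma box_sub y s t u v (c : bool) : 0 <= s -> 0 <= u -> v <= Lambda ->
  box y s t (Interval (BSide c u) (BRight v)) `<=` driving_space Lambda.
Proof.
move=> s0 u0 vL [[x t'] u'] [] [] /= _; rewrite !in_itv/= => /andP[st _] /andP[uu uv].
split=> /=; first exact: le_trans (ltW st).
by rewrite (le_trans uv vL) (le_trans u0)//; case: c uu => // /ltW.
Qed.

Lemma measurable_point_in B u : measurable B -> measurable [set w | point_in B w = u].
Proof.
move=> mB.
have H : measurable (point_count (R := R) Pi B @^-1` [set 0%E]).
  rewrite -[X in measurable X]setTI; apply: (poisson_measurable PP) => //.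
have -> : [set w | point_in B w = u] =
    if u then ~` (point_count (R := R) Pi B @^-1` [set 0%E])
    else point_count (R := R) Pi B @^-1` [set 0%E].
  apply/seteqP; case: u; split=> w /=; rewrite /point_in.
  - by move/eqP.
  - by move/eqP.
  - by move/negbFE/eqP.
  - by move=> ->; rewrite eqxx.
by case: u => //; exact: measurableC.
Qed.

Lemma poisson_prob0 (mu : R) : 0 <= mu -> poisson_prob mu 0 [set 0%N] = (expR (- mu))%:E.
Proof.
rewrite le_eqVlt => /predU1P[<-|mu0].
  (* For intensity 0 the law is the Dirac mass at 0; this covers boxes of height 0, where [alpha] or
     [beta] vanishes. *)
  by rewrite /poisson_prob ltxx oppr0 expR0 diracE mem_set.
rewrite /poisson_prob mu0 esum_set1 ?lee_fin ?poisson_pmf_ge0//.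
by rewrite /poisson_pmf mu0 expr0 fact0 invr1 !mul1r.
Qed.

Lemma poisson_prob1 (mu : R) : 0 <= mu ->
  poisson_prob mu 1 [set 1%N] = (mu * expR (- mu))%:E.
Proof.
rewrite le_eqVlt => /predU1P[<-|mu0].
  by rewrite /poisson_prob ltxx mul0r diracE memNset.
rewrite /poisson_prob mu0 esum_set1 ?lee_fin ?poisson_pmf_ge0//.
by rewrite /poisson_pmf mu0 expr1 invr1 mulr1.
Qed.

Lemma pr_hit B (mu : R) u : measurable B -> B `<=` driving_space Lambda -> 0 <= mu ->
  driving_intensity B = mu%:E ->
  pr [set w | point_in B w = u] = if u then 1 - expR (- mu) else expR (- mu).
Proof.
move=> mB BD mu0 BE.
have H : pr [set w | point_in B w = false] = expR (- mu).
  have := @poisson_law _ _ _ _ _ _ _ _ _ PP B mB BD.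
  rewrite BE /= => /(_ (ltry _) 0%N); rewrite poisson_prob0// => H0.
  rewrite -[RHS]/(fine (expR (- mu))%:E) -H0; congr (fine (P _)).
  by apply/seteqP; split=> w /=; rewrite /point_in; [move/negbFE/eqP|move=> ->; rewrite eqxx].
case: u => //; rewrite -H -pr_setC; last exact: measurable_point_in.
by congr pr; apply/seteqP; split=> w /=; case: (point_in B w).
Qed.

(** From exp(-mu) >= 1 - mu: 1 - exp(-mu) (1 + mu) <= 1 - (1 - mu) (1 + mu) = mu^2. *)
Lemma pr_hit2 B (mu : R) : measurable B -> B `<=` driving_space Lambda -> 0 <= mu ->
  driving_intensity B = mu%:E ->
  measurable [set w | ~ (point_count (R := R) Pi B w <= 1)%E] /\
  pr [set w | ~ (point_count (R := R) Pi B w <= 1)%E] <= mu ^+ 2.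
Proof.
move=> mB BD mu0 BE.
have mc (x : \bar R) : measurable [set w | point_count (R := R) Pi B w = x].
  rewrite -[X in measurable X]setTI; apply: (poisson_measurable PP mB _ (emeasurable_set1 x)) => //.
have m2 : measurable [set w | ~ (point_count (R := R) Pi B w <= 1)%E].
  have -> : [set w | ~ (point_count (R := R) Pi B w <= 1)%E] =
     ~` (setT `&` (point_count (R := R) Pi B @^-1` [set x | (x <= 1)%E])).
    by rewrite setTI.
  apply: measurableC; apply: (poisson_measurable PP) => //.
  have -> : [set x : \bar R | (x <= 1)%E] = [set` `]-oo, 1%E]].
    by apply/seteqP; split=> x /=; rewrite in_itv.
  exact: emeasurable_itv.
split=> //.
have E k : pr [set w | point_count (R := R) Pi B w = k%:R%:E] = fine (poisson_prob mu k [set k]).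
  have := @poisson_law _ _ _ _ _ _ _ _ _ PP B mB BD.
  by rewrite BE /= => /(_ (ltry _) k); rewrite /prob => ->.
have : pr [set w | ~ (point_count (R := R) Pi B w <= 1)%E] +
   (pr [set w | point_count (R := R) Pi B w = 0%:R%:E] +
    pr [set w | point_count (R := R) Pi B w = 1%:R%:E]) <= 1.
  rewrite -prU//; last first.
    by apply/seteqP; split=> w //= [->] [] /eqP; rewrite eq_sym oner_eq0.
  rewrite -prU//; last first.
    apply/seteqP; split=> w //= [H] [] H'; apply: H; rewrite H' lee_fin//.
  - exact: measurableU.
  - by apply: pr_le1; apply: measurableU => //; exact: measurableU.
rewrite !E poisson_prob0// poisson_prob1//=.
have := expR_ge1Dx (- mu) => H.
have : (1 + - mu) * (1 + mu) <= expR (- mu) * (1 + mu) by rewrite ler_wpM2r// addr_ge0.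
lra.
Qed.

Lemma pr_hits (s : seq (set (int * R * R) * bool)) :
  (forall x, x \in s -> measurable x.1) ->
  (forall x, x \in s -> x.1 `<=` driving_space Lambda) ->
  pairwise (fun x y => `[< x.1 `&` y.1 = set0 >]) s ->
  pr [set w | forall x, x \in s -> point_in x.1 w = x.2] =
  \prod_(x <- s) pr [set w | point_in x.1 w = x.2].
Proof.
move=> ms Ds ps; pose x0 : set (int * R * R) * bool := (set0, true).
pose C (u : bool) : set (\bar R) := if u then ~` [set 0%E] else [set 0%E].
have CE B u w : (point_count (R := R) Pi B @^-1` C u) w <-> point_in B w = u.
  rewrite /C /point_in; case: u => /=.
    by split => [/eqP//|/eqP].
  by split => [->|/negbFE/eqP//]; rewrite eqxx.
pose n := size s; pose B (i : 'I_n) := (nth x0 s i).1.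
have := @poisson_indep _ _ _ _ _ _ _ _ _ PP n B _ _ _ (fun i => C (nth x0 s i).2).
move=> /(_ (fun i => ms _ (mem_nth _ (ltn_ord i)))).
move=> /(_ (fun i => Ds _ (mem_nth _ (ltn_ord i)))).
have tB : trivIset [set: 'I_n] B.
  move=> i j _ _ [w [Bi Bj]].
  have D (i' j' : 'I_n) : (i' < j')%N -> B i' w -> B j' w -> False.
    move=> ij Bi' Bj'.
    have := pairwiseP x0 ps i' j' (ltn_ord _) (ltn_ord _) ij => /asboolP BB.
    by have : (B i' `&` B j') w by []; rewrite /B BB.
  apply/val_inj => /=; case: (ltngtP i j) => // ij; first by case: (D _ _ ij Bi Bj).
  by case: (D _ _ ij Bj Bi).
have mC (i : 'I_n) : measurable (C (nth x0 s i).2).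
  by rewrite /C; case: (nth x0 s i).2 => //; exact: measurableC.
move=> /(_ tB mC).
have -> : \bigcap_(i in [set: 'I_n]) (point_count (R := R) Pi (B i) @^-1` C (nth x0 s i).2) =
    [set w | forall x, x \in s -> point_in x.1 w = x.2].
  apply/seteqP; split=> w /= H.
    move=> x xs; have ix : (index x s < n)%N by rewrite index_mem.
    by have := H (Ordinal ix) I; rewrite CE /B/= nth_index.
  by move=> i _; rewrite CE; apply: H; exact: mem_nth.
move=> HP; apply: EFin_inj; rewrite /prob fineK HP; last first.
  apply/prode_fin_num => i _; rewrite fin_num_measure//.
  rewrite -[X in measurable X]setTI.
  exact: (poisson_measurable PP (ms _ (mem_nth _ (ltn_ord i)))).
rewrite -prodEFin (big_nth x0) big_mkord; apply: eq_bigr => i _.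
rewrite fineK; last by rewrite fin_num_measure//; apply: measurable_point_in; exact: ms (mem_nth _ (ltn_ord i)).
by congr (P _); apply/seteqP; split=> w /CE.
Qed.

End poisson_boxes.

(** * Functions of finitely many sites *)

Section patterns.
Context {R : realType}.
Implicit Types (l : seq int) (f g : config -> R) (z s : config).

Definition agreeb l z s : bool := all (fun y => z y == s y) l.

Definition dep l f : Prop := forall z z', (forall y, y \in l -> z y = z' y) -> f z = f z'.

(** Representatives of the patterns on [l], empty elsewhere. They turn a function of the sites in
    [l] into a finite sum of indicators, and its expectation into a finite sum of probabilities. *)
Fixpoint pats l : seq config :=
  if l is y :: l' then
    [seq upd z y true | z <- pats l'] ++ [seq upd z y false | z <- pats l']
  else [:: (fun=> false)].

Lemma depW l l' f : {subset l <= l'} -> dep l f -> dep l' f.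
Proof. by move=> ll fl z z' zz; apply: fl => y /ll/zz. Qed.

Lemma pats_sum l f z : uniq l -> dep l f ->
  f z = \sum_(s <- pats l) f s * (agreeb l z s)%:R.
Proof.
elim: l f => [|y l IH] f /=.
  by move=> _ fl; rewrite big_seq1 mulr1; exact: fl.
move=> /andP[yl ul] fl; rewrite big_cat/= !big_map.
have E v : \sum_(s <- pats l) f (upd s y v) * (agreeb (y :: l) z (upd s y v))%:R =
    if z y == v then f z else 0.
  have agE s : agreeb (y :: l) z (upd s y v) = (z y == v) && agreeb l z s.
    rewrite /agreeb /= updE eqxx; congr (_ && _); apply: eq_in_all => x xl.
    by rewrite updE; have -> : (x == y) = false by apply: contraNF yl => /eqP <-.
  case: eqP => zv; last first.
    rewrite big1// => s _; rewrite agE.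
    by have /eqP/negbTE -> := zv; rewrite mulr0.
  have -> : f z = f (upd z y v).
    by apply: fl => x _; rewrite updE; case: eqP => // ->.
  rewrite (IH (fun z => f (upd z y v)))//.
    by apply: eq_bigr => s _; rewrite agE zv eqxx.
  move=> s s' ss; apply: fl => x; rewrite inE !updE.
  by case: eqP => //= _; exact: ss.
by rewrite !E; case: (z y); rewrite ?addr0 ?add0r.
Qed.

End patterns.

(** * Events of the environment *)

Section config_sigma_lemmas.
Context {R : realType} {dd : measure_display} {Omega : measurableType dd}.
Variable eta : R -> Omega -> config.
Implicit Types (I J : set R) (A B : set Omega).

Lemma config_sigmaI I A B : config_sigma eta I A -> config_sigma eta I B ->
  config_sigma eta I (A `&` B).
Proof.
move=> IA IB.
exact: (@measurableI _ (g_sigma_algebraType [set [set w | eta z.1 w z.2 = true] | z in I `*` [set: int]]) A B).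
Qed.

Lemma config_sigmaT I : config_sigma eta I setT.
Proof.
exact: (@measurableT _ (g_sigma_algebraType [set [set w | eta z.1 w z.2 = true] | z in I `*` [set: int]])).
Qed.

Lemma config_sigma_site I t y b : I t -> config_sigma eta I [set w | eta t w y = b].
Proof.
move=> It.
have H : config_sigma eta I [set w | eta t w y = true].
  by apply: sub_sigma_algebra; exists (t, y).
case: b => //.
have -> : [set w | eta t w y = false] = ~` [set w | eta t w y = true].
  by apply/seteqP; split=> w /=; case: (eta t w y).
exact: (@measurableC _ (g_sigma_algebraType [set [set w | eta z.1 w z.2 = true] | z in I `*` [set: int]])).
Qed.

Lemma config_sigmaW I J : I `<=` J -> config_sigma eta I `<=` config_sigma eta J.
Proof.
move=> IJ; apply: sub_sigma_algebra2 => _ [[t y] [/= It _] <-].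
by exists (t, y) => //; split => //=; exact: IJ.
Qed.

Definition cyl (l : seq int) (t : R) (s : config) : set Omega :=
  [set w | agreeb l (eta t w) s].

Lemma config_sigma_cyl I l t s : I t -> config_sigma eta I (cyl l t s).
Proof.
move=> It; elim: l => [|y l IH].
  by rewrite (_ : cyl _ _ _ = setT); [exact: config_sigmaT|apply/seteqP; split].
rewrite (_ : cyl _ _ _ = [set w | eta t w y = s y] `&` cyl l t s).
  by apply: config_sigmaI => //; exact: config_sigma_site.
apply/seteqP; split=> w /=; rewrite /cyl/= /agreeb/=.
  by move=> /andP[/eqP].
by move=> [-> ->]; rewrite eqxx.
Qed.

Hypothesis meta : forall t x, 0 <= t -> measurable_fun [set: Omega] (fun w => eta t w x).

Lemma config_sigma_measurable I A : I `<=` [set t | 0 <= t] ->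
  config_sigma eta I A -> measurable A.
Proof.
move=> I0; apply: smallest_sub; first exact: sigma_algebra_measurable.
move=> _ [[t y] [/= It _] <-].
have := meta y (I0 _ It) measurableT (Y := [set true]).
by rewrite setTI; apply.
Qed.

Lemma measurable_cyl l t s : 0 <= t -> measurable (cyl l t s).
Proof.
by move=> t0; apply: (@config_sigma_measurable [set t]) => [_ ->//|]; exact: config_sigma_cyl.
Qed.

Lemma measurable_site t y b : 0 <= t -> measurable [set w | eta t w y = b].
Proof.
move=> t0; apply: (@config_sigma_measurable [set t]) => [_ ->//|].
exact: config_sigma_site.
Qed.

Variable P : probability Omega R.
Local Notation pr := (prob P).

Definition env_mean (f : config -> R) (t : R) (H : set Omega) : R :=
  fine (\int[P]_(w in H) (f (eta t w))%:E).

Lemma integral_dep l f t H : uniq l -> dep l f -> 0 <= t -> measurable H ->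
  (\int[P]_(w in H) (f (eta t w))%:E =
   (\sum_(s <- pats l) f s * pr (H `&` cyl l t s))%:E)%E.
Proof.
move=> ul fl t0 mH.
have E w : (f (eta t w))%:E =
    (\sum_(s <- pats l) (f s)%:E * (\1_(cyl l t s) w)%:E)%E.
  rewrite (pats_sum (eta t w) ul fl) -sumEFin; apply: eq_bigr => s _.
  rewrite EFinM indicE; congr (_ * _%:R%:E)%E.
  by congr nat_of_bool; apply/idP/idP; rewrite inE.
under eq_integral do rewrite E.
have ic s : P.-integrable H (fun w => (\1_(cyl l t s) w)%:E).
  apply: (@integrableS _ _ _ P setT) => //.
  by apply: integrable_indic; exact: measurable_cyl.
rewrite (@integral_sum _ _ _ _ _ mH _ (fun s w => (f s)%:E * (\1_(cyl l t s) w)%:E)%E); last first.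
  by move=> s; exact: integrableZl.
rewrite -sumEFin; apply: eq_bigr => s _.
rewrite integralZl// integral_indic//; last exact: measurable_cyl.
rewrite EFinM setIC; congr (_ * _)%E; apply: prE.
by apply: measurableI => //; exact: measurable_cyl.
Qed.

Lemma env_meanE l f t H : uniq l -> dep l f -> 0 <= t -> measurable H ->
  env_mean f t H = \sum_(s <- pats l) f s * pr (H `&` cyl l t s).
Proof. by move=> ul fl t0 mH; rewrite /env_mean (integral_dep ul fl). Qed.

Lemma sum_cyl l t H : uniq l -> 0 <= t -> measurable H ->
  \sum_(s <- pats l) pr (H `&` cyl l t s) = pr H.
Proof.
move=> ul t0 mH.
have E : (\int[P]_(w in H) 1%:E = (pr H)%:E)%E.
  by rewrite integral_cst// mul1e; exact: prE.
have := @integral_dep l (fun=> 1) t H ul (fun _ _ _ => erefl) t0 mH.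
rewrite E => H1; rewrite (EFin_inj H1); apply: eq_bigr => s _; by rewrite mul1r.
Qed.

End config_sigma_lemmas.

(** * The exclusion generator on a window *)

Section generator.
Context {R : realType}.
Variable p : R.
Variable S : R -> (config -> R) -> (config -> R).
Hypothesis ES : exclusion_semigroup p S.
Implicit Types (f : config -> R) (z : config) (a : int) (n : nat).

Definition gen0 a n f z : R := \sum_(i < n) bond p (a + i%:Z) f z.

Lemma dep_local l f : dep l f -> local_fun f.
Proof.
by move=> fl; exists [fset x in l]%fset => z z' zz; apply: fl => y yl; apply: zz; rewrite inE.
Qed.

Lemma uniq_win a n : uniq (win a n).
Proof. by rewrite map_inj_uniq ?iota_uniq// => i j /addrI []. Qed.

Lemma swap_dep a n f i z : dep (win a n) f -> ~~ (a - 1 <= i <= a + n%:Z) ->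
  f (swap i z) = f z.
Proof.
move=> fw iw; apply: fw => y; rewrite mem_win /in_window => yw; rewrite swapE.
have -> : (y == i) = false by lia.
by have -> : (y == i + 1) = false by lia.
Qed.

(** Only neighbouring pairs contribute, the two orders of a pair merge into [bond], and exchanges
    that do not touch the window leave [f] unchanged. The bonds that remain start at a - 1, ..., a +
    n, which makes n + 2 of them. *)
Lemma exclusion_generator_window a n f z : dep (win a n) f ->
  exclusion_generator p f z = gen0 (a - 1) n.+2 f z.
Proof.
move=> fw; pose F (xy : int * int) : R := jump_kernel p xy.1 xy.2 * (z xy.1)%:R *
  (1 - (z xy.2)%:R) * (f (exchange xy.1 xy.2 z) - f z).
pose J := [seq a - 1 + i%:Z | i <- iota 0 n.+2].
have uJ : uniq J by rewrite map_inj_uniq ?iota_uniq// => i j /addrI [].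
pose s := [seq (i, i + 1) | i <- J] ++ [seq (i + 1, i) | i <- J].
have us : uniq s.
  have u1 : uniq [seq (i, i + 1) | i <- J] by rewrite map_inj_uniq// => x y [].
  have u2 : uniq [seq (i + 1, i) | i <- J] by rewrite map_inj_uniq// => x y [].
  rewrite cat_uniq u1 u2 andbT andTb; apply/hasPn => _ /mapP[i _ ->]; apply/mapP => -[j _ [ij ji]].
  by move: ij ji; clear; lia.
have exC (x y : int) : exchange x y z = exchange y x z.
  apply/funext => v; rewrite /exchange; case: (eqVneq v x) => [->|_]; last by [].
  by case: eqP => // ->.
have memJ i : (i \in J) = (a - 1 <= i <= a + n%:Z).
  apply/mapP/idP => [[k]|iJ].
    by rewrite mem_iota => /andP[_ kn] ->; move: kn; clear; lia.
  exists (absz (i - (a - 1) : int)%R); first by rewrite mem_iota; move: iJ; clear; lia.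
  by move: iJ; clear; lia.
rewrite /exclusion_generator -/F.
have -> : \sum_(xy \in [set: int * int]) F xy = \sum_(xy <- s) F xy.
  rewrite (@fsbigE _ _ _ _ _ s F us)//; first by apply: eq_bigl => xy; rewrite in_setT.
  move=> [x y] _; apply: contraNeq; rewrite /F /= mulf_eq0 !mulf_eq0 !negb_or.
  move=> /andP[/andP[/andP[jk _] _] df].
  have fdf i : f (swap i z) - f z != 0 -> i \in J.
    by rewrite memJ; apply: contraR => iJ; rewrite (swap_dep _ fw)// subrr.
  rewrite mem_cat; move: jk; rewrite /jump_kernel.
  have [yx _|_] := eqVneq y (x + 1).
    apply/orP; left; apply/mapP; exists x; last by rewrite yx.
    by apply: fdf; rewrite /swap -yx.
  have [yx _|_] := eqVneq y (x - 1); last by rewrite eqxx.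
  have xy : x = y + 1 by rewrite yx; clear; lia.
  apply/orP; right; apply/mapP; exists y; last by rewrite xy.
  by apply: fdf; rewrite /swap -xy exC.
have -> : \sum_(xy <- s) F xy = \sum_(x <- J) (F (x, x + 1) + F (x + 1, x)).
  move: (J) @s {us memJ uJ} => J' /=.
  by rewrite big_cat big_split /= !big_map.
rewrite /J big_map /gen0 -(big_mkord xpredT
  (fun i => bond p (a - 1 + i%:Z) f z)) /index_iota subn0.
apply: eq_bigr => i _; set x := a - 1 + i%:Z.
rewrite /F /= /jump_kernel eqxx.
have -> : (x == x + 1 + 1) = false by clear; lia.
have -> : (x == x + 1 - 1) = true by clear; lia.
rewrite [exchange (x + 1) x z]exC -/(swap x z) /bond /bond_rate.
by case: (z x); case: (z (x + 1)) => /=; ring.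
Qed.

End generator.

(** * The Markov property over a short time step *)

Section generator_approximation.
Context {R : realType}.
Variable p : R.
Variable S : R -> (config -> R) -> (config -> R).
Hypothesis ES : exclusion_semigroup p S.
Implicit Types (f : config -> R) (z : config) (a : int) (n : nat).

Lemma uniform_near (F : R -> config -> R) (g : config -> R) (e : R) :
  {uniform, F t @[t --> 0^'+] --> g} -> 0 < e ->
  \forall t \near 0^'+, forall z, `|F t z - g z| < e.
Proof.
move=> Fg e0.
have := Fg [set k : config -> R | forall z, `|k z - g z| < e].
apply; apply/uniform_nbhs.
exists [set xy | `|xy.1 - xy.2| < e]; split; first exact: entourage_ball (PosNum e0).
by move=> k /= H z; rewrite distrC; exact: H.
Qed.

Lemma dep_continuous l f : dep l f -> continuous f.
Proof. by move=> /dep_local fl; have [] := ES.2 _ fl. Qed.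

Lemma semigroup_sum h (I : Type) (s : seq I) (c : I -> R) (F : I -> config -> R) :
  0 <= h -> (forall i, continuous (F i)) ->
  continuous (fun z => \sum_(i <- s) c i * F i z) /\
  S h (fun z => \sum_(i <- s) c i * F i z) = (fun z => \sum_(i <- s) c i * S h (F i) z).
Proof.
move=> h0 cF; have FS := ES.1.
have c1 : continuous (fun _ : config => 1 : R) by move=> ?; exact: cvg_cst.
elim: s => [|i s [IHc IHS]].
  have E : (fun z : config => \sum_(i <- [::]) c i * F i z) = (fun z => (-1) * 1 + 1).
    by apply/funext => z; rewrite big_nil; ring.
  rewrite E; split; first by move=> ?; exact: cvg_cst.
  rewrite (feller_linear FS (-1) h0 c1 c1) (feller_cst1 FS h0).
  by apply/funext => z; rewrite big_nil; ring.
have E : (fun z => \sum_(j <- i :: s) c j * F j z) =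
   (fun z => c i * F i z + \sum_(j <- s) c j * F j z).
  by apply/funext => z; rewrite big_cons.
rewrite E; split.
  by move=> z; apply: cvgD; [apply: cvgMr; exact: cF|exact: IHc].
rewrite (feller_linear FS (c i) h0 (cF i) IHc) IHS.
by apply/funext => z; rewrite big_cons.
Qed.

Definition ind l (s : config) z : R := (agreeb l z s)%:R.

Lemma ind_dep l s : dep l (ind l s).
Proof.
by move=> z z' zz; congr (_%:R); congr nat_of_bool; apply: eq_in_all => y /zz ->.
Qed.

Lemma gen0_sum a n (s : seq config) (c : config -> R) (F : config -> config -> R) z :
  gen0 p a n (fun z => \sum_(i <- s) c i * F i z) z = \sum_(i <- s) c i * gen0 p a n (F i) z.
Proof.
rewrite /gen0; under [RHS]eq_bigr do rewrite mulr_sumr.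
rewrite exchange_big/=; apply: eq_bigr => i _.
rewrite /bond -sumrB mulr_sumr; apply: eq_bigr => j _; ring.
Qed.

(** [exclusion_semigroup] gives the derivative at time 0 for each function separately. It is uniform
    over the functions of the window because these are spanned by finitely many indicators of
    patterns. *)
Lemma generator_approx a n (e : R) : 0 < e ->
  \forall h \near 0^'+, forall f M, dep (win a n) f -> (forall z, `|f z| <= M) ->
    forall z, `|S h f z - (f z + h * gen0 p (a - 1) n.+2 f z)| <= h * e * M.
Proof.
move=> e0; set l := win a n; set L := pats l.
have L0 : 0 < (size L)%:R + 1 :> R by rewrite ltr_wpDl.
pose e' := e / ((size L)%:R + 1).
have e'0 : 0 < e' by rewrite divr_gt0.
have H s : \forall h \near 0^'+, forall z,
    `|h^-1 * (S h (ind l s) z - ind l s z) - gen0 p (a - 1) n.+2 (ind l s) z| < e'.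
  apply: uniform_near => //.
  have := ES.2 _ (dep_local (@ind_dep l s)) => -[_].
  have -> // : exclusion_generator p (ind l s) = gen0 p (a - 1) n.+2 (ind l s).
  by apply/funext => z; apply: exclusion_generator_window; exact: ind_dep.
have HL : forall K : seq config, \forall h \near 0^'+, forall s, s \in K -> forall z,
    `|h^-1 * (S h (ind l s) z - ind l s z) - gen0 p (a - 1) n.+2 (ind l s) z| < e'.
  elim=> [|s K IH]; first by near=> h => s.
  near=> h => s'; rewrite inE => /predU1P[->|sK].
    by near: h; exact: H.
  by move: s' sK; near: h; exact: IH.
near=> h => f M fl fM z.
have h0 : 0 < h by [].
have M0 : 0 <= M by apply: le_trans (fM z).
have fE : f = (fun z => \sum_(s <- L) f s * ind l s z).
  by apply/funext => {}z; rewrite (pats_sum z (uniq_win a n) fl).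
have := @semigroup_sum h _ L f (ind l) (ltW h0).
move=> /(_ (fun s => dep_continuous (@ind_dep l s))) [_ HS].
have E1 : S h f z = \sum_(s <- L) f s * S h (ind l s) z by rewrite {1}fE HS.
have E2 : f z = \sum_(s <- L) f s * ind l s z by rewrite (pats_sum z (uniq_win a n) fl).
have E3 : gen0 p (a - 1) n.+2 f z = \sum_(s <- L) f s * gen0 p (a - 1) n.+2 (ind l s) z.
  by rewrite {1}fE gen0_sum.
rewrite E1 E3 E2 mulr_sumr -big_split/= -sumrB.
have -> : h * e * M = \sum_(s <- L) (h * e * M / (size L)%:R).
  rewrite big_const_seq iter_addr addr0 count_predT -[_ *+ _]mulr_natr divfK//.
  rewrite pnatr_eq0 size_eq0 /L.
  by elim: (l) => //= y l' IH; case: (pats l') IH.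
apply: (le_trans (ler_norm_sum _ _ _)); rewrite big_seq [leRHS]big_seq.
apply: ler_sum => s sL.
have Hs : `|h^-1 * (S h (ind l s) z - ind l s z) - gen0 p (a - 1) n.+2 (ind l s) z| < e'.
  by move: s sL z {E1 E2 E3}; near: h; exact: HL.
have -> : f s * S h (ind l s) z - (f s * ind l s z + h * (f s * gen0 p (a - 1) n.+2 (ind l s) z))
  = h * f s * (h^-1 * (S h (ind l s) z - ind l s z) - gen0 p (a - 1) n.+2 (ind l s) z).
  by field; rewrite gt_eqF.
rewrite !normrM (ger0_norm (ltW h0)).
have sz0 : 0 < (size L)%:R :> R by rewrite ltr0n; case: (L) sL.
have e'e : e' <= e / (size L)%:R.
  by rewrite /e' ler_pM2l// lef_pV2 ?posrE// lerDl.
rewrite -!mulrA ler_pM2l//; have -> : e * (M / (size L)%:R) = M * (e / (size L)%:R) by ring.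
by apply: ler_pM => //; exact: le_trans (ltW Hs) e'e.
Unshelve. all: by end_near. Qed.

Section markov.
Context {dd : measure_display} {Omega : measurableType dd}.
Variable P : probability Omega R.
Variable eta : R -> Omega -> config.
Hypothesis meta : forall t x, 0 <= t -> measurable_fun [set: Omega] (fun w => eta t w x).
Hypothesis ME : markov_process P S eta.

Definition trunc (N : nat) z : config := fun y => if `|y| <= N%:Z then z y else false.

Lemma trunc_cvg z : trunc N z @[N --> \oo] --> z.
Proof.
apply/(@pointwise_cvgP int bool) => y; apply: cvg_near_cst.
exists (absz y) => // N /= yN; rewrite /trunc; case: ifP => // /negP []; lia.
Qed.

Lemma measurable_dep l f t : uniq l -> dep l f -> 0 <= t ->
  measurable_fun [set: Omega] (fun w => f (eta t w)).
Proof.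
move=> ul fl t0.
have -> : (fun w => f (eta t w)) = (fun w => \sum_(s <- pats l) f s * \1_(cyl eta l t s) w).
  apply/funext => w; rewrite (pats_sum (eta t w) ul fl); apply: eq_bigr => s _.
  rewrite indicE; congr (_ * _%:R).
  by congr nat_of_bool; apply/idP/idP; rewrite inE.
apply: measurable_sum => s; apply: measurable_funM => //.
by apply: measurable_indic; exact: measurable_cyl.
Qed.

(** Needed for [S h f], which may depend on infinitely many sites while measurability is known for
    single sites: a continuous function is the pointwise limit of its values on truncated
    configurations. *)
Lemma measurable_continuous f t : continuous f -> 0 <= t ->
  measurable_fun [set: Omega] (fun w => f (eta t w)).
Proof.
move=> cf t0.
apply: (@measurable_fun_cvg _ _ _ _ (fun N w => f (trunc N (eta t w)))).
  move=> N; apply: (@measurable_dep (win (- N%:Z) (2 * N)) (fun z => f (trunc N z))) => //.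
    exact: uniq_win.
  move=> z z' zz; congr f; apply/funext => y; rewrite /trunc; case: ifP => // yN.
  by apply: zz; rewrite mem_win /in_window; move: yN; clear; lia.
move=> w _; apply: (cvg_comp _ _ (@trunc_cvg (eta t w))); exact: cf.
Qed.

Lemma markov_approx a n f t h e M A : dep (win a n) f -> (forall z, `|f z| <= M) ->
  (forall z, `|S h f z - (f z + h * gen0 p (a - 1) n.+2 f z)| <= h * e * M) ->
  0 <= t -> 0 <= h -> 0 <= e -> config_sigma eta `[0, t] A ->
  `|env_mean eta P f (t + h) A - env_mean eta P (fun z => f z + h * gen0 p (a - 1) n.+2 f z) t A| <=
  h * e * M * prob P A.
Proof.
move=> fl fM fS t0 h0 e0 tA.
have M0 : 0 <= M by apply: le_trans (fM (fun=> false)).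
have mA : measurable A.
  apply: (config_sigma_measurable meta _ tA) => x /=.
  by rewrite in_itv/= => /andP[].
set g := fun z => _ in fS *.
rewrite /env_mean (ME t0 h0 (dep_continuous fl) tA).
have gl : dep (win (a - 1) n.+2) g.
  have win_sub : {subset win a n <= win (a - 1) n.+2}.
    by move=> y; rewrite !mem_win /in_window; clear; lia.
  move=> z z' zz; rewrite /g (depW win_sub fl zz); congr (_ + _ * _).
  apply: eq_bigr => i _; rewrite /bond (depW win_sub fl zz).
  have [iw|iw] := boolP (a - 1 <= a - 1 + i%:Z <= a + n%:Z).
    have i1 : a - 1 + i%:Z \in win (a - 1) n.+2 by rewrite mem_win /in_window; move: iw; clear; lia.
    have i2 : a - 1 + i%:Z + 1 \in win (a - 1) n.+2.
      by rewrite mem_win /in_window; move: iw; clear; lia.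
    rewrite /bond_rate !zz//; congr (_ * (_ - _)); apply: (depW win_sub fl) => y yw.
    by rewrite !swapE !zz.
  by rewrite !(swap_dep _ fl iw) (depW win_sub fl zz) !subrr !mulr0.
have FS := ES.1.
have mS : measurable_fun setT (fun w => S h f (eta t w)).
  by apply: measurable_continuous => //; apply: (feller_continuous FS) => //; exact: dep_continuous fl.
have mg : measurable_fun setT (fun w => g (eta t w)).
  by apply: measurable_dep gl _ => //; exact: uniq_win.
have bnd (u : config -> R) C : (forall z, `|u z| <= C) ->
    measurable_fun setT (fun w => u (eta t w)) ->
    P.-integrable A (fun w => (u (eta t w))%:E).
  move=> uC mu; apply: measurable_bounded_integrable => //.
  - exact: le_lt_trans (probability_le1 P mA) (ltry _).
  - exact: measurable_funTS.
  - exists C; split; first exact: num_real.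
    by move=> x Cx w _ /=; exact: le_trans (uC _) (ltW Cx).
have [C gC] : exists C, forall z, `|g z| <= C.
  exists (\sum_(s <- pats (win (a - 1) n.+2)) `|g s|) => z.
  rewrite (pats_sum z (uniq_win _ _) gl); apply: (le_trans (ler_norm_sum _ _ _)).
  apply: ler_sum => s _; rewrite normrM ler_piMr// normr_nat.
  by case: agreeb; rewrite ?ler01.
have ig : P.-integrable A (fun w => (g (eta t w))%:E) by exact: bnd gC mg.
have iS : P.-integrable A (fun w => (S h f (eta t w))%:E).
  apply: (@bnd _ (C + h * e * M)) => // z.
  rewrite -(subrK (g z) (S h f z)) addrC; apply: (le_trans (ler_normD _ _)).
  by apply: lerD.
rewrite -lee_fin.
have fi (u : Omega -> R) : P.-integrable A (fun w => (u w)%:E) ->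
    (fine (\int[P]_(w in A) (u w)%:E))%:E = (\int[P]_(w in A) (u w)%:E)%E.
  by move=> iu; rewrite fineK//; exact: integrable_fin_num.
rewrite -abse_EFin EFinB !fi// -integralB_EFin//.
apply: (le_trans (le_abse_integral _ _ _)) => //.
  apply/measurable_EFinP; apply: measurable_funTS; exact: measurable_funB.
rewrite EFinM -prE//; apply: integral_le_bound => //.
- apply/measurable_EFinP; apply: measurable_funTS; exact: measurable_funB.
- by rewrite lee_fin !mulr_ge0.
- by apply: aeW => w _ /=; rewrite lee_fin.
Qed.

End markov.
End generator_approximation.

(** * Euler schemes *)

Section euler.
Context {R : realType}.
Variables (alpha beta : bool -> R) (Lambda p rho r delta : R).
Hypothesis mod : model alpha beta Lambda p rho r delta.
Context {dd : measure_display} {Omega : measurableType dd}.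
Variables (P : probability Omega R) (eta : R -> Omega -> config)
  (Pi : Omega -> set (int * R * R)).
Hypothesis SE : simple_exclusion P p rho eta.
Hypothesis PP : poisson_process P (driving_space Lambda) driving_intensity Pi.
Hypothesis IN : independent_sigma P (config_sigma eta `[0, +oo[) (points_sigma (R := R) Pi).
Variable h : R.
Hypothesis h_gt0 : 0 < h.

Implicit Types (i : nat) (y : int) (b : bool) (e : bool * bool) (w : Omega).
Local Notation pr := (prob P).
Local Notation hit := (point_in Pi).

Definition grid i : R := i%:R * h.

(** The boxes exist for both occupation values b and so do not depend on the environment; [steps]
    selects a pair of them by the occupation at the start of the strip. *)
Definition rbox i y b := box y (grid i) (grid i.+1) (Interval (BLeft 0) (BRight (alpha b))).
Definition lbox i y b :=
  box y (grid i) (grid i.+1) (Interval (BRight (alpha b)) (BRight (alpha b + beta b))).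

Definition bits i y b w : bool * bool := (hit (rbox i y b) w, hit (lbox i y b) w).

Definition disp e : int := (e.1 : nat)%:Z - (e.2 : nat)%:Z.

Definition pos (l : seq (bool * bool)) : int := \sum_(e <- l) disp e.

(* The steps, most recent first, of the walk which reads the environment and the
   Poisson points only at the times i h. *)
Fixpoint steps i w : seq (bool * bool) :=
  if i is i'.+1 then
    let y := pos (steps i' w) in bits i' y (eta (grid i') w y) w :: steps i' w
  else [::].

(** The law of the bit that tells whether a box of intensity mu contains a Poisson point. *)
Definition qbit (mu : R) (u : bool) : R := if u then 1 - expR (- mu) else expR (- mu).

Definition step_prob b e : R := qbit (h * alpha b) e.1 * qbit (h * beta b) e.2.

Lemma qbit01 (mu : R) u : 0 <= mu -> 0 <= qbit mu u <= 1.
Proof.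
move=> mu0; have : expR (- mu) <= 1 by rewrite -expR0 ler_expR oppr_le0.
by have := expR_ge0 (- mu); rewrite /qbit; case: u => ? ?; apply/andP; split; lra.
Qed.

Lemma step_prob_ge0 b e : 0 <= step_prob b e.
Proof.
have h0 := ltW h_gt0.
have /andP[H _] := @qbit01 (h * alpha b) e.1 (mulr_ge0 h0 (model_alpha mod b)).
have /andP[H' _] := @qbit01 (h * beta b) e.2 (mulr_ge0 h0 (model_beta mod b)).
exact: mulr_ge0.
Qed.

(** A site, the occupation value that selects the boxes, and the two bits required of them. A list
    of prescriptions concerns successive strips. *)
Definition prescription : Type := (int * bool * (bool * bool))%type.

Fixpoint fut i (l : seq prescription) : set Omega :=
  if l is x :: l' then [set w | bits i x.1.1 x.1.2 w = x.2] `&` fut i.+1 l' else setT.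

Fixpoint boxes i (l : seq prescription) : seq (set (int * R * R) * bool) :=
  if l is x :: l' then
    [:: (rbox i x.1.1 x.1.2, x.2.1), (lbox i x.1.1 x.1.2, x.2.2) & boxes i.+1 l']
  else [::].

Definition qp (l : seq prescription) : R := \prod_(x <- l) step_prob x.1.2 x.2.

Lemma grid_ge0 i : 0 <= grid i.
Proof. by rewrite mulr_ge0// ltW. Qed.

Lemma grid_lt i : grid i < grid i.+1.
Proof. by rewrite ltr_pM2r// ltr_nat. Qed.

Lemma gridS i : grid i.+1 = grid i + h.
Proof. by rewrite /grid -natr1 mulrDl mul1r. Qed.

Lemma grid_le i j : (i <= j)%N -> grid i <= grid j.
Proof. by move=> ij; rewrite ler_pM2r// ler_nat. Qed.

Lemma rbox_sub i y b : rbox i y b `<=` driving_space Lambda.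
Proof.
apply: box_sub => //; first exact: grid_ge0.
by have := model_rates mod b; have := model_beta mod b; lra.
Qed.

Lemma lbox_sub i y b : lbox i y b `<=` driving_space Lambda.
Proof.
by apply: box_sub; [exact: grid_ge0|exact: (model_alpha mod)|exact: (model_rates mod)].
Qed.

Lemma boxes_time i l (x : set (int * R * R) * bool) : x \in boxes i l -> forall z, x.1 z -> grid i < z.1.2.
Proof.
elim: l i => // y l IH i /=; rewrite !inE => /or3P[/eqP->|/eqP->|/IH H] z /=.
- by move=> [] [_] /=; rewrite in_itv/= => /andP[].
- by move=> [] [_] /=; rewrite in_itv/= => /andP[].
- by move=> /H; exact: lt_trans (grid_lt i).
Qed.

Lemma boxesP i l (x : set (int * R * R) * bool) : x \in boxes i l -> measurable x.1 /\ x.1 `<=` driving_space Lambda.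
Proof.
elim: l i => // y l IH i /=; rewrite !inE => /or3P[/eqP->|/eqP->|/IH//] /=.
- by split; [exact: measurable_box|exact: rbox_sub].
- by split; [exact: measurable_box|exact: lbox_sub].
Qed.

Lemma boxes_disjoint i l :
  pairwise (fun x y : set (int * R * R) * bool => `[< x.1 `&` y.1 = set0 >]) (boxes i l).
Proof.
elim: l i => // y l IH i /=; rewrite IH andbT -andbA; apply/and3P; split.
- apply/asboolP/seteqP; split=> // -[[x t] u] [] [_ /=].
  by rewrite in_itv/= => /andP[_ ua] [_ /=]; rewrite in_itv/= ltNge ua.
- apply/allP => x xb; apply/asboolP/seteqP; split=> // z [] [] [_] /=.
  by rewrite in_itv/= => /andP[_ zt] _ /(boxes_time xb); rewrite ltNge zt.
- apply/allP => x xb; apply/asboolP/seteqP; split=> // z [] [] [_] /=.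
  by rewrite in_itv/= => /andP[_ zt] _ /(boxes_time xb); rewrite ltNge zt.
Qed.

Lemma futE i l : fut i l = [set w | forall x : set (int * R * R) * bool, x \in boxes i l -> hit x.1 w = x.2].
Proof.
elim: l i => [|y l IH] i /=; first by apply/seteqP; split.
rewrite IH; apply/seteqP; split=> w /=.
  move=> [hy H] [B u]; rewrite !inE => /or3P[/eqP[-> ->]|/eqP[-> ->]|/H//] /=.
    by rewrite -hy.
  by rewrite -hy.
move=> H; split; last by move=> [B u] xl; apply: H; rewrite !inE xl !orbT.
rewrite /bits (H (rbox i y.1.1 y.1.2, y.2.1)) ?mem_head//.
rewrite (H (lbox i y.1.1 y.1.2, y.2.2)) ?inE ?eqxx ?orbT//.
by case: (y.2).
Qed.

Lemma pr_fut i l : pr (fut i l) = qp l.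
Proof.
rewrite futE (pr_hits PP); last 3 first.
- by move=> x /boxesP[].
- by move=> x /boxesP[].
- exact: boxes_disjoint.
rewrite /qp; elim: l i => [|x l IH] i; first by rewrite !big_nil.
rewrite !big_cons IH mulrA; congr (_ * _); rewrite /step_prob /=.
have h0 := ltW h_gt0; have a0 := model_alpha mod x.1.2; have b0 := model_beta mod x.1.2.
have iE (u v : R) c : u <= v -> driving_intensity (box x.1.1 (grid i) (grid i.+1)
    (Interval (BSide c u) (BRight v))) = (h * (v - u))%:E.
  move=> uv; rewrite intensity_box// ?ltW ?grid_lt//.
  by rewrite gridS addrAC subrr add0r.
congr (_ * _).
  rewrite (pr_hit PP _ (measurable_box _ _ _ _) (@rbox_sub _ _ _) (mulr_ge0 h0 a0))//.
  by rewrite iE// subr0.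
rewrite (pr_hit PP _ (measurable_box _ _ _ _) (@lbox_sub _ _ _) (mulr_ge0 h0 b0))//.
by rewrite iE ?lerDl// addrAC subrr add0r.
Qed.

Lemma measurable_bits i y b e : measurable [set w | bits i y b w = e].
Proof.
have -> : [set w | bits i y b w = e] =
    [set w | hit (rbox i y b) w = e.1] `&` [set w | hit (lbox i y b) w = e.2].
  apply/seteqP; split=> w /=; first by move=> <-.
  by case: e => e1 e2 /= [<- <-].
by apply: measurableI; apply: (measurable_point_in PP); exact: measurable_box.
Qed.

Lemma measurable_fut i l : measurable (fut i l).
Proof.
elim: l i => [|x l IH] i //=; apply: measurableI => //; exact: measurable_bits.
Qed.

Lemma points_sigma_fut i l : points_sigma (R := R) Pi (fut i l).
Proof.
rewrite /points_sigma; set G := (X in <<s X>>).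
have hitG (B : set (int * R * R)) u : measurable B -> <<s G>> [set w | hit B w = u].
  move=> mB; apply: sub_sigma_algebra; exists B, (if u then ~` [set 0%E] else [set 0%E]).
  split => //; first by case: u => //; exact: measurableC.
  apply/seteqP; split=> w; rewrite /point_in /=; case: u => /=.
  - by move/eqP.
  - by move/negbFE/eqP.
  - by move/eqP.
  - by move=> ->; rewrite eqxx.
elim: l i => [|x l IH] i /=.
  exact: (@measurableT _ (g_sigma_algebraType G)).
have -> : [set w | bits i x.1.1 x.1.2 w = x.2] =
    [set w | hit (rbox i x.1.1 x.1.2) w = x.2.1] `&` [set w | hit (lbox i x.1.1 x.1.2) w = x.2.2].
  apply/seteqP; split=> w /=; first by move=> <-.
  by case: (x.2) => e1 e2 /= [<- <-].
apply: (@measurableI _ (g_sigma_algebraType G)); last exact: IH.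
by apply: (@measurableI _ (g_sigma_algebraType G)); apply: hitG; exact: measurable_box.
Qed.

Let meta := @exclusion_measurable _ _ _ _ _ _ _ SE.

Local Notation sigma_all := (config_sigma eta `[0, +oo[).

Lemma sigma_all_measurable A : sigma_all A -> measurable A.
Proof. by apply: config_sigma_measurable => // x /=; rewrite in_itv/= andbT. Qed.

Lemma grid_in i : `[0, +oo[%classic (grid i).
Proof. by rewrite /= in_itv/= andbT grid_ge0. Qed.

Definition steps_at i (l : seq (bool * bool)) : set Omega := [set w | steps i w = l].

Lemma steps_at_cons i e l : steps_at i.+1 (e :: l) =
  (([set w | eta (grid i) w (pos l) = true] `&` steps_at i l) `&` [set w | bits i (pos l) true w = e]) `|`
  (([set w | eta (grid i) w (pos l) = false] `&` steps_at i l) `&` [set w | bits i (pos l) false w = e]).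
Proof.
apply/seteqP; split=> w; rewrite /steps_at /=.
  move=> [<- sl]; rewrite sl; case E : (eta (grid i) w (pos l)); [left|right];
    by rewrite -?E; repeat split.
by move=> [] [[E sl] <-]; rewrite sl E.
Qed.

Lemma measurable_steps_at i l : measurable (steps_at i l).
Proof.
elim: i l => [|i IH] [|e l].
- by rewrite (_ : steps_at _ _ = setT)//; apply/seteqP; split.
- by rewrite (_ : steps_at _ _ = set0)//; apply/seteqP; split.
- by rewrite (_ : steps_at _ _ = set0)//; apply/seteqP; split.
rewrite steps_at_cons; apply: measurableU; apply: measurableI; try exact: measurable_bits;
  by apply: measurableI => //; apply: measurable_site => //; exact: grid_ge0.
Qed.

Lemma steps_at_step i e l A C : measurable A -> measurable C ->
  pr (A `&` steps_at i.+1 (e :: l) `&` C) =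
  pr ((A `&` [set w | eta (grid i) w (pos l) = true]) `&` steps_at i l `&`
      ([set w | bits i (pos l) true w = e] `&` C)) +
  pr ((A `&` [set w | eta (grid i) w (pos l) = false]) `&` steps_at i l `&`
      ([set w | bits i (pos l) false w = e] `&` C)).
Proof.
move=> mA mC; have g0 := grid_ge0 i.
have mm b : measurable ((A `&` [set w | eta (grid i) w (pos l) = b]) `&` steps_at i l `&`
      ([set w | bits i (pos l) b w = e] `&` C)).
  apply: measurableI; last by apply: measurableI => //; exact: measurable_bits.
  apply: measurableI; last exact: measurable_steps_at.
  by apply: measurableI => //; exact: measurable_site.
rewrite -prU//; last first.
  by apply/seteqP; split=> w //= -[[[[_ t1] _] _] [[[_ t2] _] _]]; rewrite t1 in t2.
congr pr; rewrite steps_at_cons; apply/seteqP; split=> w /=; first by tauto.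
by tauto.
Qed.

(* Given the environment, the steps are chosen independently: the strips used
   by different steps are disjoint. *)
Lemma steps_indep i l A m : sigma_all A ->
  pr (A `&` steps_at i l `&` fut i m) = qp m * pr (A `&` steps_at i l).
Proof.
elim: i l A m => [|i IH] [|e l] A m sA; have mA := sigma_all_measurable sA.
- rewrite (_ : steps_at 0 [::] = setT); last by apply/seteqP; split.
  rewrite setIT; have := IN sA (points_sigma_fut 0 m).
  rewrite [in X in X -> _]prE; last by apply: measurableI => //; exact: measurable_fut.
  rewrite !prE//; last exact: measurable_fut.
  by rewrite -EFinM => H1; rewrite (EFin_inj H1) pr_fut mulrC.
- rewrite (_ : steps_at 0 _ = set0); last by apply/seteqP; split.
  by rewrite !setI0 set0I pr_set0 mulr0.
- rewrite (_ : steps_at _ _ = set0); last by apply/seteqP; split.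
  by rewrite !setI0 set0I pr_set0 mulr0.
have sB b : sigma_all (A `&` [set w | eta (grid i) w (pos l) = b]).
  by apply: config_sigmaI => //; apply: config_sigma_site; exact: grid_in.
(* The occupation read by the last step joins the environment event and its bits join the
   prescriptions; this is why the statement is proved for all [A] and [m] at once. *)
have H b m' : pr ((A `&` [set w | eta (grid i) w (pos l) = b]) `&` steps_at i l `&`
     ([set w | bits i (pos l) b w = e] `&` fut i.+1 m')) =
     step_prob b e * qp m' * pr ((A `&` [set w | eta (grid i) w (pos l) = b]) `&` steps_at i l).
  have := IH l _ ((pos l, b, e) :: m') (sB b).
  by rewrite /= /qp big_cons.
rewrite steps_at_step//; last exact: measurable_fut.
rewrite -[A `&` steps_at i.+1 _]setIT -[setT]/(fut i.+1 [::]) steps_at_step//; last exact: measurable_fut.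
by rewrite !H /qp big_nil; ring.
Qed.

Lemma steps_at_rec i e l A : sigma_all A ->
  pr (A `&` steps_at i.+1 (e :: l)) =
  \sum_(b <- [:: true; false]) step_prob b e *
    pr ((A `&` [set w | eta (grid i) w (pos l) = b]) `&` steps_at i l).
Proof.
move=> sA; have mA := sigma_all_measurable sA.
have sB b : sigma_all (A `&` [set w | eta (grid i) w (pos l) = b]).
  by apply: config_sigmaI => //; apply: config_sigma_site; exact: grid_in.
have H b := @steps_indep i l _ [:: (pos l, b, e)] (sB b).
rewrite -[A `&` steps_at i.+1 _]setIT steps_at_step//.
by rewrite !H /qp !big_seq1 big_cons big_seq1.
Qed.

End euler.

(** * Moments of the Euler schemes *)

Section step_laws.
Context {R : realType}.
Variables (alpha beta : bool -> R) (Lambda p rho r delta : R).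
Hypothesis mod : model alpha beta Lambda p rho r delta.
Context {dd : measure_display} {Omega : measurableType dd}.
Variables (P : probability Omega R) (eta : R -> Omega -> config)
  (Pi : Omega -> set (int * R * R)).
Hypothesis SE : simple_exclusion P p rho eta.
Hypothesis PP : poisson_process P (driving_space Lambda) driving_intensity Pi.
Hypothesis IN : independent_sigma P (config_sigma eta `[0, +oo[) (points_sigma (R := R) Pi).
Variable h : R.
Hypothesis h_gt0 : 0 < h.

Implicit Types (i : nat) (b : bool) (e : bool * bool) (w : Omega).
Implicit Types (l : seq (bool * bool)) (phi : seq (bool * bool) -> R).
Local Notation pr := (prob P).
Local Notation steps := (steps alpha beta eta Pi h).
Local Notation at_steps := (steps_at alpha beta eta Pi h).
Local Notation qstep := (step_prob alpha beta h).
Local Notation grid := (grid h).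

Definition ebits : seq (bool * bool) :=
  [:: (true, true); (true, false); (false, true); (false, false)].

Fixpoint lists i : seq (seq (bool * bool)) :=
  if i is i'.+1 then [seq e :: l | e <- ebits, l <- lists i'] else [:: [::]].

Lemma mem_ebits e : e \in ebits.
Proof. by case: e => [[] []]. Qed.

Lemma steps_lists i w : steps i w \in lists i.
Proof.
elim: i => [|i IH]; first by rewrite mem_head.
by apply/allpairsP; exists (head (true, true) (steps i.+1 w), steps i w); rewrite mem_ebits.
Qed.

Lemma uniq_lists i : uniq (lists i).
Proof.
elim: i => // i IH; apply: allpairs_uniq => // -[e l] [e' l'] _ _ /= [-> ->] //.
Qed.

Lemma sum_lists i phi :
  \sum_(l <- lists i.+1) phi l = \sum_(l <- lists i) \sum_(e <- ebits) phi (e :: l).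
Proof.
rewrite exchange_big -[lists i.+1]/([seq e :: l | e <- ebits, l <- lists i]).
by rewrite big_flatten big_map; apply: eq_bigr => e _; rewrite big_map.
Qed.

Definition steps_mean i phi : R := \sum_(l <- lists i) phi l * pr (at_steps i l).

Lemma mat i l : measurable (at_steps i l).
Proof. exact: (@measurable_steps_at R alpha beta Lambda p rho dd Omega P eta Pi SE PP h h_gt0 i l). Qed.

Lemma pr_steps i (Q : pred (seq (bool * bool))) :
  measurable [set w | Q (steps i w)] /\
  pr [set w | Q (steps i w)] = steps_mean i (fun l => (Q l)%:R).
Proof.
have -> : [set w | Q (steps i w)] =
    \big[setU/set0]_(l <- [seq l <- lists i | Q l]) at_steps i l.
  apply/seteqP; split=> w /=.
    move=> Qw; rewrite -bigcup_seq; exists (steps i w) => //=.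
    by rewrite mem_filter Qw steps_lists.
  by rewrite -bigcup_seq => -[l /=]; rewrite mem_filter => /andP[Ql _]; rewrite /steps_at /= => ->.
split; first by apply: bigsetU_measurable => l _; exact: mat.
have : uniq [seq l <- lists i | Q l] by rewrite filter_uniq// uniq_lists.
rewrite /steps_mean.
have -> : \sum_(l <- lists i) (Q l)%:R * pr (at_steps i l) =
   \sum_(l <- [seq l <- lists i | Q l]) pr (at_steps i l).
  by rewrite big_filter [RHS]big_mkcond; apply: eq_bigr => l _; case: (Q l);
    rewrite ?mul1r ?mul0r.
elim: [seq l <- lists i | Q l] => [|l s IH]; first by rewrite !big_nil pr_set0.
move=> /= /andP[ls us]; rewrite !big_cons prU ?IH//; first exact: mat.
  by apply: bigsetU_measurable => l' _; exact: mat.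
apply/seteqP; split=> w //=; rewrite -bigcup_seq => -[wl [l' l's wl']].
by move/negP : ls; apply; move: l's; rewrite -[l]wl -[l']wl'.
Qed.

Lemma steps_mean_le i phi psi : (forall l, phi l <= psi l) -> steps_mean i phi <= steps_mean i psi.
Proof. by move=> pp; apply: ler_sum => l _; rewrite ler_wpM2r// pr_ge0. Qed.

Lemma steps_mean_lin i c d phi psi :
  steps_mean i (fun l => c * phi l + d * psi l) = c * steps_mean i phi + d * steps_mean i psi.
Proof.
by rewrite /steps_mean !mulr_sumr -big_split/=; apply: eq_bigr => l _; ring.
Qed.

Lemma steps_mean1 i : steps_mean i (fun=> 1) = 1.
Proof.
have [_] := @pr_steps i xpredT.
have -> : [set w | xpredT (steps i w)] = setT by apply/seteqP; split => //.
by rewrite pr_setT => H; exact: esym H.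
Qed.

Lemma pr_steps_le i (Q : pred (seq (bool * bool))) phi :
  (forall l, (Q l)%:R <= phi l) -> pr [set w | Q (steps i w)] <= steps_mean i phi.
Proof. by move=> Qp; have [_ ->] := @pr_steps i Q; exact: steps_mean_le. Qed.

Lemma pr_site_split i l : \sum_(b <- [:: true; false])
  pr ([set w | eta (grid i) w (pos l) = b] `&` at_steps i l) = pr (at_steps i l).
Proof.
have mB b : measurable [set w | eta (grid i) w (pos l) = b].
  apply: measurable_site; last exact: grid_ge0.
  exact: (exclusion_measurable SE).
rewrite big_cons big_seq1 [RHS](@pr_split _ _ _ _ _ [set w | eta (grid i) w (pos l) = true])//; last exact: mat.
rewrite [at_steps i l `&` _]setIC [at_steps i l `&` _]setIC; congr (_ + pr (_ `&` _)).
by apply/seteqP; split=> w /=; case: (eta (grid i) w (pos l)).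
Qed.

Lemma sum_step_prob b : \sum_(e <- ebits) qstep b e = 1.
Proof. by rewrite /step_prob !big_cons big_nil /qbit /=; ring. Qed.

Lemma steps_meanS i phi : steps_mean i.+1 phi =
  \sum_(l <- lists i) \sum_(b <- [:: true; false])
    pr ([set w | eta (grid i) w (pos l) = b] `&` at_steps i l) *
    \sum_(e <- ebits) qstep b e * phi (e :: l).
Proof.
rewrite /steps_mean sum_lists; apply: eq_bigr => l _.
transitivity (\sum_(e <- ebits) \sum_(b <- [:: true; false])
    pr ([set w | eta (grid i) w (pos l) = b] `&` at_steps i l) * (qstep b e * phi (e :: l))).
  apply: eq_bigr => e _.
  have := steps_at_rec mod SE PP IN h_gt0 i e l (@config_sigmaT _ _ _ eta `[0, +oo[%classic).
  rewrite setTI => ->.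
  by rewrite mulr_sumr; apply: eq_bigr => b _; rewrite setTI; ring.
by rewrite exchange_big/=; apply: eq_bigr => b _; rewrite mulr_sumr.
Qed.

(** The one-step bound is required for either occupation value, so the law of the environment does
    not enter. *)
Lemma steps_meanS_le i phi psi C :
  (forall b l, \sum_(e <- ebits) qstep b e * phi (e :: l) <= C * psi l) ->
  steps_mean i.+1 phi <= C * steps_mean i psi.
Proof.
move=> H; rewrite steps_meanS /steps_mean mulr_sumr; apply: ler_sum => l _.
rewrite -pr_site_split !mulr_sumr; apply: ler_sum => b _.
by rewrite mulrA mulrC ler_wpM2r// pr_ge0.
Qed.

Lemma steps_meanS_ge i phi psi :
  (forall b l, psi l <= \sum_(e <- ebits) qstep b e * phi (e :: l)) ->
  steps_mean i psi <= steps_mean i.+1 phi.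
Proof.
move=> H; rewrite steps_meanS /steps_mean; apply: ler_sum => l _.
rewrite -pr_site_split mulr_sumr; apply: ler_sum => b _.
by rewrite mulrC ler_wpM2l// pr_ge0.
Qed.

(* The two bits of a step are read independently; a step (true, true) moves the
   walk by 0 but counts for two jumps. *)
Definition jumps l : nat := \sum_(e <- l) (e.1 + e.2)%N.

Lemma jumps_cons e l : jumps (e :: l) = (e.1 + e.2 + jumps l)%N.
Proof. by rewrite /jumps big_cons. Qed.

Lemma pos_cons e l : pos (e :: l) = disp e + pos l.
Proof. by rewrite /pos big_cons. Qed.

Lemma pos_jumps l : `|pos l| <= (jumps l)%:Z.
Proof.
elim: l => [|e l IH]; first by rewrite /pos /jumps !big_nil.
rewrite pos_cons jumps_cons; move: IH; move: (pos l) (jumps l) => x k.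
by rewrite /disp; clear; case: e => [[] []] /=; lia.
Qed.

Lemma qbit_ge (mu : R) : 0 <= mu -> mu - mu ^+ 2 <= qbit mu true <= mu.
Proof.
move=> mu0; rewrite /qbit; have H := expR_ge1Dx (- mu).
apply/andP; split; last by lra.
have H1 : expR (- mu) * (1 + mu) <= 1.
  by rewrite expRN mulrC ler_pdivrMr ?expR_gt0// mul1r expR_ge1Dx.
have H2 : 0 < 1 + mu by lra.
have : expR (- mu) <= 1 - mu + mu ^+ 2.
  rewrite -(ler_pM2r H2); apply: (le_trans H1).
  have -> : (1 - mu + mu ^+ 2) * (1 + mu) = 1 + mu ^+ 3 by ring.
  by rewrite lerDl exprn_ge0.
lra.
Qed.

(** The two bits are independent, with success probabilities at most h alpha and h beta, and 1 + y
    <= exp y. *)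
Lemma exp_jumps_step (c : R) b l : 1 <= c ->
  \sum_(e <- ebits) qstep b e * c ^+ jumps (e :: l) <=
  expR ((c - 1) * Lambda * h) * c ^+ jumps l.
Proof.
move=> c1; have h0 := ltW h_gt0.
have a0 : 0 <= h * alpha b by rewrite mulr_ge0// (model_alpha mod).
have b0 : 0 <= h * beta b by rewrite mulr_ge0// (model_beta mod).
have -> : \sum_(e <- ebits) qstep b e * c ^+ jumps (e :: l) =
   (1 + (c - 1) * qbit (h * alpha b) true) * (1 + (c - 1) * qbit (h * beta b) true)
    * c ^+ jumps l.
  by rewrite /step_prob !big_cons big_nil !jumps_cons /= !add0n !add1n /qbit !exprS; ring.
rewrite ler_wpM2r// ?exprn_ge0//; first by lra.
have H mu : 0 <= mu -> 0 <= 1 + (c - 1) * qbit mu true <= expR ((c - 1) * mu).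
  move=> mu0; have /andP[q0 _] := qbit01 true mu0; have /andP[_ q1] := qbit_ge mu0.
  apply/andP; split; first by rewrite addr_ge0// mulr_ge0//; lra.
  by apply: (le_trans _ (expR_ge1Dx _)); rewrite lerD2l ler_wpM2l//; lra.
have /andP[Ha0 Ha] := H _ a0; have /andP[Hb0 Hb] := H _ b0.
apply: (le_trans (ler_pM Ha0 Hb0 Ha Hb)); rewrite -expRD ler_expR -mulrDr -mulrA.
rewrite ler_wpM2l//; first by lra.
by rewrite -mulrDr mulrC ler_wpM2r// (model_rates mod).
Qed.

(** Since the most recent step comes first, [take k] keeps the steps of the last k strips. *)
Lemma exp_jumps (c : R) i k : 1 <= c ->
  steps_mean (i + k) (fun l => c ^+ jumps (take k l)) <= expR ((c - 1) * Lambda * h * k%:R).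
Proof.
move=> c1; elim: k => [|k IH].
  rewrite mulr0 expR0 -(steps_mean1 (i + 0)); apply: steps_mean_le => l.
  by rewrite take0 /jumps big_nil expr0.
rewrite addnS -natr1 mulrDr mulr1 addrC expRD.
apply: (le_trans _ (ler_wpM2l (expR_ge0 _) IH)); apply: steps_meanS_le => b l /=.
exact: exp_jumps_step.
Qed.

Lemma exp_jumps_all (c : R) i : 1 <= c ->
  steps_mean i (fun l => c ^+ jumps l) <= expR ((c - 1) * Lambda * h * i%:R).
Proof.
move=> c1; elim: i => [|i IH].
  rewrite mulr0 expR0 -(steps_mean1 0) /steps_mean !big_seq1 /jumps big_nil expr0; exact: lexx.
rewrite -natr1 mulrDr mulr1 addrC expRD.
apply: (le_trans _ (ler_wpM2l (expR_ge0 _) IH)); apply: steps_meanS_le => b l /=.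
exact: exp_jumps_step.
Qed.

(** A step has mean at least h (alpha - beta) - (h Lambda)^2, and alpha - beta >= 1 + delta follows
    from [model_drift] and r < 1. *)
Lemma mean_pos i : i%:R * (h * (1 + delta) - (h * Lambda) ^+ 2) <= steps_mean i (fun l => (pos l)%:~R).
Proof.
have h0 := ltW h_gt0.
elim: i => [|i IH].
  by rewrite mul0r /steps_mean big_seq1 /pos big_nil mul0r.
set k := h * (1 + delta) - _ in IH *.
rewrite -natr1 mulrDl mul1r; apply: (@le_trans _ _ (steps_mean i (fun l => 1 * (pos l)%:~R + k * 1))).
  by rewrite steps_mean_lin steps_mean1 mul1r mulr1 lerD2r.
apply: steps_meanS_ge => b l; rewrite mul1r mulr1.
have a0 : 0 <= h * alpha b by rewrite mulr_ge0// (model_alpha mod).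
have b0 : 0 <= h * beta b by rewrite mulr_ge0// (model_beta mod).
have -> : \sum_(e <- ebits) qstep b e * (pos (e :: l))%:~R =
   (pos l)%:~R + (qbit (h * alpha b) true - qbit (h * beta b) true).
  rewrite /step_prob !big_cons big_nil !pos_cons /disp /=.
  rewrite !rmorphD /= !rmorphN /= /qbit; ring.
rewrite lerD2l.
have /andP[qa _] := qbit_ge a0; have /andP[_ qb] := qbit_ge b0.
have /andP[r0 r1] := model_r mod; have dr := model_drift mod b.
have aa := model_alpha mod b; have bb := model_beta mod b; have rl := model_rates mod b.
have right_rate : r * alpha b <= 1 * alpha b by rewrite ler_wpM2r// ltW.
have sq : (h * alpha b) ^+ 2 <= (h * Lambda) ^+ 2.
  rewrite ler_pXn2r ?nnegrE ?mulr_ge0//; try lra.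
  by rewrite ler_wpM2l//; lra.
have : h * (1 + delta) <= h * (alpha b - beta b) by rewrite ler_wpM2l//; lra.
rewrite /k; lra.
Qed.

End step_laws.

(** * The initial law *)

Section bernoulli_law.
Context {R : realType} {dd : measure_display} {Omega : measurableType dd}.
Variables (P : probability Omega R) (eta : R -> Omega -> config) (p rho : R).
Hypothesis SE : simple_exclusion P p rho eta.
Hypothesis rho01 : 0 <= rho <= 1.

Definition weight (l : seq int) (s : config) : R :=
  \prod_(y <- l) (if s y then rho else 1 - rho).

Lemma avgs_upd l y v (f : config -> R) z : y \notin l ->
  avgs rho l f (upd z y v) = avgs rho l (fun s => f (upd s y v)) z.
Proof.
elim: l z => //= x l IH z; rewrite inE negb_or => /andP[yx yl].
by rewrite /avg !(updC _ _ _ yx) !IH.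
Qed.

Lemma avgs_pats l (f : config -> R) z : uniq l -> dep l f ->
  avgs rho l f z = \sum_(s <- pats l) f s * weight l s.
Proof.
elim: l f z => [|y l IH] f z /=.
  by move=> _ fl; rewrite big_seq1 /weight big_nil mulr1; exact: fl.
move=> /andP[yl ul] fl; rewrite big_cat/= !big_map /avg.
have E v : \sum_(s <- pats l) f (upd s y v) * weight (y :: l) (upd s y v) =
    (if v then rho else 1 - rho) * avgs rho l f (upd z y v).
  rewrite avgs_upd// IH//.
    rewrite mulr_sumr; apply: eq_bigr => s _; rewrite /weight big_cons updE eqxx.
    rewrite mulrCA; congr (_ * (_ * _)); apply: eq_big_seq => x xl.
    by rewrite updE; have -> : (x == y) = false by apply: contraNF yl => /eqP <-.
  by move=> s s' ss; apply: fl => x; rewrite inE !updE; case: eqP => //= _; exact: ss.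
by rewrite !E.
Qed.

Lemma pr_cyl0 l s : uniq l -> prob P (cyl eta l 0 s) = weight l s.
Proof.
move=> ul; have := exclusion_initial SE [fset x in l]%fset (fun x => [set s x]).
have -> : [set w | forall x, x \in [fset x in l]%fset -> [set s x] (eta 0 w x)] = cyl eta l 0 s.
  apply/seteqP; split=> w /=.
    by move=> H; apply/allP => x xl; apply/eqP; apply: H; rewrite inE.
  by move=> /allP H x; rewrite inE => /H/eqP.
rewrite /prob => ->; rewrite (perm_big l) /=; last first.
  by apply: uniq_perm => //; [exact: fset_uniq|move=> x; rewrite inE].
rewrite (eq_bigr (fun x => (if s x then rho else 1 - rho)%:E)) ?prodEFin//.
move=> x _; rewrite bernoulli_probE// !diracE.
have inE1 (u v : bool) : (u \in [set v]%classic) = (u == v).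
  by apply/idP/idP; rewrite inE => /eqP.
by rewrite !inE1 -!EFinM -EFinD /unstable.onem; case: (s x) => /=; congr _%:E; ring.
Qed.

Lemma env_mean0_window a n (f : config -> R) : dep (win a n) f ->
  env_mean eta P f 0 setT = window_mean rho a n f.
Proof.
move=> fl; rewrite (env_meanE (exclusion_measurable SE) P (uniq_win a n) fl)//.
rewrite /window_mean avgs_pats ?uniq_win//; apply: eq_bigr => s _.
by rewrite setTI pr_cyl0 ?uniq_win.
Qed.

End bernoulli_law.

(** * One step of the scheme against one step of the chain *)

Section euler_vs_chain.
Context {R : realType}.
Variables (alpha beta : bool -> R) (Lambda p rho r delta : R).
Hypothesis mod : model alpha beta Lambda p rho r delta.
Context {dd : measure_display} {Omega : measurableType dd}.
Variables (P : probability Omega R) (eta : R -> Omega -> config)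
  (Pi : Omega -> set (int * R * R)).
Hypothesis SE : simple_exclusion P p rho eta.
Hypothesis PP : poisson_process P (driving_space Lambda) driving_intensity Pi.
Hypothesis IN : independent_sigma P (config_sigma eta `[0, +oo[) (points_sigma (R := R) Pi).
Variable S : R -> (config -> R) -> (config -> R).
Hypothesis ES : exclusion_semigroup p S.
Hypothesis ME : markov_process P S eta.
Variable h : R.
Hypothesis h_gt0 : 0 < h.
Variables (a : int) (n : nat) (eps : R).
Hypothesis eps_ge0 : 0 <= eps.
Hypothesis approx : forall f M, dep (win a n) f -> (forall z, `|f z| <= M) ->
  forall z, `|S h f z - (f z + h * gen0 p (a - 1) n.+2 f z)| <= h * eps * M.
Hypothesis hs : small_step Lambda n h.

Implicit Types (i : nat) (b : bool) (e : bool * bool) (w : Omega).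
Implicit Types (l : seq (bool * bool)) (W : config -> int -> R).
Local Notation pr := (prob P).
Local Notation at_steps := (steps_at alpha beta eta Pi h).
Local Notation qstep := (step_prob alpha beta h).
Local Notation grid := (grid h).
Local Notation Ex := (env_mean eta P).
Local Notation EY := (steps_mean alpha beta P eta Pi h).
Local Notation step := (chain_step alpha beta Lambda p rho a n h).
Local Notation wide := (win (a - 1) n.+2).
Let meta := exclusion_measurable SE.
Let mat i l : measurable (at_steps i l) := @mat R alpha beta Lambda p rho dd Omega P eta Pi SE PP h h_gt0 i l.
Local Notation sigma_all := (config_sigma eta `[0, +oo[).

Let gsite b i l : set Omega := [set w | eta (grid i) w (pos l) = b].

Let mgsite b i l : measurable (gsite b i l).
Proof. by apply: measurable_site => //; exact: grid_ge0. Qed.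

(** Here the exclusion lives on the whole line: exchanges at the ends of the window read one more
    site on each side, whence the window [wide]. *)
Definition euler_step (f : config -> R) : config -> R :=
  fun z => f z + h * gen0 p (a - 1) n.+2 f z.

Lemma win_wide : {subset win a n <= wide}.
Proof. by move=> y; rewrite !mem_win /in_window; lia. Qed.

Lemma euler_step_dep f : dep (win a n) f -> dep wide (euler_step f).
Proof.
move=> fl z z' zz; rewrite /euler_step (depW win_wide fl zz); congr (_ + _ * _).
apply: eq_bigr => i _; rewrite /bond (depW win_wide fl zz).
have [iw|iw] := boolP (a - 1 <= a - 1 + i%:Z <= a + n%:Z).
  have i1 : a - 1 + i%:Z \in wide by rewrite mem_win /in_window; move: iw; clear; lia.
  have i2 : a - 1 + i%:Z + 1 \in wide by rewrite mem_win /in_window; move: iw; clear; lia.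
  rewrite /bond_rate !zz//; congr (_ * (_ - _)); apply: (depW win_wide fl) => y yw.
  by rewrite !swapE !zz.
by rewrite !(swap_dep _ fl iw) (depW win_wide fl zz) !subrr !mulr0.
Qed.

Lemma env_mean_steps_rec f t i e l A : dep wide f -> 0 <= t -> sigma_all A ->
  Ex f t (A `&` at_steps i.+1 (e :: l)) =
  \sum_(b <- [:: true; false]) qstep b e * Ex f t ((A `&` gsite b i l) `&` at_steps i l).
Proof.
move=> fl t0 sA; have mA := sigma_all_measurable SE sA.
rewrite (env_meanE meta P (uniq_win _ _) fl t0); last by apply: measurableI => //; exact: mat.
have E b : Ex f t ((A `&` gsite b i l) `&` at_steps i l) =
  \sum_(s <- pats wide) f s * pr ((A `&` gsite b i l) `&` at_steps i l `&` cyl eta wide t s).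
  rewrite (env_meanE meta P (uniq_win _ _) fl t0)//; apply: measurableI => //.
  exact: measurableI.
rewrite !big_cons big_nil addr0 !E !mulr_sumr -big_split/=; apply: eq_bigr => s _.
have sC : sigma_all (A `&` cyl eta wide t s).
  by apply: config_sigmaI => //; apply: config_sigma_cyl => /=; rewrite in_itv/= t0.
have := steps_at_rec mod SE PP IN h_gt0 i e l sC.
rewrite !big_cons big_nil addr0 setIAC => ->.
have X (b : bool) : A `&` gsite b i l `&` at_steps i l `&` cyl eta wide t s =
    A `&` cyl eta wide t s `&` gsite b i l `&` at_steps i l.
  by rewrite [LHS]setIAC; congr (_ `&` _); rewrite setIAC.
by rewrite !X; ring.
Qed.

Lemma env_mean_set0 f t : Ex f t set0 = 0.
Proof. by rewrite /env_mean integral_set0. Qed.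

(** [at_steps i l] is not an event of the environment, so [markov_process] does not apply to it
    directly. Peeling off the steps turns their Poisson part into factors [qstep] and leaves
    environment events at times up to t. *)
Lemma markov_steps f M i l A t : dep (win a n) f -> (forall z, `|f z| <= M) -> 0 <= t ->
  (forall k, (k < i)%N -> grid k <= t) -> config_sigma eta `[0, t] A ->
  `|Ex f (t + h) (A `&` at_steps i l) - Ex (euler_step f) t (A `&` at_steps i l)| <=
  h * eps * M * pr (A `&` at_steps i l).
Proof.
move=> fl fM t0; have h0 := ltW h_gt0.
have empty B : B = set0 :> set Omega -> `|Ex f (t + h) B - Ex (euler_step f) t B| <=
    h * eps * M * pr B.
  by move=> ->; rewrite !env_mean_set0 subrr normr0 pr_set0 mulr0.
elim: i l A => [|i IH] [|e l] A kt sA.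
- rewrite (_ : at_steps 0 [::] = setT); last by apply/seteqP; split.
  by rewrite setIT; apply: (markov_approx ES) => //; exact: approx.
- by apply: empty; apply/seteqP; split=> w // [].
- by apply: empty; apply/seteqP; split=> w // [].
have sub : subset (`[0, t]%classic : set R) `[0, +oo[%classic.
  by move=> x /=; rewrite !in_itv/= andbT => /andP[].
have sA' : sigma_all A by exact: config_sigmaW sA.
rewrite !env_mean_steps_rec ?addr_ge0//; last 2 first.
- exact: euler_step_dep.
- exact: depW win_wide fl.
rewrite -sumrB (steps_at_rec mod SE PP IN h_gt0)// mulr_sumr.
apply: (le_trans (ler_norm_sum _ _ _)); apply: ler_sum => b _.
rewrite -mulrBr normrM (ger0_norm (step_prob_ge0 mod h_gt0 b e)) mulrCA.
rewrite ler_wpM2l ?(step_prob_ge0 mod h_gt0)//; apply: IH.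
  by move=> k ki; apply: kt; exact: ltnW.
apply: config_sigmaI => //; apply: config_sigma_site => /=.
by rewrite in_itv/= grid_ge0// kt.
Qed.

Definition nu i W : R := \sum_(l <- lists i) Ex (W^~ (pos l)) (grid i) (at_steps i l).

(* One step of the expectation is one step of the chain, up to the semigroup
   approximation and the discrepancy of the two generators. *)
Lemma nu_step i W (err : int -> R) : loc a n W -> (forall z x, `|W z x| <= 1) ->
  (forall b s x, (in_window a n x -> s x = b) ->
    `|\sum_(e <- ebits) qstep b e * euler_step (W^~ (disp e + x)) s - step W s x| <= err x) ->
  `|nu i.+1 W - nu i (step W)| <= h * eps + EY i (fun l => err (pos l)).
Proof.
move=> Wl W1 Werr.
have dW x : dep (win a n) (W^~ x).
  by move=> z z' zz; apply: Wl => y; rewrite -mem_win; exact: zz.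
have dW' x : dep wide (W^~ x) by exact: depW win_wide (dW x).
have dS x : dep wide ((step W)^~ x).
  apply: (depW win_wide) => z z' zz; have [h0 h1] := hs.
  have SL : loc a n (step W).
    by case: (mod) => *; apply: (step_loc alpha beta (Lambda := Lambda)).
  by apply: SL => y; rewrite -mem_win; exact: zz.
have g0 := grid_ge0 h_gt0.
have mG b l : measurable (gsite b i l `&` at_steps i l) by exact: measurableI.
have E1 : nu i.+1 W = \sum_(l <- lists i) \sum_(b <- [:: true; false]) \sum_(e <- ebits)
    qstep b e * Ex (W^~ (disp e + pos l)) (grid i + h) (gsite b i l `&` at_steps i l).
  rewrite /nu sum_lists; apply: eq_bigr => l _; rewrite exchange_big/=; apply: eq_bigr => e _.
  rewrite pos_cons gridS -[at_steps i.+1 _]setTI env_mean_steps_rec ?addr_ge0 ?(ltW h_gt0)//.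
    by apply: eq_bigr => b _; rewrite setTI.
  exact: config_sigmaT.
have split (f : config -> R) l : dep wide f -> Ex f (grid i) (at_steps i l) =
   \sum_(b <- [:: true; false]) Ex f (grid i) (gsite b i l `&` at_steps i l).
  move=> fl; rewrite (env_meanE meta P (uniq_win _ _) fl)// !big_cons big_nil addr0.
  rewrite !(env_meanE meta P (uniq_win _ _) fl)// -big_split/=; apply: eq_bigr => s _.
  have mC : measurable (cyl eta wide (grid i) s) by exact: measurable_cyl.
  rewrite -mulrDr (@pr_split _ _ _ _ (at_steps i l `&` _) (gsite true i l))//; last first.
    exact: measurableI.
  congr (_ * (pr _ + pr _)); first by rewrite setIC setIA.
  rewrite setIC setIA; congr (_ `&` _ `&` _).
  by apply/seteqP; split=> w /=; rewrite /gsite /=; case: (eta _ w _).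
have E2 : nu i (step W) = \sum_(l <- lists i) \sum_(b <- [:: true; false])
    Ex ((step W)^~ (pos l)) (grid i) (gsite b i l `&` at_steps i l).
  by rewrite /nu; apply: eq_bigr => l _; rewrite split.
rewrite E1 E2 -sumrB.
have -> : h * eps + EY i (fun l => err (pos l)) =
    \sum_(l <- lists i) \sum_(b <- [:: true; false])
      (h * eps + err (pos l)) * pr (gsite b i l `&` at_steps i l).
  have HE : h * eps = EY i (fun=> h * eps).
    have H1 : \sum_(l <- lists i) pr (at_steps i l) = 1.
      by rewrite -(steps_mean1 alpha beta SE PP h_gt0 i); apply: eq_bigr => l _; rewrite mul1r.
    by rewrite /steps_mean -mulr_sumr H1 mulr1.
  rewrite {1}HE /steps_mean -big_split/=; apply: eq_bigr => l _.
  rewrite -mulrDl -mulr_sumr; congr (_ * _).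
  exact: (esym (pr_site_split alpha beta SE PP h_gt0 i l)).
apply: (le_trans (ler_norm_sum _ _ _)); apply: ler_sum => l _.
rewrite -sumrB; apply: (le_trans (ler_norm_sum _ _ _)); apply: ler_sum => b _.
set B := gsite b i l `&` _; set x := pos l.
(* [mid] separates the two errors: the semigroup is already replaced by its first-order
   approximation, while the walker still moves with the step probabilities of the scheme. *)
pose mid := \sum_(e <- ebits) qstep b e * Ex (euler_step (W^~ (disp e + x))) (grid i) B.
have H1 : `|\sum_(e <- ebits) qstep b e * Ex (W^~ (disp e + x)) (grid i + h) B - mid| <=
    h * eps * pr B.
  rewrite /mid -sumrB; apply: (le_trans (ler_norm_sum _ _ _)).
  have -> : h * eps * pr B = \sum_(e <- ebits) qstep b e * (h * eps * 1 * pr B).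
    by rewrite -mulr_suml sum_step_prob mul1r mulr1.
  apply: ler_sum => e _; rewrite -mulrBr normrM (ger0_norm (step_prob_ge0 mod h_gt0 b e)).
  rewrite ler_wpM2l ?(step_prob_ge0 mod h_gt0)//; apply: markov_steps => //.
    by move=> k ki; apply: grid_le => //; exact: ltnW.
  by apply: config_sigma_site => /=; rewrite in_itv/= g0 lexx.
have H2 : `|mid - Ex ((step W)^~ x) (grid i) B| <= err x * pr B.
  rewrite /mid (env_meanE meta P (uniq_win _ _) (dS x) (g0 i) (mG b l)).
  under eq_bigr => e _ do rewrite (env_meanE meta P (uniq_win _ _) (euler_step_dep (dW _)) (g0 i) (mG b l)) mulr_sumr.
  rewrite exchange_big/= -sumrB -(sum_cyl meta P (uniq_win (a - 1) n.+2) (g0 i) (mG b l)) mulr_sumr.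
  apply: (le_trans (ler_norm_sum _ _ _)); apply: ler_sum => s _.
  have -> : \sum_(e <- ebits) qstep b e * (euler_step (W^~ (disp e + x)) s *
      pr (B `&` cyl eta wide (grid i) s)) - step W s x * pr (B `&` cyl eta wide (grid i) s) =
    (\sum_(e <- ebits) qstep b e * euler_step (W^~ (disp e + x)) s - step W s x) *
      pr (B `&` cyl eta wide (grid i) s).
    by rewrite mulrBl mulr_suml; congr (_ - _); apply: eq_bigr => e _; ring.
  rewrite normrM [X in _ * X]ger0_norm ?pr_ge0//.
  (* [Werr] only concerns patterns compatible with the occupation b of site x; the other patterns do
     not meet [B]. *)
  have [sx|sx] := pselect (in_window a n x -> s x = b).
    by rewrite ler_wpM2r ?pr_ge0// Werr.
  have -> : B `&` cyl eta wide (grid i) s = set0; last by rewrite pr_set0 !mulr0.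
  apply/seteqP; split=> w //= [[/= xb _] /allP ag]; apply: sx => xin.
  have xw : x \in wide by apply: win_wide; rewrite mem_win.
  by have /eqP <- := ag _ xw.
rewrite mulrDl -(subrK mid (\sum_(e <- ebits) _)) -addrA.
by apply: (le_trans (ler_normD _ _)); apply: lerD.
Qed.

End euler_vs_chain.

Lemma bump_shift (a : int) i : a - 1 + (bump 0 i)%:Z = a + i%:Z.
Proof. by rewrite /bump /=; lia. Qed.

(** * The discrepancy of the two generators *)

Section chain_error.
Context {R : realType}.
Variables (alpha beta : bool -> R) (Lambda p rho r delta : R).
Hypothesis mod : model alpha beta Lambda p rho r delta.
Variable h : R.
Hypothesis h_gt0 : 0 < h.
Variables (a : int) (n : nat).
Hypothesis hs : small_step Lambda n h.
Implicit Types (b : bool) (e : bool * bool).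
Local Notation qstep := (step_prob alpha beta h).
Local Notation step := (chain_step alpha beta Lambda p rho a n h).
Local Notation evolve := (evolve alpha beta Lambda p rho a n h).

(** The influence of the two ends of the window on a walker at x: the first term comes from
    [evolve_left], the second with its growth factor [E] from [evolve_right]. *)
Definition boundary (E : R) (x : int) : R := r ^ (x - a) + E * 2^-1 ^ (a + n%:Z - x).

Lemma step_prob_close b : `|qstep b (true, false) - h * alpha b| <= (h * Lambda) ^+ 2 /\
  `|qstep b (false, true) - h * beta b| <= (h * Lambda) ^+ 2.
Proof.
have h0 := ltW h_gt0.
have al := model_alpha mod b; have be := model_beta mod b; have rl := model_rates mod b.
have key mu nu : 0 <= mu -> 0 <= nu -> mu + nu <= Lambda ->
    `|qbit (h * mu) true * qbit (h * nu) false - h * mu| <= (h * Lambda) ^+ 2.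
  move=> mu0 nu0 mnL.
  have hm : 0 <= h * mu by rewrite mulr_ge0.
  have hn : 0 <= h * nu by rewrite mulr_ge0.
  have /andP[q1 q2] := qbit_ge hm; have /andP[q3 q4] := qbit_ge hn.
  have /andP[q5 _] := qbit01 true hm.
  have E : qbit (h * nu) false = 1 - qbit (h * nu) true by rewrite /qbit; ring.
  have H1 : qbit (h * mu) true * qbit (h * nu) true <= h * mu * (h * nu).
    apply: ler_pM => //; have /andP[H _] := qbit01 true hn; exact: H.
  have H0 : 0 <= qbit (h * mu) true * qbit (h * nu) true.
    by rewrite mulr_ge0//; have /andP[H _] := qbit01 true hn.
  have H2 : (h * mu) * (h * (mu + nu)) <= (h * Lambda) * (h * Lambda).
    apply: ler_pM; rewrite ?mulr_ge0 ?addr_ge0//; rewrite ler_wpM2l//; lra.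
  rewrite E ler_norml; apply/andP; split; last by nra.
  rewrite expr2; move: H1 H2 q1; rewrite expr2 => H1 H2 q1; lra.
split; first exact: key.
by rewrite /step_prob mulrC; apply: key => //; rewrite addrC.
Qed.

(** The generators differ in the bonds at the two ends and in the rates of a walker outside the
    window, and [boundary] controls both. The rest is of order h^2: two Poisson points in a strip,
    or a jump together with an exchange. *)
Lemma chain_err g t b (s : config) (x : int) : (forall x, `|g x| <= 1) ->
  (in_window a n x -> s x = b) ->
  `|\sum_(e <- ebits) qstep b e * euler_step p h a n ((evolve t g)^~ (disp e + x)) s
    - step (evolve t g) s x| <=
  h * ((4 * Lambda + 4) * boundary ((1 + h * (Lambda + 1)) ^+ t) x)
  + h ^+ 2 * (4 * Lambda ^+ 2 + 4 * Lambda * n.+2%:R).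
Proof.
move=> g1 sx; have h0 := ltW h_gt0; have [_ h1] := hs.
have /andP[r0 r1] := model_r mod; have L1 := model_Lambda mod.
set E := (1 + h * (Lambda + 1)) ^+ t; set W := evolve t g.
have W1 z y : `|W z y| <= 1 by apply: (evolve_norm mod).
have E1 : 1 <= E by rewrite exprn_ege1// lerDl mulr_ge0//; lra.
have Dw z z' y y' : `|W z y - W z' y'| <= 2.
  by apply: (le_trans (ler_normB _ _)); have := W1 z y; have := W1 z' y'; lra.
have bq z i : 0 <= bond_rate p z i <= 1 by exact: bond_rate01 (model_p mod) z i.
have bb y i : `|bond p i (W^~ y) s| <= 2.
  rewrite /bond normrM; have /andP[q0 q1] := bq s i.
  by rewrite (ger0_norm q0) -[2]mul1r; apply: ler_pM.
pose G y := gen0 p (a - 1) n.+2 (W^~ y) s.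
have Gb y : `|G y| <= 2 * n.+2%:R.
  rewrite /G /gen0; apply: (le_trans (ler_norm_sum _ _ _)).
  by rewrite mulrC; apply: sum_ord_le => i.
have DG y y' : `|G y - G y'| <= 4 * n.+2%:R.
  by apply: (le_trans (ler_normB _ _)); have := Gb y; have := Gb y'; lra.
pose B1 := bond p (a - 1) (W^~ x) s; pose B2 := bond p (a + n%:Z) (W^~ x) s.
pose Sm := \sum_(i < n) bond p (a + i%:Z) (W^~ x) s.
have GE : G x = B1 + Sm + B2.
  rewrite /G /gen0 big_ord_recl big_ord_recr /= /B1 /Sm /B2 addr0 addrA; congr (_ + _ + _).
    apply: eq_bigr => i _.
    by have -> : a - 1 + (bump 0 i)%:Z = a + i%:Z by exact: bump_shift.
  by have -> : a - 1 + (bump 0 n)%:Z = a + n%:Z by exact: bump_shift.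
have IL : influence true r 2 W.
  by have := @evolve_left R alpha beta Lambda p rho r delta mod a n h t g 1 hs g1; rewrite mulr1.
have IR : influence false 2^-1 (2 * E) W.
  by have := @evolve_right R alpha beta Lambda p rho r delta mod a n h t g 1 hs g1; rewrite mulr1.
have absI sd u D z z' m : influence sd u D W -> agree sd m z z' ->
    `|W z x - W z' x| <= D * u ^ depth sd m x.
  move=> I zz; rewrite ler_norml; apply/andP; split; last exact: I.
  by rewrite lerNl opprB; apply: I; exact: agree_sym.
(* Within the window the exchange across (a - 1, a) changes the site a only, so the configurations
   agree to the right of a. *)
have B1b : `|B1| <= 2 * r ^ (x - a).
  rewrite /B1 /bond normrM; have /andP[q0 q1] := bq s (a - 1).
  rewrite (ger0_norm q0) -[leRHS]mul1r; apply: ler_pM => //.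
  apply: (absI true r 2 _ _ a IL) => y ay; rewrite swapE.
  have -> : (y == a - 1) = false by move: ay; rewrite /=; clear; lia.
  by have -> : (y == a - 1 + 1) = false by move: ay; rewrite /=; clear; lia.
have B2b : `|B2| <= 2 * E * 2^-1 ^ (a + n%:Z - x).
  rewrite /B2 /bond normrM; have /andP[q0 q1] := bq s (a + n%:Z).
  rewrite (ger0_norm q0) -[leRHS]mul1r; apply: ler_pM => //.
  apply: (absI false 2^-1 (2 * E) _ _ (a + n%:Z) IR) => y ay; rewrite swapE.
  have -> : (y == a + n%:Z) = false by move: ay; rewrite /=; clear; lia.
  by have -> : (y == a + n%:Z + 1) = false by move: ay; rewrite /=; clear; lia.
pose Rv := resv p rho a n (W^~ x) s.
have Rvb : `|Rv| <= 2 * E * 2^-1 ^ (a + n%:Z - x).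
  rewrite /Rv /resv normrM.
  have /andP[q0 q1] := end_rate01 a n (model_p mod) (model_rho mod) s.
  rewrite (ger0_norm q0) -[leRHS]mul1r; apply: ler_pM => //.
  apply: (absI false 2^-1 (2 * E) _ _ (a + n%:Z) IR) => y ay; rewrite updE.
  by have -> : (y == a + n%:Z) = false by move: ay; rewrite /=; clear; lia.
set om := boundary E x.
have u0 : 0 < r ^ (x - a) by rewrite exprz_gt0.
have v0 : 0 < 2^-1 ^ (a + n%:Z - x) :> R by rewrite exprz_gt0// invr_gt0.
have om0 : 0 <= om by rewrite /om /boundary addr_ge0 ?mulr_ge0 ?(ltW u0) ?(ltW v0)//; lra.
pose wp := W s (x + 1) - W s x; pose wm := W s (x - 1) - W s x.
have wpb : `|wp| <= 2 by exact: Dw.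
have wmb : `|wm| <= 2 by exact: Dw.
set q1 := qstep b (true, false); set q2 := qstep b (false, true).
have [c1 c2] := step_prob_close b.
have al := model_alpha mod b; have be := model_beta mod b; have rl := model_rates mod b.
have q1b : 0 <= q1 <= h * alpha b.
  rewrite (step_prob_ge0 mod h_gt0)/= /q1 /step_prob /= -[leRHS]mulr1.
  have ha : 0 <= h * alpha b by rewrite mulr_ge0.
  have hb : 0 <= h * beta b by rewrite mulr_ge0.
  have /andP[x1 x2] := qbit_ge ha; have /andP[x3 _] := qbit01 true ha.
  by have /andP[x4 x5] := qbit01 false hb; apply: ler_pM.
have q2b : 0 <= q2 <= h * beta b.
  rewrite (step_prob_ge0 mod h_gt0)/= /q2 /step_prob /= -[leRHS]mul1r.
  have ha : 0 <= h * alpha b by rewrite mulr_ge0.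
  have hb : 0 <= h * beta b by rewrite mulr_ge0.
  have /andP[x1 x2] := qbit_ge hb; have /andP[x3 _] := qbit01 true hb.
  by have /andP[x4 x5] := qbit01 false ha; apply: ler_pM.
pose Rt := (alpha b - right_rate alpha Lambda a n s x) * wp + (beta b - left_rate beta a n s x) * wm.
have Rtb : `|Rt| <= 4 * Lambda * om.
  rewrite /Rt /right_rate /left_rate; case: ifPn => xin.
    by rewrite (sx xin) !subrr !mul0r addr0 normr0 !mulr_ge0//; lra.
  (* Outside the window one of the two exponents in [boundary] is negative. *)
  have om1 : 1 <= om.
    rewrite /om /boundary.
    have neg (u : R) k : 0 < u <= 1 -> k <= 0 -> 1 <= u ^ k.
      move=> /andP[uu0 uu1]; case: k => // k; first by case: k.
      by move=> _; rewrite /exprz invf_ge1 ?exprn_gt0// exprn_ile1// ltW.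
    have [xa|xa] := ltP x a.
      have -> // : 1 <= r ^ (x - a) -> 1 <= r ^ (x - a) + E * 2^-1 ^ (a + n%:Z - x).
        by move=> H; apply: (le_trans H); rewrite lerDl mulr_ge0 ?(ltW v0)//; lra.
      by apply: neg; [rewrite r0 ltW|move: xa; clear; lia].
    have H : 1 <= 2^-1 ^ (a + n%:Z - x) :> R.
      apply: neg; first by apply/andP; split; lra.
      by move: xin; rewrite /in_window xa /=; clear; lia.
    have : 1 * 1 <= E * 2^-1 ^ (a + n%:Z - x) by apply: ler_pM.
    lra.
  have H1 : `|(alpha b - Lambda) * wp| <= Lambda * 2.
    by rewrite normrM; apply: ler_pM => //; rewrite ler_norml; apply/andP; split; lra.
  have H2 : `|(beta b - 0) * wm| <= Lambda * 2.
    by rewrite normrM; apply: ler_pM => //; rewrite ler_norml; apply/andP; split; lra.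
  have H3 : 4 * Lambda * 1 <= 4 * Lambda * om by rewrite ler_wpM2l//; lra.
  by apply: (le_trans (ler_normD _ _)); lra.
have -> : \sum_(e <- ebits) qstep b e * euler_step p h a n (W^~ (disp e + x)) s
    - step W s x = (q1 - h * alpha b) * wp + (q2 - h * beta b) * wm + h * Rt +
    h * (q1 * (G (x + 1) - G x) + q2 * (G (x - 1) - G x)) + h * (B1 + B2 - Rv).
  have T (e : bool * bool) : euler_step p h a n (W^~ (disp e + x)) s =
      W s (disp e + x) + h * G (disp e + x) by [].
  have q0 : qstep b (true, true) + qstep b (false, false) = 1 - q1 - q2.
    by have := sum_step_prob alpha beta h b; rewrite !big_cons big_nil /q1 /q2; lra.
  under eq_bigr do rewrite T.
  rewrite !big_cons big_nil -/q1 -/q2.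
  rewrite (_ : disp (true, true) = 0)// (_ : disp (false, false) = 0)//.
  rewrite (_ : disp (true, false) = 1)// (_ : disp (false, true) = -1)//.
  rewrite !add0r (addrC 1 x) (addrC (-1) x).
  have -> : qstep b (true, true) = 1 - q1 - q2 - qstep b (false, false) by lra.
  rewrite /chain_step /gen -/Sm -/Rv /Rt /wp /wm GE; ring.
have K1 : `|(q1 - h * alpha b) * wp| <= (h * Lambda) ^+ 2 * 2.
  by rewrite normrM; apply: ler_pM.
have K2 : `|(q2 - h * beta b) * wm| <= (h * Lambda) ^+ 2 * 2.
  by rewrite normrM; apply: ler_pM.
have K3 : `|h * Rt| <= h * (4 * Lambda * om) by rewrite normrM (ger0_norm h0) ler_wpM2l.
have /andP[q10 q11] := q1b; have /andP[q20 q21] := q2b.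
have K4 : `|h * (q1 * (G (x + 1) - G x) + q2 * (G (x - 1) - G x))| <=
    h * (h * Lambda * (4 * n.+2%:R)).
  rewrite normrM (ger0_norm h0) ler_wpM2l//; apply: (le_trans (ler_normD _ _)).
  rewrite (normrM q1) (normrM q2) (ger0_norm q10) (ger0_norm q20).
  have M1 : q1 * `|G (x + 1) - G x| <= h * alpha b * (4 * n.+2%:R) by apply: ler_pM.
  have M2 : q2 * `|G (x - 1) - G x| <= h * beta b * (4 * n.+2%:R) by apply: ler_pM.
  have M3 : h * (alpha b + beta b) * (4 * n.+2%:R) <= h * Lambda * (4 * n.+2%:R).
    by rewrite ler_wpM2r ?mulr_ge0// ler_wpM2l.
  lra.
have K5 : `|h * (B1 + B2 - Rv)| <= h * (4 * om).
  rewrite normrM (ger0_norm h0) ler_wpM2l//.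
  apply: (le_trans (ler_normB _ _)); apply: (le_trans (lerD (ler_normD _ _) (lexx _))).
  by rewrite /om /boundary; lra.
apply: (le_trans (ler_normD _ _)); apply: (le_trans (lerD (ler_normD _ _) (lexx _))).
apply: (le_trans (lerD (lerD (ler_normD _ _) (lexx _)) (lexx _))).
apply: (le_trans (lerD (lerD (lerD (ler_normD _ _) (lexx _)) (lexx _)) (lexx _))).
have Z : h ^+ 2 * (4 * Lambda ^+ 2 + 4 * Lambda * n.+2%:R) =
   (h * Lambda) ^+ 2 * 2 + (h * Lambda) ^+ 2 * 2 + h * (h * Lambda * (4 * n.+2%:R)) by ring.
rewrite Z; lra.
Qed.

End chain_error.

(** * Laws of the scheme and of the chain *)

Section euler_chain.
Context {R : realType}.
Variables (alpha beta : bool -> R) (Lambda p rho r delta : R).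
Hypothesis mod : model alpha beta Lambda p rho r delta.
Context {dd : measure_display} {Omega : measurableType dd}.
Variables (P : probability Omega R) (eta : R -> Omega -> config)
  (Pi : Omega -> set (int * R * R)).
Hypothesis SE : simple_exclusion P p rho eta.
Hypothesis PP : poisson_process P (driving_space Lambda) driving_intensity Pi.
Hypothesis IN : independent_sigma P (config_sigma eta `[0, +oo[) (points_sigma (R := R) Pi).
Local Notation EY h := (steps_mean alpha beta P eta Pi h).
Local Notation evolve := (evolve alpha beta Lambda p rho).

(** The first factor bounds the growth in [evolve_right], the second is the exponential moment of
    the number of jumps with base 2 / r. *)
Definition growth (T : R) : R :=
  expR ((Lambda + 1) * T) * expR ((2 / r - 1) * Lambda * T).

(** This is [boundary] with E = 1, seen from the origin. *)
Definition remote (a : int) (n : nat) : R := r ^ (- a) + 2^-1 ^ (a + n%:Z).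

Let c_ge1 : 1 <= 2 / r.
Proof.
have /andP[r0 r1] := model_r mod.
by rewrite ler_pdivlMr// mul1r; lra.
Qed.

(** A jump multiplies either exponential by at most 2 / r, which dominates both 1 / r and 2. *)
Lemma boundary_jumps (E : R) a n (l : seq (bool * bool)) : 1 <= E ->
  boundary r a n E (pos l) <= E * remote a n * (2 / r) ^+ jumps l.
Proof.
move=> E1; have /andP[r0 r1] := model_r mod.
have [x0 J] : exists k : nat, (k <= jumps l)%N /\ (pos l = k%:Z \/ pos l = - k%:Z).
  exists (absz (pos l)); have := pos_jumps l; move: (pos l) (jumps l) => x k; clear.
  by case: x => x /=; split; [lia|left|lia|right; rewrite NegzE].
case: J => xJ xE.
have c1 := c_ge1.
have ir : r^-1 <= 2 / r by rewrite ler_peMl ?invr_ge0 ?(ltW r0)//; lra.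
have ir1 : 1 <= r^-1 by rewrite invf_ge1// ltW.
have i2 : 2 <= 2 / r :> R by rewrite ler_pdivlMr//; lra.
have cJ : (2 / r) ^+ x0 <= (2 / r) ^+ jumps l by rewrite ler_weXn2l.
have H1 : r ^ pos l <= (2 / r) ^+ jumps l.
  apply: (le_trans _ cJ); case: xE => ->.
    rewrite -exprnP; apply: (@le_trans _ _ 1); last by rewrite exprn_ege1.
    by rewrite exprn_ile1// ltW.
  rewrite -exprnN -exprVn lerXn2r ?nnegrE// ?invr_ge0 ?(ltW r0)//.
  by rewrite divr_ge0// ltW.
have H2 : 2^-1 ^ (- pos l) <= (2 / r) ^+ jumps l.
  apply: (le_trans _ cJ); case: xE => ->.
    rewrite -exprnN -exprVn invrK lerXn2r ?nnegrE//.
    by rewrite divr_ge0// ltW.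
  rewrite opprK -exprnP; apply: (@le_trans _ _ 1); last by rewrite exprn_ege1.
  by rewrite exprn_ile1// ?invr_ge0// invf_le1//; lra.
have rn0 : r != 0 by rewrite gt_eqF.
have u0 : 0 <= r ^ (- a) by rewrite exprz_ge0// ltW.
have v0 : 0 <= 2^-1 ^ (a + n%:Z) :> R by rewrite exprz_ge0// invr_ge0.
have hn0 : (2^-1 : R) != 0 by rewrite invr_eq0.
rewrite /boundary /remote (expfzDr _ _ rn0) (expfzDr _ (- pos l) hn0).
move: H1 H2 u0 v0; set X := r ^ pos l; set Y := 2^-1 ^ (- pos l); set u := r ^ (- a).
set v := 2^-1 ^ (a + n%:Z); set C := (2 / r) ^+ _ => H1 H2 u0 v0.
have C0 : 0 <= C by rewrite exprn_ge0//; lra.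
have K1 := ler_wpM2r u0 H1.
have K2 : 1 * (C * u) <= E * (C * u) by rewrite ler_wpM2r ?mulr_ge0.
have K3 : E * (v * Y) <= E * (v * C) by rewrite ler_wpM2l ?ler_wpM2l//; lra.
lra.
Qed.

Section one_mesh.
Variables (h : R) (a : int) (n : nat) (eps : R) (S : R -> (config -> R) -> (config -> R)).
Hypothesis h_gt0 : 0 < h.
Hypothesis ES : exclusion_semigroup p S.
Hypothesis ME : markov_process P S eta.
Hypothesis eps_ge0 : 0 <= eps.
Hypothesis approx : forall f M, dep (win a n) f -> (forall z, `|f z| <= M) ->
  forall z, `|S h f z - (f z + h * gen0 p (a - 1) n.+2 f z)| <= h * eps * M.
Hypothesis hs : small_step Lambda n h.

(** The steps of the scheme are replaced by steps of the chain one at a time, starting from the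
    last. Each replacement costs the error of [nu_step], where [boundary] is averaged over the
    position through the moment of the jumps. *)
Lemma euler_chain k (g : int -> R) : (forall x, `|g x| <= 1) ->
  `|EY h k (fun l => g (pos l)) - window_mean rho a n (fun z => evolve a n h k g z 0)| <=
  k%:R * h * (eps + (4 * Lambda + 4) * (growth (k%:R * h) * remote a n) +
    h * (4 * Lambda ^+ 2 + 4 * Lambda * n.+2%:R)).
Proof.
move=> g1; have h0 := ltW h_gt0; have L1 := model_Lambda mod.
have /andP[r0 r1] := model_r mod.
set T := k%:R * h; set eta0 := eps + _ + _.
have rem0 : 0 <= remote a n.
  by rewrite /remote addr_ge0// exprz_ge0// ?invr_ge0// ltW.
have main i j : (i + j <= k)%N ->
  `|nu alpha beta P eta Pi h (i + j) (fun=> g) -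
    nu alpha beta P eta Pi h i (evolve a n h j g)| <= j%:R * (h * eta0).
  elim: j i => [|j IH] i ijk; first by rewrite addn0 subrr normr0 mul0r.
  have H1 := IH i.+1; rewrite addSnnS in H1; have {}H1 := H1 ijk.
  have H2 := @nu_step R alpha beta Lambda p rho r delta mod dd Omega P eta Pi SE PP IN S ES ME
    h h_gt0 a n eps eps_ge0 approx hs i (evolve a n h j g) (fun x => h * ((4 * Lambda + 4) *
      boundary r a n ((1 + h * (Lambda + 1)) ^+ j) x)
      + h ^+ 2 * (4 * Lambda ^+ 2 + 4 * Lambda * n.+2%:R)).
  have {}H2 := H2 (@evolve_loc R alpha beta Lambda p rho r delta mod a n h j g hs)
    (@evolve_norm R alpha beta Lambda p rho r delta mod a n h j g 1 hs g1).
  have {}H2 := H2 (fun b s x sx =>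
    @chain_err R alpha beta Lambda p rho r delta mod h h_gt0 a n hs g j b s x g1 sx).
  set E := (1 + h * (Lambda + 1)) ^+ j in H2.
  have E1 : 1 <= E by rewrite exprn_ege1// lerDl mulr_ge0//; lra.
  have EE : E <= expR ((Lambda + 1) * T).
    have b1 : 1 <= 1 + h * (Lambda + 1) by rewrite lerDl mulr_ge0//; lra.
    apply: (@le_trans _ _ ((1 + h * (Lambda + 1)) ^+ k)).
      by rewrite ler_weXn2l//; move: ijk; clear; lia.
    have -> : (Lambda + 1) * T = k%:R * (h * (Lambda + 1)) by rewrite /T; ring.
    rewrite expRM_natl.
    by rewrite lerXn2r ?nnegrE ?expR_ge0// ?(le_trans ler01)// expR_ge1Dx.
  have EJ : EY h i (fun l => (2 / r) ^+ jumps l) <= expR ((2 / r - 1) * Lambda * T).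
    apply: (le_trans (exp_jumps_all mod SE PP IN h_gt0 i c_ge1)).
    rewrite ler_expR /T -!mulrA ler_wpM2l//; first by have := c_ge1; lra.
    rewrite ler_wpM2l//; first lra.
    by rewrite mulrC ler_wpM2r// ler_nat; move: ijk; clear; lia.
  have EB : EY h i (fun l => h * ((4 * Lambda + 4) * boundary r a n E (pos l))
      + h ^+ 2 * (4 * Lambda ^+ 2 + 4 * Lambda * n.+2%:R)) <=
     h * ((4 * Lambda + 4) * (growth T * remote a n))
      + h ^+ 2 * (4 * Lambda ^+ 2 + 4 * Lambda * n.+2%:R).
    set C2 := h ^+ 2 * _.
    apply: (@le_trans _ _ (EY h i (fun l =>
      (h * ((4 * Lambda + 4) * (E * remote a n))) * (2 / r) ^+ jumps l + C2 * 1))).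
      apply: steps_mean_le => l; rewrite mulr1 lerD2r -[leRHS]mulrA ler_wpM2l// -[leRHS]mulrA.
      by rewrite ler_wpM2l ?boundary_jumps//; lra.
    rewrite steps_mean_lin (steps_mean1 alpha beta SE PP h_gt0) mulr1 lerD2r -mulrA ler_wpM2l//.
    rewrite -mulrA ler_wpM2l//; first lra.
    rewrite mulrAC ler_wpM2r// /growth; apply: ler_pM => //; first by lra.
    by apply: sumr_ge0 => l _; rewrite mulr_ge0 ?pr_ge0// exprn_ge0//; have := c_ge1; lra.
  have H3 : `|nu alpha beta P eta Pi h i.+1 (evolve a n h j g) -
      nu alpha beta P eta Pi h i (evolve a n h j.+1 g)| <= h * eta0.
    by apply: (le_trans H2); rewrite /eta0; lra.
  rewrite -natr1 mulrDl mul1r.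
  rewrite -(subrK (nu alpha beta P eta Pi h i.+1 (evolve a n h j g)) (nu _ _ _ _ _ _ (i + j.+1) _)) -addrA.
  by apply: (le_trans (ler_normD _ _)); apply: lerD.
have := main 0%N k (leqnn k); rewrite add0n.
have -> : nu alpha beta P eta Pi h k (fun=> g) = EY h k (fun l => g (pos l)).
  rewrite /nu; apply: eq_bigr => l _.
  have m := @mat R alpha beta Lambda p rho dd Omega P eta Pi SE PP h h_gt0 k l.
  rewrite (@env_meanE _ _ _ eta (exclusion_measurable SE) P [::])//; last exact: grid_ge0.
  rewrite big_seq1; congr (_ * prob P _).
  by apply/seteqP; split=> w //= [].
have -> : nu alpha beta P eta Pi h 0 (evolve a n h k g) =
    window_mean rho a n (fun z => evolve a n h k g z 0).
  rewrite /nu big_seq1 /pos big_nil /grid mul0r.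
  rewrite (_ : steps_at _ _ _ _ _ _ _ = setT); last by apply/seteqP; split.
  apply: (env_mean0_window SE (model_rho mod)) => z z' zz.
  by apply: (@evolve_loc R alpha beta Lambda p rho r delta mod a n h k g hs) => y; rewrite -mem_win; exact: zz.
by rewrite mulrA.
Qed.

End one_mesh.

End euler_chain.

Section mesh.
Context {R : realType}.

(** With dyadic meshes every integer time is a grid point. *)
Definition mesh (j : nat) : R := 2^-1 ^+ j.

Lemma mesh_gt0 j : 0 < mesh j.
Proof. by rewrite exprn_gt0// invr_gt0. Qed.

Lemma near_mesh (Q : R -> Prop) : (\forall h \near 0^'+, Q h) ->
  exists J, forall j, (J <= j)%N -> Q (mesh j).
Proof.
move=> [e /= e0 He].
have H : mesh j @[j --> \oo] --> (0 : R).
  by apply: cvg_expr; rewrite ger0_norm ?invr_ge0// invf_lt1// ltr1n.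
have /cvgrPdist_lt/(_ e e0)[J _ HJ] := H.
exists J => j Jj; apply: He; last exact: mesh_gt0.
exact: HJ.
Qed.

Lemma mesh_grid T j i : (T * 2 ^ j)%:R * mesh j = T%:R :> R /\ (i * 2 ^ j)%:R * mesh j = i%:R :> R.
Proof.
have H t : (t * 2 ^ j)%:R * mesh j = t%:R :> R.
  by rewrite natrM natrX /mesh -mulrA -exprMn divff// expr1n mulr1.
by split.
Qed.

End mesh.

Section law_approximation.
Context {R : realType}.
Variables (alpha beta : bool -> R) (Lambda p rho r delta : R).
Hypothesis mod : model alpha beta Lambda p rho r delta.
Context {dd : measure_display} {Omega : measurableType dd}.
Variables (P : probability Omega R) (eta : R -> Omega -> config)
  (Pi : Omega -> set (int * R * R)).
Hypothesis SE : simple_exclusion P p rho eta.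
Hypothesis PP : poisson_process P (driving_space Lambda) driving_intensity Pi.
Hypothesis IN : independent_sigma P (config_sigma eta `[0, +oo[) (points_sigma (R := R) Pi).

Definition euler_mean (j T : nat) (g : int -> R) : R :=
  steps_mean alpha beta P eta Pi (mesh j) (T * 2 ^ j) (fun l => g (pos l)).

Definition chain_mean (a : int) (n j T : nat) (g : int -> R) (x : int) : R :=
  window_mean rho a n (fun z => evolve alpha beta Lambda p rho a n (mesh j) (T * 2 ^ j) g z x).

(* The error has two sources: the boundary of the window, which the walk sees
   with probability of order remote r a n, and the mesh. *)
Lemma law_approx T a n (eps : R) : 0 < eps ->
  exists J, forall j, (J <= j)%N -> small_step Lambda n (mesh j) /\
    forall g, (forall x, `|g x| <= 1) ->
    `|euler_mean j T g - chain_mean a n j T g 0| <=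
    T%:R * (4 * Lambda + 4) * growth Lambda r T%:R * remote r a n + eps.
Proof.
move=> eps0; have [S [ES ME]] := exclusion_markov SE.
have L1 := model_Lambda mod.
pose C2 : R := 4 * Lambda ^+ 2 + 4 * Lambda * n.+2%:R.
have C20 : 0 <= C2 by rewrite addr_ge0// !mulr_ge0//; lra.
(* Two errors of size [e1] per unit of time: one from the semigroup, one from the mesh. *)
pose e1 := eps / (2 * (T%:R + 1)).
have T1 : 0 < T%:R + 1 :> R by rewrite ltr_wpDl.
have e10 : 0 < e1 by rewrite divr_gt0// mulr_gt0.
have N0 : 0 <= n%:R :> R by [].
have H0 : \forall h \near 0^'+,
    [/\ (forall f M, dep (win a n) f -> (forall z, `|f z| <= M) -> forall z,
      `|S h f z - (f z + h * gen0 p (a - 1) n.+2 f z)| <= h * e1 * M),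
     h * (2 * (n%:R + 1 + Lambda)) <= 1 & h * (C2 + 1) <= e1].
  near=> h; split.
  - by near: h; exact: generator_approx.
  - rewrite -ler_pdivlMr; last by lra.
    by near: h; apply: nbhs_right_le; rewrite divr_gt0//; lra.
  - rewrite -ler_pdivlMr; last by lra.
    by near: h; apply: nbhs_right_le; rewrite divr_gt0//; lra.
have [J HJ] := near_mesh H0.
exists J => j Jj; have [H1 H2 H3] := HJ j Jj; have m0 := @mesh_gt0 R j.
have hs : small_step Lambda n (mesh j) by split => //; exact: ltW.
split=> // g g1.
have := @euler_chain R alpha beta Lambda p rho r delta mod dd Omega P eta Pi SE PP IN
  (mesh j) a n e1 S m0 ES ME (ltW e10) H1 hs (T * 2 ^ j) g g1.
have [-> _] := @mesh_grid R T j 0; move=> H; apply: (le_trans H).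
have K1 : mesh j * C2 <= e1 by apply: (le_trans _ H3); rewrite ler_wpM2l ?(ltW m0)// lerDl.
have K2 : T%:R * (e1 + mesh j * C2) <= T%:R * (e1 + e1) by rewrite ler_wpM2l// lerD2l.
have K3 : T%:R * (e1 + e1) <= eps.
  have -> : e1 + e1 = eps / (T%:R + 1) by rewrite /e1; field; rewrite gt_eqF.
  rewrite mulrCA ler_piMr ?(ltW eps0)// ler_pdivrMr// mul1r lerDl//.
rewrite -/C2; lra.
Unshelve. all: by end_near. Qed.

End law_approximation.

(** * Paths of the walk *)

Section walk_paths.
Context {R : realType}.
Variables (alpha beta : bool -> R) (eta : R -> config) (pi : set (int * R * R))
  (X : R -> int).
Hypothesis WP : walk_path alpha beta eta pi X.
Implicit Types (s t tau u : R) (x : int).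

Lemma int_cvg_near (f : R -> int) (F : set_system R) (l : int) : f @ F --> l ->
  F [set t | f t = l].
Proof. by move=> H; have := H [set l]; apply. Qed.

Lemma int_hausdorff : hausdorff_space int.
Proof.
move=> x y H; have [z [/= <- <-]] // : [set x] `&` [set y] !=set0 by apply: H.
Qed.

Lemma left_limit_cst s t x : s < t -> (forall tau, s <= tau < t -> X tau = x) ->
  left_limit X t = x.
Proof.
move=> st Xx; apply: cvg_lim; first exact: int_hausdorff.
have H : \forall tau \near t^'-, X tau = x.
  exists (t - s) => /=; first by rewrite subr_gt0.
  move=> tau /=; rewrite ltr_distlC => /andP[H1 H2] H3; apply: Xx.
  by apply/andP; split => //; lra.
by move=> A Ax; apply: filterS H => tau /= ->; exact: nbhs_singleton Ax.
Qed.

Lemma walk_right_cst t : 0 <= t -> exists2 e, 0 < e & forall tau, t <= tau < t + e -> X tau = X t.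
Proof.
move=> t0; have [H _] := walk_cadlag WP; have /int_cvg_near [e /= e0 He] := H _ t0.
exists e => // tau /andP[]; rewrite le_eqVlt => /predU1P[->//|ttau] te.
apply: He => //=; rewrite ltr_distl; apply/andP; split; lra.
Qed.

(** Let v be the last time up to which the walk has stayed at x. At v itself [walk_stay] applies,
    and right continuity would carry the walk beyond v if v < t. *)
Lemma walk_constant s t x : 0 <= s -> s <= t -> X s = x ->
  (forall tau u, s < tau <= t -> ~ pi (x, tau, u)) ->
  forall tau, s <= tau <= t -> X tau = x.
Proof.
move=> s0 st Xs nopt.
pose A : set R := [set v | s <= v <= t /\ forall tau, s <= tau <= v -> X tau = x].
have As : A s.
  split; first by rewrite lexx.
  by move=> tau /andP[H1 H2]; have -> : tau = s by apply/eqP; rewrite eq_le H1 H2.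
have hA : has_sup A by split; [exists s|exists t => v [/andP[]]].
set v := sup A.
have vt : v <= t by apply: ge_sup; [exists s|move=> w [/andP[]]].
have sv : s <= v by apply: ub_le_sup => //; case: hA.
have below tau : s <= tau < v -> X tau = x.
  move=> /andP[stau tauv]; have e0 : 0 < v - tau by rewrite subr_gt0.
  have [w [_ Aw] wv] := sup_adherent e0 hA; apply: Aw.
  by rewrite stau /=; rewrite -/v in wv; lra.
have Xv : X v = x.
  move: sv; rewrite le_eqVlt => /predU1P[<-//|sv].
  have v0 : 0 < v by lra.
  have ll := left_limit_cst sv below.
  rewrite -ll; apply: (walk_stay WP) => //; rewrite ll.
    by move=> [u [pu _]]; apply: (nopt v u) pu; rewrite sv vt.
  by move=> [u [pu _]]; apply: (nopt v u) pu; rewrite sv vt.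
have Av : forall tau, s <= tau <= v -> X tau = x.
  move=> tau /andP[H1]; rewrite le_eqVlt => /predU1P[->//|H2].
  by apply: below; rewrite H1.
move: vt; rewrite le_eqVlt => /predU1P[<-//|vt].
have v0 : 0 <= v by lra.
have [e e0 He] := walk_right_cst v0.
pose v' := Num.min t (v + e / 2).
have v't : v' <= t by rewrite /v' ge_min lexx.
have v've : v' <= v + e / 2 by rewrite /v' ge_min lexx orbT.
have vv' : v < v' by rewrite /v' lt_min vt ltrDl divr_gt0.
have : v' <= v.
  apply: ub_le_sup; first by case: hA.
  split; first by rewrite v't andbT; lra.
  move=> tau /andP[H1 H2]; have [tv|tv] := leP tau v; first by apply: Av; rewrite H1.
  by rewrite He ?Xv//; apply/andP; split; lra.
by rewrite leNgt vv'.
Qed.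

Definition mark_disp (b : bool) u : int :=
  if u <= alpha b then 1 else if u <= alpha b + beta b then -1 else 0.

(** Uniqueness of the point is also required above the neighbours of x: after its jump the walk sits
    on one of them and must not meet a second point. *)
Lemma walk_one_point s t x tau0 u0 : 0 <= s -> X s = x -> s < tau0 <= t ->
  pi (x, tau0, u0) ->
  (forall y tau u, `|y - x| <= 1 -> s < tau <= t -> pi (y, tau, u) ->
    tau = tau0 /\ u = u0) ->
  X t = x + mark_disp (eta tau0 x) u0 /\
  forall tau, s <= tau <= t -> X tau = x \/ X tau = X t.
Proof.
move=> s0 Xs /andP[st0 t0t] p0 uniq0.
have xx : `|x - x| <= 1 by rewrite subrr normr0.
have before tau : s <= tau < tau0 -> X tau = x.
  move=> /andP[stau tautau0]; apply: (@walk_constant s tau x) => //; last by rewrite stau lexx.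
  move=> tau' u /andP[H1 H2] pp.
  have [|E _] := uniq0 x tau' u xx _ pp; first by apply/andP; split; lra.
  by move: H2; rewrite E leNgt tautau0.
have ll := left_limit_cst st0 before.
have t00 : 0 < tau0 by lra.
have X0 : X tau0 = x + mark_disp (eta tau0 x) u0.
  rewrite /mark_disp; case: ifPn => ua.
    by rewrite (walk_right WP t00) ll//; exists u0.
  rewrite -ltNge in ua.
  have uu u : pi (x, tau0, u) -> u = u0.
    by move=> pp; have [|_ ->//] := uniq0 x tau0 u xx _ pp; rewrite st0.
  case: ifPn => uab.
    by rewrite (walk_left WP t00) ll//; exists u0; rewrite ua uab.
  rewrite addr0 (walk_stay WP t00) ll//.
    by move=> [u [/uu -> /=]]; rewrite leNgt ua.
  by move=> [u [/uu -> /=]]; rewrite (negbTE uab) andbF.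
have after tau : tau0 <= tau <= t -> X tau = X tau0.
  apply: walk_constant => //; first by lra.
  move=> tau' u /andP[H1 H2] pp.
  have : `|X tau0 - x| <= 1.
    by rewrite X0 /mark_disp; case: ifP => _; [|case: ifP => _]; lia.
  move=> Hx; have [|E _] := uniq0 (X tau0) tau' u Hx _ pp; first by apply/andP; split; lra.
  by move: H1; rewrite E ltxx.
have Xt : X t = X tau0 by apply: after; rewrite t0t lexx.
split; first by rewrite Xt.
move=> tau /andP[H1 H2]; have [H|H] := ltP tau tau0.
  by left; apply: before; rewrite H1.
by right; rewrite Xt; apply: after; rewrite H.
Qed.

End walk_paths.

Section jump_times_finite.
Context {R : realType}.
Variable f : R -> bool.
Hypothesis fr : forall t, 0 <= t -> exists2 e, 0 < e & forall u, t <= u < t + e -> f u = f t.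
Hypothesis fl : forall t, 0 < t -> exists2 e, 0 < e &
  forall u v, t - e < u < t -> t - e < v < t -> f u = f v.

(** Compactness, as a supremum argument. The list may contain points that are not jump times; it
    only has to meet every interval across which [f] changes. *)
Lemma jump_times_finite (T : R) : 0 <= T -> exists s : seq R,
  forall u v, 0 <= u -> u < v <= T -> f u != f v -> exists2 c, c \in s & u < c <= v.
Proof.
move=> T0.
pose A : set R := [set t | 0 <= t <= T /\ exists s : seq R,
  forall u v, 0 <= u -> u < v <= t -> f u != f v -> exists2 c, c \in s & u < c <= v].
have A0 : A 0.
  split; first by rewrite lexx.
  by exists [::] => u v u0 /andP[uv v0]; lra.
have hA : has_sup A by split; [exists 0|exists T => v [/andP[]]].
set m := sup A.
have mT : m <= T by apply: ge_sup; [exists 0|move=> w [/andP[]]].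
have m0 : 0 <= m by apply: ub_le_sup => //; case: hA.
have [s Hs] : exists s : seq R, forall u v, 0 <= u -> u < v <= m -> f u != f v ->
    exists2 c, c \in s & u < c <= v.
  move: m0; rewrite le_eqVlt => /predU1P[m0|m0].
    by exists [::] => u v u0 /andP[uv]; rewrite -m0 => v0; lra.
  have [e e0 He] := fl m0.
  have [t0 [_ [s Hs]] t0m] := sup_adherent e0 hA; rewrite -/m in t0m.
  exists [:: t0, m & s] => u v u0 /andP[uv vm] fuv.
  have [vt0|t0v] := leP v t0.
    have [|c cs uc] := Hs u v u0 _ fuv; first by rewrite uv.
    by exists c; rewrite ?inE ?cs ?orbT.
  have [ut0|t0u] := ltP u t0.
    by exists t0; rewrite ?inE ?eqxx// ut0 ltW.
  move: vm; rewrite le_eqVlt => /predU1P[vm|vm].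
    by exists m; rewrite ?inE ?eqxx ?orbT// -vm uv lexx.
  exfalso; move/negP : fuv; apply; apply/eqP; apply: He; apply/andP; split; lra.
have [e e0 He] := fr m0.
have chain_step t : m <= t < m + e -> forall u v, 0 <= u -> u < v <= t -> f u != f v ->
    exists2 c, c \in m :: s & u < c <= v.
  move=> /andP[mt te] u v u0 /andP[uv vt] fuv.
  have [vm|mv] := leP v m.
    have [|c cs uc] := Hs u v u0 _ fuv; first by rewrite uv.
    by exists c; rewrite ?inE ?cs ?orbT.
  have [um|mu] := ltP u m; first by exists m; rewrite ?inE ?eqxx// um ltW.
  exfalso; move/negP : fuv; apply; apply/eqP.
  by rewrite (He u) ?(He v)//; apply/andP; split; lra.
have [mT'|Tm] := ltP m T; last first.
  have <- : m = T by apply/eqP; rewrite eq_le mT Tm.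
  by exists s.
pose m' := Num.min T (m + e / 2).
have m'T : m' <= T by rewrite /m' ge_min lexx.
have m'e : m' <= m + e / 2 by rewrite /m' ge_min lexx orbT.
have mm' : m < m' by rewrite /m' lt_min mT' ltrDl divr_gt0.
have : m' <= m.
  apply: ub_le_sup; first by case: hA.
  split; first by rewrite m'T andbT; lra.
  by exists (m :: s); apply: chain_step; apply/andP; split; lra.
by rewrite leNgt mm'.
Qed.

End jump_times_finite.

Section coordinates.
Context {R : realType}.
Implicit Type (e : R -> config).

Lemma cadlag_coord_right e y : cadlag e -> forall t, 0 <= t ->
  exists2 d, 0 < d & forall u, t <= u < t + d -> e u y = e t y.
Proof.
move=> [H _] t t0.
have : e s y @[s --> t^'+] --> e t y.
  by have := cvg_comp _ _ (H t t0) (@proj_continuous int (fun=> bool) y (e t)).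
move=> /(_ [set e t y]) [//|d /= d0 Hd].
exists d => // u /andP[]; rewrite le_eqVlt => /predU1P[->//|tu ud].
by apply: Hd => //=; rewrite ltr_distl; apply/andP; split; lra.
Qed.

Lemma cadlag_coord_left e y : cadlag e -> forall t, 0 < t ->
  exists2 d, 0 < d & forall u v, t - d < u < t -> t - d < v < t -> e u y = e v y.
Proof.
move=> [_ H] t t0; have [l Hl] := H t t0.
have : e s y @[s --> t^'-] --> (l : config) y.
  by have := cvg_comp _ _ Hl (@proj_continuous int (fun=> bool) y l).
move=> /(_ [set (l : config) y]) [//|d /= d0 Hd].
have Hd' u : t - d < u < t -> e u y = l y.
  by move=> /andP[u1 u2]; apply: Hd => //=; rewrite ltr_distlC; apply/andP; split; lra.
by exists d => // u v /Hd' -> /Hd' ->.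
Qed.

End coordinates.

(** * Changes of the environment within a strip *)

Section changes.
Context {R : realType}.
Context {dd : measure_display} {Omega : measurableType dd}.
Variables (P : probability Omega R) (eta : R -> Omega -> config) (p rho : R).
Hypothesis SE : simple_exclusion P p rho eta.
Local Notation sigma_all := (config_sigma eta `[0, +oo[).
Local Notation pr := (prob P).

Section one_mesh.
Variable h : R.
Hypothesis h_gt0 : 0 < h.

(** Rational times detect every change of a cadlag path and keep [change] measurable; clamping also
    catches the right end of the strip, which may be irrational. *)
Definition clampt i (q : rat) : R := Num.max (grid h i) (Num.min (ratr q) (grid h i.+1)).

Lemma clampt_in i q : grid h i <= clampt i q <= grid h i.+1.
Proof.
rewrite /clampt le_max lexx /= ge_max ge_min lexx orbT andbT.
by apply: ltW; exact: grid_lt.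
Qed.

Definition change i (y : int) : set Omega :=
  \bigcup_q [set w | eta (clampt i q) w y != eta (grid h i) w y].

Lemma change_sigma i y : sigma_all (change i y).
Proof.
set G := [set [set w | eta z.1 w z.2 = true] | z in (`[0, +oo[%classic : set R) `*` [set: int]].
apply: (@bigcupT_measurable_rat _ (g_sigma_algebraType G)) => q.
have t0 : `[0, +oo[%classic (clampt i q).
  rewrite /= in_itv/= andbT; have /andP[H _] := clampt_in i q.
  exact: le_trans (grid_ge0 h_gt0 i) H.
have g0 : `[0, +oo[%classic (grid h i) by exact: grid_in.
have S b c : sigma_all ([set w | eta (clampt i q) w y = b] `&` [set w | eta (grid h i) w y = c]).
  by apply: config_sigmaI; exact: config_sigma_site.
have -> : [set w | eta (clampt i q) w y != eta (grid h i) w y] =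
    ([set w | eta (clampt i q) w y = true] `&` [set w | eta (grid h i) w y = false]) `|`
    ([set w | eta (clampt i q) w y = false] `&` [set w | eta (grid h i) w y = true]).
  apply/seteqP; split=> w /=.
    by case: (eta _ w y); case: (eta _ w y) => //= _; [left|right].
  by move=> [[-> ->]|[-> ->]].
by apply: (@measurableU _ (g_sigma_algebraType G)); exact: S.
Qed.

Lemma measurable_change i y : measurable (change i y).
Proof. by apply: (sigma_all_measurable SE); exact: change_sigma. Qed.

Lemma no_change i y w : cadlag (eta ^~ w) -> ~ change i y w ->
  forall tau, grid h i <= tau <= grid h i.+1 -> eta tau w y = eta (grid h i) w y.
Proof.
move=> cw nc tau /andP[t1 t2].
have H q : eta (clampt i q) w y = eta (grid h i) w y.
  by apply: contrapT => /eqP Hq; apply: nc; exists q.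
move: t2; rewrite le_eqVlt => /predU1P[->|t2].
  have gg : grid h i.+1 < grid h i.+1 + 1 by rewrite ltrDl.
  have [q] := rat_in_itvoo gg; rewrite in_itv/= => /andP[q1 _].
  have := H q; rewrite /clampt.
  have -> : Num.min (ratr q) (grid h i.+1) = grid h i.+1 by apply: min_r; exact: ltW.
  by rewrite max_r// ltW// grid_lt.
have t0 : 0 <= tau by apply: le_trans t1; exact: grid_ge0.
have [d d0 Hd] := cadlag_coord_right y cw t0.
have tt : tau < Num.min (tau + d) (grid h i.+1) by rewrite lt_min t2 ltrDl d0.
have [q] := rat_in_itvoo tt; rewrite in_itv/= lt_min => /andP[q1 /andP[q2 q3]].
rewrite -(H q) /clampt (min_l (ltW q3)) max_r; last by apply: (le_trans t1); exact: ltW.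
by symmetry; apply: Hd; rewrite (ltW q1).
Qed.

End one_mesh.

(** Path by path the number of strips with a change is bounded as the mesh tends to 0, so its
    product with the mesh tends to 0; it is also at most T. Dominated convergence thus takes the
    place of a bound on the mean number of changes. *)
Lemma change_prob y (T : nat) (eps : R) : 0 < eps -> exists J, forall j, (J <= j)%N ->
  mesh j * \sum_(i < T * 2 ^ j) pr (change (mesh j) i y) <= eps.
Proof.
move=> eps0.
pose N j w : R := \sum_(i < T * 2 ^ j) mesh j * \1_(change (mesh j) i y) w.
have mN j : measurable_fun setT (fun w => (N j w)%:E).
  apply/measurable_EFinP; apply: measurable_sum => i; apply: measurable_funM => //.
  by apply: measurable_indic; apply: measurable_change; exact: mesh_gt0.
have N0 j w : 0 <= N j w.
  by apply: sumr_ge0 => i _; rewrite mulr_ge0// ltW// mesh_gt0.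
have NT j w : N j w <= T%:R.
  apply: (@le_trans _ _ (\sum_(i < T * 2 ^ j) mesh j)).
    apply: ler_sum => i _; have m0 := ltW (@mesh_gt0 R j).
    by apply: ler_piMr => //; rewrite indicE; case: (_ \in _).
  by rewrite sumr_const card_ord -[_ *+ _]mulr_natl (mesh_grid T j 0).1.
have cN : \forall w \ae P, [set: Omega] w -> (N j w)%:E @[j --> \oo] --> 0%E.
  apply: filterS (exclusion_cadlag SE) => w cw _.
  have [s Hs] := jump_times_finite (cadlag_coord_right y cw) (cadlag_coord_left y cw) (ler0n R T).
  have NJ j : N j w <= mesh j * (size s)%:R.
    have m0 := @mesh_gt0 R j.
    rewrite /N -mulr_sumr ler_wpM2l ?(ltW m0)//.
    pose B : R := \sum_(i < T * 2 ^ j) \sum_(c <- s)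
        (grid (mesh j) i < c <= grid (mesh j) i.+1)%R%:R.
    suff [L1 L2] : \sum_(i < T * 2 ^ j) \1_(change (mesh j) i y) w <= B /\ B <= (size s)%:R.
      exact: le_trans L1 L2.
    split.
      apply: ler_sum => i _; rewrite indicE; case: (boolP (_ \in _)); last first.
        by move=> _; apply: sumr_ge0.
      rewrite inE => -[q _ /= ne].
      have /andP[q1 q2] := clampt_in m0 i q.
      have iT : grid (mesh j) i.+1 <= (T%:R : R).
        apply: (@le_trans _ _ ((T * 2 ^ j)%:R * mesh j)); last by rewrite (mesh_grid T j 0).1.
        by rewrite ler_wpM2r ?(ltW m0)// ler_nat; exact: ltn_ord.
      have ig : grid (mesh j) i < clampt (mesh j) i q.
        rewrite lt_neqAle q1 andbT; apply: contra ne => /eqP <-; exact: eqxx.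
      have [| |c cs /andP[c1 c2]] := Hs (grid (mesh j) i) (clampt (mesh j) i q) (grid_ge0 m0 i).
      - by rewrite ig (le_trans q2 iT).
      - by rewrite eq_sym.
      rewrite (big_rem c)//= c1 (le_trans c2 q2) /= lerDl.
      by apply: sumr_ge0.
    rewrite /B exchange_big/=; apply: (@le_trans _ _ (\sum_(c <- s) (1 : R))); last first.
      by rewrite big_const_seq iter_addr addr0 count_predT.
    apply: ler_sum => c _.
    have [[i ic]|noi] := pselect (exists i : 'I_(T * 2 ^ j), grid (mesh j) i < c <= grid (mesh j) i.+1).
      rewrite (bigD1 i)//= ic big1 ?addr0// => k ki.
      case: (boolP (_ && _)) => // /andP[k1 k2]; exfalso; move/negP : ki; apply; apply/eqP/val_inj => /=.
      move: ic => /andP[i1 i2].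
      have := lt_le_trans k1 i2; have := lt_le_trans i1 k2.
      by rewrite !ltr_pM2r// !ltr_nat; lia.
    by rewrite big1// => i _; case: (boolP (_ && _)) => // ic; exfalso; apply: noi; exists i.
  have H : mesh j * (size s)%:R @[j --> \oo] --> (0 : R).
    rewrite -[X in _ --> X](mul0r ((size s)%:R : R)); apply: cvgMr_tmp.
    by apply: cvg_expr; rewrite ger0_norm ?invr_ge0// invf_lt1// ltr1n.
  apply: cvg_EFin; first by apply: nearW.
  apply: (squeeze_cvgr _ (cvg_cst 0) H).
  by apply: nearW => j; rewrite N0 NJ.
have iT : P.-integrable setT (fun=> T%:R%:E : \bar R).
  exact: (@finite_measure_integrable_cst _ _ R P setT T%:R).
have dom : \forall w \ae P, forall j, [set: Omega] w -> (`|(N j w)%:E| <= T%:R%:E)%E.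
  by apply: aeW => w j _; rewrite lee_fin ger0_norm.
have [_ _] := dominated_convergence measurableT mN (@measurable_cst _ _ _ _ setT 0%E) cN iT dom.
rewrite integral0 => /fine_cvgP[_] /cvgrPdist_le /(_ eps eps0) [J _ HJ].
exists J => j Jj; have := HJ j Jj; rewrite /= sub0r normrN.
have -> : (\int[P]_w (N j w)%:E = (mesh j * \sum_(i < T * 2 ^ j) pr (change (mesh j) i y))%:E)%E.
  have m0 := @mesh_gt0 R j.
  rewrite /N; under eq_integral do rewrite -sumEFin.
  have ic i : P.-integrable setT (fun w => (mesh j * \1_(change (mesh j) i y) w)%:E).
    under eq_fun do rewrite EFinM; apply: integrableZl => //.
    by apply: integrable_indic; exact: measurable_change.
  rewrite (@integral_sum _ _ _ _ _ measurableT _ (fun (i : 'I_(T * 2 ^ j)) w => (mesh j * \1_(change (mesh j) i y) w)%:E))//.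
  rewrite mulr_sumr -sumEFin; apply: eq_bigr => i _.
  under eq_integral do rewrite EFinM.
  rewrite integralZl//; last by apply: integrable_indic; exact: measurable_change.
  rewrite integral_indic//; last exact: measurable_change.
  by rewrite setIT EFinM; congr (_ * _)%E; apply: prE; exact: measurable_change.
rewrite /= ger0_norm//; apply: mulr_ge0; first by rewrite ltW// mesh_gt0.
by apply: sumr_ge0 => i _; exact: pr_ge0.
Qed.

End changes.

Section counting.
Context {R : realType} {T : choiceType}.
Implicit Type A : set T.

Lemma counting_eq0 A : counting A = 0%E :> \bar R -> A = set0.
Proof.
rewrite /counting; case: asboolP => // fA [] /eqP.
rewrite pnatr_eq0 cardfs_eq0 => /eqP A0.
by rewrite -[A]fset_setK// A0; apply/seteqP; split.
Qed.

Lemma counting_le1 A : (counting A <= 1 :> \bar R)%E -> forall x y, A x -> A y -> x = y.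
Proof.
rewrite /counting; case: asboolP => // fA; rewrite lee_fin lern1 => A1 x y Ax Ay.
apply: contrapT => /eqP xy.
have : (#|` [fset x; y]%fset| <= #|` fset_set A|)%N.
  apply: fsubset_leq_card; apply/fsubsetP => z.
  by rewrite !inE in_fset_set// => /orP[]/eqP ->; rewrite inE.
by rewrite cardfs2 xy => /leq_trans /(_ A1).
Qed.

End counting.

(** * Agreement of the walk with its Euler schemes *)

Section path_matching.
Context {R : realType}.
Variables (alpha beta : bool -> R) (Lambda p rho r delta : R).
Hypothesis mod : model alpha beta Lambda p rho r delta.
Context {dd : measure_display} {Omega : measurableType dd}.
Variables (P : probability Omega R) (eta : R -> Omega -> config)
  (Pi : Omega -> set (int * R * R)) (X : R -> Omega -> int).
Hypothesis EW : exclusion_walk alpha beta Lambda p rho P eta Pi X.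
Let SE := walk_environment EW.
Let PP := walk_driving EW.
Let IN := walk_independent EW.
Local Notation pr := (prob P).
Local Notation hit := (point_in Pi).

Lemma point_inP (B : set (int * R * R)) w : hit B w <-> exists z, Pi w z /\ B z.
Proof.
rewrite /point_in /point_count; split; last first.
  move=> [z [Pz Bz]]; apply/eqP => /counting_eq0 H.
  by have : (Pi w `&` B) z by []; rewrite H.
move=> /eqP H; apply: contrapT => nz; apply: H.
have -> : Pi w `&` B = set0.
  by apply/seteqP; split=> // z [Pz Bz]; apply: nz; exists z.
by rewrite /counting; case: asboolP => [_|/(_ (finite_set0 _))//]; rewrite fset_set0 cardfs0.
Qed.

Section one_mesh.
Variable h : R.
Hypothesis h_gt0 : 0 < h.
Local Notation steps := (steps alpha beta eta Pi h).
Local Notation grid := (grid h).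

Definition hitbox i (y : int) := box y (grid i) (grid i.+1) (Interval (BLeft 0) (BRight Lambda)).

Definition slab i (K : nat) : set (int * R * R) :=
  ([set y : int | `|y| <= K%:Z] `*` `]grid i, grid i.+1]) `*` `[0, Lambda].

Definition good_path w : Prop :=
  cadlag (eta ^~ w) /\ walk_path alpha beta (eta ^~ w) (Pi w) (X ^~ w).

(** A change of occupation is harmless unless the strip also contains a point above the same site,
    and with a single point near the walker the two boxes record exactly the move of the walk. *)
Lemma match_strip i K w : good_path w -> X (grid i) w = pos (steps i w) ->
  `|pos (steps i w)| + 1 <= K%:Z ->
  (point_count (R := R) Pi (slab i K) w <= 1)%E ->
  (forall y : int, `|y| <= K%:Z -> ~ (change eta h i y w /\ hit (hitbox i y) w)) ->
  X (grid i.+1) w = pos (steps i.+1 w) /\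
  forall tau, grid i <= tau <= grid i.+1 ->
    X tau w = pos (steps i w) \/ X tau w = pos (steps i.+1 w).
Proof.
move=> [cw WP] Xi xK c1 noch; have h0 := ltW h_gt0.
have g0 := grid_ge0 h_gt0 i; have gl := grid_lt h_gt0 i.
set x := pos (steps i w) in Xi xK *; pose b := eta (grid i) w x.
have sE : pos (steps i.+1 w) = disp (bits alpha beta Pi h i x b w) + x by rewrite /= pos_cons.
have inD z : Pi w z -> 0 <= z.2 <= Lambda by move=> /(poisson_sub PP)[].
have [[[tau0 u0] /= [t0 p0]]|nopt] := pselect
    (exists z : R * R, grid i < z.1 <= grid i.+1 /\ Pi w (x, z.1, z.2)); last first.
  have cst : forall tau, grid i <= tau <= grid i.+1 -> X tau w = x.
    apply: (walk_constant WP) => //; first exact: ltW.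
    by move=> tau u tt pp; apply: nopt; exists (tau, u).
  have nohit U : hit (box x (grid i) (grid i.+1) U) w = false.
    apply: negbTE; apply/negP => /(proj1 (point_inP _ _)) [[[y tau] u] [pz [[/= yx]]]]; rewrite in_itv/= => tt _.
    by apply: nopt; exists (tau, u); rewrite /= -yx.
  have E : pos (steps i.+1 w) = x by rewrite sE /bits !nohit /disp /= subrr add0r.
  rewrite E; split; first by apply: cst; rewrite lexx (ltW gl).
  by move=> tau /cst; left.
have xK' : `|x| <= K%:Z by move: xK; move: (x) => x'; clear; lia.
have uniq0 (y : int) tau u : `|y - x| <= 1 -> grid i < tau <= grid i.+1 -> Pi w (y, tau, u) ->
    tau = tau0 /\ u = u0.
  move=> yx tt pp.
  have yK : `|y| <= K%:Z by move: xK yx; move: (x) => x'; clear; lia.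
  have := counting_le1 c1; move=> /(_ (y, tau, u) (x, tau0, u0)).
  have S1 : (Pi w `&` slab i K) (y, tau, u).
    by split=> //; split; [split=> //=; rewrite in_itv|rewrite /= in_itv/=; exact: inD pp].
  have S2 : (Pi w `&` slab i K) (x, tau0, u0).
    by split=> //; split; [split=> //=; rewrite in_itv|rewrite /= in_itv/=; exact: inD p0].
  by move=> /(_ S1 S2) [].
have eb : eta tau0 w x = b.
  apply: (no_change h_gt0 cw); last by case/andP: t0 => /ltW -> ->.
  move=> ch; apply: (noch x xK'); split => //; apply: (proj2 (point_inP _ _)); exists (x, tau0, u0); split => //.
  by split; [split=> //=; rewrite in_itv|rewrite /= in_itv/=; exact: inD p0].
have [Xt Xm] := walk_one_point WP g0 Xi t0 p0 uniq0.
have E : pos (steps i.+1 w) = x + mark_disp alpha beta b u0.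
  rewrite sE [RHS]addrC; congr (_ + _).
  have hb U : hit (box x (grid i) (grid i.+1) U) w = (u0 \in U).
    apply/idP/idP.
      move=> /(proj1 (point_inP _ _)) [[[y tau] u] [pz [[/= yx]]]]; rewrite in_itv/= => tt uU.
      have [|_ <-//] := uniq0 y tau u _ tt pz; by rewrite yx subrr normr0.
    move=> uU; apply: (proj2 (point_inP _ _)); exists (x, tau0, u0); split => //.
  have /andP[u00 _] := inD _ p0.
  rewrite /bits /rbox /lbox !hb !in_itv/= u00 /= /disp /= /mark_disp.
  case: (leP u0 (alpha b)) => ua /=; first by rewrite subr0.
  by case: ifP => _ /=; rewrite ?sub0r ?subrr.
rewrite E -eb; split=> // tau /Xm [->|->]; [by left|by right; rewrite Xt].
Qed.

Lemma match_all n K w : good_path w -> (jumps (steps n w) < K)%N ->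
  (forall i, (i < n)%N -> (point_count (R := R) Pi (slab i K) w <= 1)%E) ->
  (forall i, (i < n)%N -> forall y : int, `|y| <= K%:Z ->
    ~ (change eta h i y w /\ hit (hitbox i y) w)) ->
  (forall i, (i <= n)%N -> X (grid i) w = pos (steps i w)) /\
  forall i, (i < n)%N -> forall tau, grid i <= tau <= grid i.+1 ->
    X tau w = pos (steps i w) \/ X tau w = pos (steps i.+1 w).
Proof.
move=> gw jK c1 noch.
have jmono i m : (i <= m)%N -> (jumps (steps i w) <= jumps (steps m w))%N.
  elim: m => [|m IH]; first by rewrite leqn0 => /eqP ->.
  rewrite leq_eqVlt => /predU1P[->//|]; rewrite ltnS => /IH H.
  by apply: (leq_trans H); rewrite [in leqRHS]/= jumps_cons leq_addl.
have bnd i : (i <= n)%N -> `|pos (steps i w)| + 1 <= K%:Z.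
  move=> /jmono H; have := pos_jumps (steps i w).
  move: (jumps (steps i w)) (jumps (steps n w)) (pos _) H jK => j1 j2 x; clear; lia.
have all i : (i <= n)%N -> X (grid i) w = pos (steps i w).
  elim: i => [|i IH] i_n.
    by rewrite /grid mul0r /= /pos big_nil; case: gw => _ WP; exact: walk_at0 WP.
  by have [] := match_strip gw (IH (ltnW i_n)) (bnd _ (ltnW i_n)) (c1 _ i_n) (noch _ i_n).
split=> // i i_n tau ti.
by have [_] := match_strip gw (all _ (ltnW i_n)) (bnd _ (ltnW i_n)) (c1 _ i_n) (noch _ i_n); apply.
Qed.

Definition card_ball (K : nat) : R := fine (counting [set y : int | `|y| <= K%:Z] : \bar R).

Lemma slab_prob i K : measurable [set w | ~ (point_count (R := R) Pi (slab i K) w <= 1)%E] /\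
  pr [set w | ~ (point_count (R := R) Pi (slab i K) w <= 1)%E] <= (h * (card_ball K * Lambda)) ^+ 2.
Proof.
have h0 := ltW h_gt0; have L1 := model_Lambda mod.
have c0 : 0 <= card_ball K.
  by rewrite /card_ball fine_ge0//; exact: (@measure_ge0 _ _ _ (counting : {measure set int -> \bar R})).
apply: (pr_hit2 PP).
- by apply: measurableX => //; exact: measurableX.
- move=> [[y t] u] [] [] /= _; rewrite !in_itv/= => /andP[t1 _] u01.
  by split=> //=; apply: le_trans (ltW t1); exact: grid_ge0.
- by rewrite !mulr_ge0//; lra.
- rewrite /driving_intensity product_measure1E//; last exact: measurableX.
  rewrite [X in (X * _)%E]product_measure1E//.
  have cE : counting [set y : int | `|y| <= K%:Z] = (card_ball K)%:E.
    rewrite /card_ball fineK// /counting; case: asboolP => // [[]].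
    have -> : [set y : int | `|y| <= K%:Z] = [set` win (- K%:Z) (2 * K)].
      by apply/seteqP; split=> y /=; rewrite mem_win /in_window; clear; lia.
    exact: finite_seq.
  rewrite [X in (X * _ * _)%E](_ : _ = (card_ball K)%:E)//.
  rewrite [X in (_ * X * _)%E]lebesgue_measure_itv [X in (_ * _ * X)%E]lebesgue_measure_itv /= !lte_fin.
  rewrite grid_lt// gridS; have -> : 0 < Lambda by lra.
  rewrite -!EFinB -!EFinM; congr _%:E; ring.
Qed.

Lemma measurable_hitbox i y : measurable [set w | hit (hitbox i y) w].
Proof. by apply: (measurable_point_in PP true); exact: measurable_box. Qed.

(** [change] is an event of the environment, hence independent of the Poisson points, and the box is
    hit with probability at most h Lambda. *)
Lemma change_hit_prob i y :
  measurable (change eta h i y `&` [set w | hit (hitbox i y) w]) /\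
  pr (change eta h i y `&` [set w | hit (hitbox i y) w]) <= h * Lambda * pr (change eta h i y).
Proof.
have h0 := ltW h_gt0; have L1 := model_Lambda mod.
have mC := measurable_change SE h_gt0 i y; have mH := measurable_hitbox i y.
have mCH := measurableI _ _ mC mH.
split=> //.
have := IN (change_sigma (eta := eta) h_gt0 i y) (_ : points_sigma (R := R) Pi [set w | hit (hitbox i y) w]).
have mB : measurable (hitbox i y) by exact: measurable_box.
have : points_sigma (R := R) Pi [set w | hit (hitbox i y) w].
  apply: sub_sigma_algebra; exists (hitbox i y), (~` [set 0%E]); split => //.
    exact: measurableC.
  by apply/seteqP; split=> w; rewrite /point_in /= => /eqP.
move=> H /(_ H); rewrite [in X in X -> _]prE// !prE// -EFinM => H1; rewrite (EFin_inj H1).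
rewrite mulrC ler_wpM2r ?pr_ge0//.
have hL : 0 <= h * Lambda by rewrite mulr_ge0//; lra.
have HB : driving_intensity (hitbox i y) = (h * Lambda)%:E.
  rewrite intensity_box//; last lra.
    by rewrite gridS; congr _%:E; ring.
  by apply: ltW; exact: grid_lt.
have sub : hitbox i y `<=` driving_space Lambda by apply: box_sub => //; exact: grid_ge0.
rewrite (pr_hit PP true mB sub hL HB).
by have := expR_ge1Dx (- (h * Lambda)); lra.
Qed.

End one_mesh.

(** Three bad events. At least K jumps: excluded by an exponential moment. Two points in a slab:
    probability O(h^2) in each of T / h strips. A change together with a point: for each site,
    Lambda h times the mean number of strips with a change, small by [change_prob]. *)
Lemma path_match T (eps : R) : 0 < eps -> exists J, forall j, (J <= j)%N ->
  exists Bad, [/\ measurable Bad, pr Bad <= eps & forall w, good_path w -> ~ Bad w ->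
    (forall i, (i <= T * 2 ^ j)%N ->
       X (grid (mesh j) i) w = pos (steps alpha beta eta Pi (mesh j) i w)) /\
    forall i, (i < T * 2 ^ j)%N -> forall tau, grid (mesh j) i <= tau <= grid (mesh j) i.+1 ->
      X tau w = pos (steps alpha beta eta Pi (mesh j) i w) \/
      X tau w = pos (steps alpha beta eta Pi (mesh j) i.+1 w)].
Proof.
move=> eps0; have L1 := model_Lambda mod.
have e30 : 0 < eps / 3 by rewrite divr_gt0.
have near_small (C : R) (e : R) : 0 < e -> exists J, forall j, (J <= j)%N -> mesh j * C <= e.
  move=> e0; apply: (@near_mesh R (fun h => h * C <= e)).
  near=> h; apply: (@le_trans _ _ (h * (`|C| + 1))).
    by rewrite ler_wpM2l//; have := ler_norm C; lra.
  have C0 : 0 < `|C| + 1 by have := normr_ge0 C; lra.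
  by rewrite -ler_pdivlMr//; near: h; apply: nbhs_right_le; rewrite divr_gt0.
have [K HK] := near_small (expR (Lambda * T%:R)) _ e30.
have {}HK := HK K (leqnn K).
pose l := win (- K%:Z) (2 * K).
pose e2 := eps / 3 / (Lambda * ((size l)%:R + 1)).
have sl0 : 0 < (size l)%:R + 1 :> R by rewrite ltr_wpDl.
have e20 : 0 < e2 by rewrite divr_gt0// mulr_gt0//; lra.
have [J1 HJ1] : exists J, forall j, (J <= j)%N -> forall y, y \in l ->
    mesh j * \sum_(i < T * 2 ^ j) pr (change eta (mesh j) i y) <= e2.
  elim: (l) => [|y l' [J IH]]; first by exists 0%N.
  have [J' HJ'] := change_prob SE y T e20.
  exists (maxn J J') => j; rewrite geq_max => /andP[j1 j2] y'.
  by rewrite inE => /predU1P[->|yl']; [exact: HJ'|exact: IH].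
have [J2 HJ2] := near_small (T%:R * (card_ball K * Lambda) ^+ 2) _ e30.
exists (maxn J1 J2) => j; rewrite geq_max => /andP[/HJ1 {}HJ1 /HJ2 {}HJ2].
have m0 := @mesh_gt0 R j; set h := mesh j in m0 HJ1 HJ2 *; set n := (T * 2 ^ j)%N.
have nh : n%:R * h = T%:R := (mesh_grid T j 0).1.
pose B1 := [set w | (K <= jumps (steps alpha beta eta Pi h n w))%N].
pose F2 (i : 'I_n) := [set w | ~ (point_count (R := R) Pi (slab h i K) w <= 1)%E].
pose F3 (iy : 'I_n * int) := change eta h iy.1 iy.2 `&` [set w | hit (hitbox h iy.1 iy.2) w].
pose B2 := \big[setU/set0]_(i <- index_enum 'I_n) F2 i.
pose B3 := \big[setU/set0]_(iy <- [seq (i, y) | i <- index_enum 'I_n, y <- l]) F3 iy.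
have [mB1 pB1] := @pr_steps R alpha beta Lambda p rho dd Omega P eta Pi SE PP h m0 n
  (fun s => (K <= jumps s)%N).
have mF2 i : measurable (F2 i) by have [] := slab_prob m0 i K.
have mF3 iy : measurable (F3 iy) by have [] := change_hit_prob m0 iy.1 iy.2.
have mB2 : measurable B2 by exact: bigsetU_measurable.
have mB3 : measurable B3 by exact: bigsetU_measurable.
exists (B1 `|` (B2 `|` B3)); split.
- by apply: measurableU => //; exact: measurableU.
- have P1 : pr B1 <= eps / 3.
    rewrite /B1 pB1; apply: le_trans HK.
    apply: (@le_trans _ _ (steps_mean alpha beta P eta Pi h n (fun s => mesh K * 2 ^+ jumps s + 0 * 1))).
      apply: steps_mean_le => s; rewrite mul0r addr0; case: leqP => Ks /=.
        rewrite -(subnK Ks) exprD mulrCA -exprMn mulVf// expr1n mulr1.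
        by rewrite exprn_ege1// ler1n.
      by rewrite mulr_ge0 ?exprn_ge0// ltW// mesh_gt0.
    rewrite steps_mean_lin mul0r addr0 ler_wpM2l ?(ltW (mesh_gt0 K))//.
    have := exp_jumps_all mod SE PP IN m0 n (ler1n R 2).
    have -> // : (2 - 1) * Lambda * h * n%:R = Lambda * T%:R by rewrite -nh; ring.
  have P2 : pr B2 <= eps / 3.
    apply: (le_trans (pr_bigU _ _ mF2)); apply: le_trans HJ2.
    apply: (@le_trans _ _ (\sum_(i < n) (h * (card_ball K * Lambda)) ^+ 2)).
      by apply: ler_sum => i _; have [] := slab_prob m0 i K.
    rewrite sumr_const card_ord -[_ *+ _]mulr_natl -nh.
    have -> // : n%:R * (h * (card_ball K * Lambda)) ^+ 2 = h * (n%:R * h * (card_ball K * Lambda) ^+ 2) by ring.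
  have P3 : pr B3 <= eps / 3.
    apply: (le_trans (pr_bigU _ _ mF3)).
    rewrite big_allpairs_dep /= exchange_big /=.
    apply: (@le_trans _ _ (\sum_(y <- l) Lambda * e2)).
      rewrite big_seq [leRHS]big_seq; apply: ler_sum => y yl.
      apply: le_trans (ler_wpM2l _ (HJ1 y yl)); last lra.
      rewrite mulrA mulr_sumr; apply: ler_sum => i _.
      by have [_] := change_hit_prob m0 i y; rewrite [h * Lambda]mulrC.
    rewrite big_const_seq count_predT iter_addr_0 -[(Lambda * e2) *+ _]mulr_natl /e2.
    have e' := ltW e30; have L0 : Lambda != 0 by apply: lt0r_neq0; lra.
    have -> : (size l)%:R * (Lambda * (eps / 3 / (Lambda * ((size l)%:R + 1)))) =
       eps / 3 * ((size l)%:R / ((size l)%:R + 1)) by field; rewrite L0 /= gt_eqF.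
    by rewrite ler_piMr// ler_pdivrMr// mul1r; lra.
  have := pr_leU P mB2 mB3; have := pr_leU P mB1 (measurableU _ _ mB2 mB3); lra.
move=> w gw nB.
apply: (match_all m0 (K := K)) => //.
- by rewrite ltnNge; apply/negP => H; apply: nB; left.
- move=> i i_n; apply: contrapT => H; apply: nB; right; left.
  by rewrite /B2 -bigcup_seq; exists (Ordinal i_n) => //=; rewrite mem_index_enum.
- move=> i i_n y yK [c1 c2]; apply: nB; right; right.
  rewrite /B3 -bigcup_seq; exists (Ordinal i_n, y); last by split.
  change (is_true ((Ordinal i_n, y) \in [seq (i, y) | i <- index_enum (ordinal n : finType), y <- l])); apply/allpairsPdep; exists (Ordinal i_n), y; split=> //=; first by rewrite mem_index_enum.
  by rewrite mem_win /in_window; move: yK; clear; lia.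
Unshelve. all: by end_near. Qed.

End path_matching.

(** * The law of the walk *)

Section law_limit.
Context {R : realType}.
Variables (alpha beta : bool -> R) (Lambda p rho r delta : R).
Hypothesis mod : model alpha beta Lambda p rho r delta.
Context {dd : measure_display} {Omega : measurableType dd}.
Variables (P : probability Omega R) (eta : R -> Omega -> config)
  (Pi : Omega -> set (int * R * R)) (X : R -> Omega -> int).
Hypothesis EW : exclusion_walk alpha beta Lambda p rho P eta Pi X.
Let SE := walk_environment EW.
Let PP := walk_driving EW.
Local Notation pr := (prob P).
Local Notation steps := (steps alpha beta eta Pi).
Local Notation at_steps := (steps_at alpha beta eta Pi).
Local Notation EY := (steps_mean alpha beta P eta Pi).
Local Notation euler_law := (euler_mean alpha beta P eta Pi).

Lemma measurable_at (h : R) i l : 0 < h -> measurable (at_steps h i l).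
Proof. move=> h0; exact: (@mat R alpha beta Lambda p rho dd Omega P eta Pi SE PP h h0 i l). Qed.

Lemma pr_lists (h : R) i A : 0 < h -> measurable A ->
  pr A = \sum_(l <- lists i) pr (A `&` at_steps h i l).
Proof.
move=> h0 mA.
have H (s : seq (seq (bool * bool))) : uniq s ->
    measurable [set w | steps h i w \in s] /\
    pr (A `&` [set w | steps h i w \in s]) = \sum_(l <- s) pr (A `&` at_steps h i l).
  elim: s => [|l s IH] /=.
    rewrite big_nil (_ : [set w | _] = set0); last by apply/seteqP; split.
    by rewrite setI0 pr_set0; split.
  move=> /andP[ls us]; have [m1 e1] := IH us; have m2 := measurable_at i l h0.
  rewrite big_cons -e1 (_ : [set w | steps h i w \in l :: s] = at_steps h i l `|` [set w | steps h i w \in s]).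
    split; first exact: measurableU.
    rewrite setIUr prU; [by []|exact: measurableI|exact: measurableI|].
     apply/seteqP; split=> // w [[_ /= E] [_ /=]]; rewrite /steps_at /= in E.
    by rewrite E (negbTE ls).
  by apply/seteqP; split=> w /=; rewrite inE => H; [exact/predU1P|exact/predU1P].
have [_ <-] := H _ (uniq_lists i); congr pr; apply/seteqP; split=> [w Aw|w []//].
by split => //=; exact: steps_lists.
Qed.

Lemma steps_mean_diff (h h' M : R) i i' (g : int -> R) : 0 < h -> 0 < h' ->
  (forall x, `|g x| <= M) ->
  measurable [set w | pos (steps h i w) != pos (steps h' i' w)] /\
  `|EY h i (fun l => g (pos l)) - EY h' i' (fun l => g (pos l))| <=
  2 * M * pr [set w | pos (steps h i w) != pos (steps h' i' w)].
Proof.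
move=> h0 h0' gM; have M0 : 0 <= M by apply: le_trans (gM 0); exact: normr_ge0.
set D := [set w | _].
have mt l := measurable_at i l h0; have mt' l := measurable_at i' l h0'.
have mD : measurable D.
  have -> : D = \big[setU/set0]_(l <- lists i) \big[setU/set0]_(l' <- [seq l' <- lists i' | pos l != pos l'])
      (at_steps h i l `&` at_steps h' i' l').
    apply/seteqP; split=> w.
      move=> Dw; rewrite -bigcup_seq; exists (steps h i w); first exact: steps_lists.
      rewrite -bigcup_seq; exists (steps h' i' w) => //=.
      by rewrite mem_filter steps_lists andbT.
    rewrite -bigcup_seq => -[l _]; rewrite -bigcup_seq => -[l' /=].
    by rewrite mem_filter => /andP[ne _] [/= E E']; rewrite /D /= E E'.
  by apply: bigsetU_measurable => l _; apply: bigsetU_measurable => l' _; exact: measurableI.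
split=> //.
have -> : EY h i (fun l => g (pos l)) =
    \sum_(l <- lists i) \sum_(l' <- lists i') g (pos l) * pr (at_steps h i l `&` at_steps h' i' l').
  by apply: eq_bigr => l _; rewrite -mulr_sumr -pr_lists.
have -> : EY h' i' (fun l => g (pos l)) =
    \sum_(l <- lists i) \sum_(l' <- lists i') g (pos l') * pr (at_steps h i l `&` at_steps h' i' l').
  rewrite exchange_big /=; apply: eq_bigr => l' _; rewrite -mulr_sumr; congr (_ * _).
  by rewrite (pr_lists i h0)//; apply: eq_bigr => l _; rewrite setIC.
rewrite -sumrB (pr_lists i h0 mD) mulr_sumr; apply: (le_trans (ler_norm_sum _ _ _)).
apply: ler_sum => l _; rewrite -sumrB (pr_lists i' h0'); last exact: measurableI.
rewrite mulr_sumr; apply: (le_trans (ler_norm_sum _ _ _)).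
apply: ler_sum => l' _; rewrite -mulrBl normrM (ger0_norm (pr_ge0 _ _)).
have [pp|pp] := eqVneq (pos l) (pos l').
  by rewrite pp subrr normr0 mul0r !mulr_ge0 ?pr_ge0.
have -> : D `&` at_steps h i l `&` at_steps h' i' l' = at_steps h i l `&` at_steps h' i' l'.
  rewrite -setIA; apply/seteqP; split=> w; first by case.
  by move=> H; split=> //; case: H => [/= E E']; rewrite /D /= E E'.
rewrite ler_wpM2r ?pr_ge0//; apply: (le_trans (ler_normB _ _)).
by have := gM (pos l); have := gM (pos l'); lra.
Qed.

Lemma good_path_ae : {ae P, forall w, good_path alpha beta eta Pi X w}.
Proof. by apply: filterS2 (exclusion_cadlag SE) (walk_paths EW) => w; split. Qed.

(** Off their bad events two schemes agree with [X T], hence with each other: the walk serves as a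
    coupling of the schemes. *)
Lemma euler_mean_cauchy T (M eps : R) : 0 < eps -> exists J, forall j j', (J <= j)%N -> (J <= j')%N ->
  forall g, (forall x, `|g x| <= M) -> `|euler_law j T g - euler_law j' T g| <= eps.
Proof.
move=> eps0.
have e0 : 0 < eps / (4 * (`|M| + 1)).
  by rewrite divr_gt0// mulr_gt0// ltr_wpDl.
have [J HJ] := path_match mod EW T e0.
exists J => j j' /HJ[B [mB pB HB]] /HJ[B' [mB' pB' HB']] g gM.
have [N [mN N0 HN]] := good_path_ae.
have M0 : 0 <= M by apply: le_trans (gM 0); exact: normr_ge0.
have [mD H] := steps_mean_diff (T * 2 ^ j) (T * 2 ^ j') (mesh_gt0 j) (mesh_gt0 j') gM.
apply: (le_trans H); set D := [set w | _] in mD H *.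
have mBB : measurable (B `|` B') by exact: measurableU.
have : pr D <= pr (B `|` B') + pr N.
  apply: pr_le_cases => // w Dw; apply: contrapT => nw.
  have gw : good_path alpha beta eta Pi X w by apply: contrapT => ng; apply: nw; right; exact: HN.
  have [/(_ _ (leqnn _)) E _] := HB w gw (fun b => nw (or_introl (or_introl b))).
  have [/(_ _ (leqnn _)) E' _] := HB' w gw (fun b => nw (or_introl (or_intror b))).
  move: Dw; rewrite /D /= -E -E' /grid (mesh_grid _ j 0).1 (mesh_grid _ j' 0).1.
  by rewrite eqxx.
have := pr_leU P mB mB'.
have -> : pr N = 0 by rewrite /prob N0.
move=> H1 H2; have H3 : pr D <= 2 * (eps / (4 * (`|M| + 1))) by lra.
apply: (@le_trans _ _ (2 * M * (2 * (eps / (4 * (`|M| + 1)))))).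
  by rewrite ler_wpM2l// mulr_ge0.
have -> : 2 * M * (2 * (eps / (4 * (`|M| + 1)))) = eps * (M / (`|M| + 1)).
  by field; rewrite gt_eqF// ltr_wpDl.
rewrite ger0_norm// ler_piMr ?(ltW eps0)// ler_pdivrMr ?ltr_wpDl//; lra.
Qed.

(** Stands for the expectation of [g (X T)], without measurability of [X T]. *)
Definition walk_mean (T : nat) (g : int -> R) : R := lim (euler_law j T g @[j --> \oo]).

Lemma walk_mean_near T (M eps : R) : 0 < eps -> exists J, forall j, (J <= j)%N ->
  forall g, (forall x, `|g x| <= M) -> `|euler_law j T g - walk_mean T g| <= eps.
Proof.
move=> eps0; have [J HJ] := euler_mean_cauchy T M eps0.
exists J => j Jj g gM; apply/ler_addgt0Pr => e e0.
have cv : cvg (euler_law k T g @[k --> \oo]).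
  apply: cauchy_cvg; apply: cauchy_exP => e' e'0.
  have [J' HJ'] := euler_mean_cauchy T M (divr_gt0 e'0 (@ltr0Sn R 1)).
  exists (euler_law J' T g); exists J' => // k /= Jk.
  have := HJ' J' k (leqnn _) Jk g gM; rewrite /ball /=; lra.
have /cvgrPdist_le/(_ e e0)[J' _ HJ'] : euler_law k T g @[k --> \oo] --> walk_mean T g by [].
have := HJ' (maxn J J') (leq_maxr _ _); have := HJ j (maxn J J') Jj (leq_maxl _ _) g gM.
set a := euler_law j T g; set b := euler_law _ T g; set c := walk_mean T g.
move=> ab cb; have -> : a - c = (a - b) - (c - b) by ring.
by apply: (le_trans (ler_normB _ _)); exact: lerD.
Qed.

End law_limit.

Section clipping.
Context {R : realType}.

(** A bounded nondecreasing substitute for the position, as the decoupling inequality demands. *)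
Definition clip (n : nat) (x : int) : R := (Num.min (Num.max x 0) n%:Z)%:~R.

Lemma clip01 n x : 0 <= clip n x <= n%:R.
Proof.
rewrite /clip ler0z -[n%:R]/((n%:Z)%:~R) ler_int.
by move: x n; clear; lia.
Qed.

Lemma clip_mono n x : clip n x <= clip n (x + 1).
Proof. by rewrite /clip ler_int; move: x n; clear; lia. Qed.

(** All that Hammersley's argument uses of the laws at integer times. [B] is a speed that is
    exceeded with exponentially small probability only. *)
Record additive_laws (L : nat -> (int -> R) -> R) (B : nat) (C r delta : R) : Prop := {
  laws_lin : forall t a (f g : int -> R) M, (forall x, `|f x| <= M) -> (forall x, `|g x| <= M) ->
    L t (fun x => a * f x + g x) = a * L t f + L t g ;
  laws_le : forall t (f g : int -> R) M, (forall x, `|f x| <= M) -> (forall x, `|g x| <= M) ->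
    (forall x, f x <= g x) -> L t f <= L t g ;
  laws_cst1 : forall t, L t (fun=> 1) = 1 ;
  laws_decouple : forall s t k (g : int -> R), (forall x, 0 <= g x <= 1) ->
    (forall x, g x <= g (x + 1)) ->
    L (s + t)%N g <= L s (fun y => L t (fun x => g (x + y + (2 * k)%:Z))) + C * r ^+ k ;
  laws_tail : forall t, L t (fun x => (((B * t)%:Z < x)%R%:R)) <= 2^-1 ^+ t ;
  laws_mean : forall t, (1 + delta) * t%:R - 1 <= L t (clip (B * t))
}.

End clipping.

(** * Properties of the limit laws *)

Section walk_laws.
Context {R : realType}.
Variables (alpha beta : bool -> R) (Lambda p rho r delta : R).
Hypothesis mod : model alpha beta Lambda p rho r delta.
Context {dd : measure_display} {Omega : measurableType dd}.
Variables (P : probability Omega R) (eta : R -> Omega -> config)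
  (Pi : Omega -> set (int * R * R)) (X : R -> Omega -> int).
Hypothesis EW : exclusion_walk alpha beta Lambda p rho P eta Pi X.
Let SE := walk_environment EW.
Let PP := walk_driving EW.
Let IN := walk_independent EW.
Local Notation euler_law := (euler_mean alpha beta P eta Pi).
Local Notation walk_law := (walk_mean alpha beta P eta Pi).
Local Notation chain_law := (chain_mean alpha beta Lambda p rho).

Lemma euler_mean_lin j T a b (f g : int -> R) :
  euler_law j T (fun x => a * f x + b * g x) = a * euler_law j T f + b * euler_law j T g.
Proof. exact: steps_mean_lin. Qed.

Lemma euler_mean_cst j T c : euler_law j T (fun=> c) = c.
Proof.
have H := euler_mean_lin j T c 0 (fun=> 1) (fun=> 1).
have E1 : euler_law j T (fun=> 1) = 1 by exact: (steps_mean1 alpha beta SE PP (mesh_gt0 j)).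
move: H; rewrite E1 mulr1 mul0r addr0 => H; rewrite -[RHS]H.
by congr (euler_mean _ _ _ _ _ _ _ _); apply/funext => x; rewrite mulr1 mul0r addr0.
Qed.

Lemma euler_mean_le j T (f g : int -> R) : (forall x, f x <= g x) -> euler_law j T f <= euler_law j T g.
Proof. by move=> fg; apply: steps_mean_le. Qed.

Lemma euler_mean_norm j T (f : int -> R) M : (forall x, `|f x| <= M) -> `|euler_law j T f| <= M.
Proof.
move=> fM; rewrite ler_norml -{1}(euler_mean_cst j T (- M)) -{2}(euler_mean_cst j T M).
by rewrite !euler_mean_le// => x; have := fM x; rewrite ler_norml => /andP[].
Qed.

Lemma walk_mean_close T (f : int -> R) M c : (forall x, `|f x| <= M) ->
  (forall e, 0 < e -> exists J, forall j, (J <= j)%N -> `|euler_law j T f - c| <= e) ->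
  walk_law T f = c.
Proof.
move=> fM H; apply/eqP; rewrite -subr_eq0 -normr_le0; apply/ler_addgt0Pr => e e0.
have e2 : 0 < e / 2 by rewrite divr_gt0.
have [J HJ] := H _ e2; have [J' HJ'] := walk_mean_near mod EW T M e2.
have := HJ (maxn J J') (leq_maxl _ _); have := HJ' (maxn J J') (leq_maxr _ _) f fM.
set a := euler_law _ _ _ => H1 H2; rewrite distrC in H1.
have := ler_normD (walk_law T f - a) (a - c); rewrite subrKA; lra.
Qed.

Lemma walk_mean_le_of T (f : int -> R) M c : (forall x, `|f x| <= M) ->
  (forall e, 0 < e -> exists J, forall j, (J <= j)%N -> euler_law j T f <= c + e) ->
  walk_law T f <= c.
Proof.
move=> fM H; apply/ler_addgt0Pr => e e0.
have e2 : 0 < e / 2 by rewrite divr_gt0.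
have [J HJ] := H _ e2; have [J' HJ'] := walk_mean_near mod EW T M e2.
have := HJ (maxn J J') (leq_maxl _ _); have := HJ' (maxn J J') (leq_maxr _ _) f fM.
rewrite ler_norml => /andP[]; lra.
Qed.

Lemma walk_mean_norm T (f : int -> R) M : (forall x, `|f x| <= M) -> `|walk_law T f| <= M.
Proof.
move=> fM; apply/ler_addgt0Pr => e e0; have [J HJ] := walk_mean_near mod EW T M e0.
have := HJ J (leqnn _) f fM; have := @euler_mean_norm J T _ _ fM.
set a := euler_law _ _ _ => H1 H2; rewrite distrC in H2.
have := ler_normD (walk_law T f - a) a; rewrite subrK; lra.
Qed.

Lemma walk_mean_lin T a (f g : int -> R) M : (forall x, `|f x| <= M) -> (forall x, `|g x| <= M) ->
  walk_law T (fun x => a * f x + g x) = a * walk_law T f + walk_law T g.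
Proof.
move=> fM gM; apply: (@walk_mean_close T _ (`|a| * M + M)).
  by move=> x; apply: (le_trans (ler_normD _ _)); rewrite lerD// normrM ler_wpM2l.
move=> e e0; have e2 : 0 < e / (`|a| + 1) by rewrite divr_gt0// ltr_wpDl.
have [J HJ] := walk_mean_near mod EW T M e2; exists J => j /HJ {}HJ.
have -> : euler_law j T (fun x => a * f x + g x) = a * euler_law j T f + euler_law j T g.
  by rewrite -[X in _ + X]mul1r -euler_mean_lin; congr (euler_mean _ _ _ _ _ _ _ _); apply/funext => x; rewrite mul1r.
set b := euler_law j T f; set c := euler_law j T g.
have -> : a * b + c - (a * walk_law T f + walk_law T g) = a * (b - walk_law T f) + (c - walk_law T g) by ring.
apply: (le_trans (ler_normD _ _)); rewrite normrM.
have H1 := ler_wpM2l (normr_ge0 a) (HJ f fM); have H2 := HJ g gM.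
apply: (le_trans (lerD H1 H2)).
have -> // : `|a| * (e / (`|a| + 1)) + e / (`|a| + 1) = e.
by field; rewrite gt_eqF// ltr_wpDl.
Qed.

Lemma walk_mean_le T (f g : int -> R) M : (forall x, `|f x| <= M) -> (forall x, `|g x| <= M) ->
  (forall x, f x <= g x) -> walk_law T f <= walk_law T g.
Proof.
move=> fM gM fg; apply: (walk_mean_le_of fM) => e e0.
have [J HJ] := walk_mean_near mod EW T M e0; exists J => j /HJ/(_ g gM).
by have := euler_mean_le j T fg; rewrite ler_norml => H /andP[]; lra.
Qed.

Lemma walk_mean_cst T c : walk_law T (fun=> c) = c.
Proof.
apply: (@walk_mean_close T _ `|c|) => // e e0; exists 0%N => j _.
by rewrite euler_mean_cst subrr normr0 ltW.
Qed.

Lemma euler_mean_exp j T : euler_law j T (fun x => (2 ^+ absz x)) <= expR (Lambda * T%:R).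
Proof.
have := exp_jumps_all mod SE PP IN (mesh_gt0 j) (T * 2 ^ j) (ler1n R 2).
have -> : (2 - 1) * Lambda * mesh j * (T * 2 ^ j)%:R = Lambda * T%:R.
  by rewrite -(@mesh_grid R T j 0).1; ring.
apply: le_trans; apply: steps_mean_le => l; apply: ler_weXn2l; first by rewrite ler1n.
by have := pos_jumps l; clear; lia.
Qed.

Lemma remote_le (a : int) (n N : nat) : a <= - N%:Z -> N%:Z <= a + n%:Z ->
  remote r a n <= r ^+ N + 2^-1 ^+ N.
Proof.
have /andP[r0 r1] := model_r mod; rewrite /remote => aN aN'.
have -> : - a = (absz a)%:Z by move: aN; clear; lia.
have -> : a + n%:Z = (absz (a + n%:Z))%:Z by move: aN'; clear; lia.
rewrite lerD// -exprnP; apply: ler_wiXn2l => //; rewrite ?invr_ge0 ?invf_le1 ?ler1n//; try exact: ltW.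
  by move: aN; clear; lia.
by move: aN'; clear; lia.
Qed.

Lemma remote_small (c e : R) : 0 < e -> exists N : nat, forall (a : int) (n : nat),
  a <= - N%:Z -> N%:Z <= a + n%:Z -> c * remote r a n <= e.
Proof.
move=> e0; have /andP[r0 r1] := model_r mod.
have e1 : 0 < e / (2 * (`|c| + 1)) by rewrite divr_gt0// mulr_gt0// ltr_wpDl.
have c0 : 0 < `|c| + 1 by rewrite ltr_wpDl.
have H (q : R) : 0 < q -> q < 1 -> exists N, forall n, (N <= n)%N -> q ^+ n <= e / (2 * (`|c| + 1)).
  move=> q0 q1; have /cvgrPdist_le/(_ _ e1)[N _ HN] : q ^+ n @[n --> \oo] --> (0 : R).
    by apply: cvg_expr; rewrite gtr0_norm.
  exists N => n /HN; rewrite sub0r normrN ger0_norm// exprn_ge0// ltW//.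
have [N1 H1] := H r r0 r1; have [N2 H2] : exists N, forall n, (N <= n)%N -> 2^-1 ^+ n <= e / (2 * (`|c| + 1)).
  by apply: H; rewrite ?invr_gt0// invf_lt1// ltr1n.
exists (maxn N1 N2) => a n aN aN'.
have K := remote_le aN aN'; have K1 := H1 _ (leq_maxl N1 N2); have K2 := H2 _ (leq_maxr N1 N2).
have r_ge0 : 0 <= remote r a n by rewrite addr_ge0// exprz_ge0 ?invr_ge0// ltW.
apply: (@le_trans _ _ ((`|c| + 1) * remote r a n)).
  by rewrite ler_wpM2r//; have := ler_norm c; lra.
apply: (@le_trans _ _ ((`|c| + 1) * (2 * (e / (2 * (`|c| + 1)))))).
  by rewrite ler_wpM2l ?(ltW c0)//; lra.
by have -> : (`|c| + 1) * (2 * (e / (2 * (`|c| + 1)))) = e by field; rewrite gt_eqF.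
Qed.

Lemma chain_mean_shift (y : int) a n j T (g : int -> R) :
  chain_law a n j T g y = chain_law (a - y) n j T (fun x => g (x + y)) 0.
Proof.
rewrite /chain_mean -{1}[a](subrK y) -[LHS](window_mean_shift mod (a - y) n y).
congr (window_mean _ _ _ _); apply/funext => z.
by rewrite (evolve_shift mod) add0r subrK.
Qed.

(** The passage of [evolve_decouple] to fine meshes and large windows. A restart at y' is compared
    with a start from 0 in the window shifted by y'. This is uniform over finitely many y' only; the
    others are excluded by the tail of the first stage. *)
Lemma walk_mean_decouple s t k (g : int -> R) : (forall x, 0 <= g x <= 1) ->
  (forall x, g x <= g (x + 1)) ->
  walk_law (s + t)%N g <= walk_law s (fun y => walk_law t (fun x => g (x + y + (2 * k)%:Z))) +
    2 * (3 + tail_cst Lambda r delta) * r ^+ k.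
Proof.
move=> g01 gi; apply/ler_addgt0Pr => e e0.
have L1 := model_Lambda mod.
have gn (y x : int) : `|g (x + y)| <= 1.
  by have /andP[? ?] := g01 (x + y); rewrite ger0_norm.
have gn0 x : `|g x| <= 1 by have := gn 0 x; rewrite addr0.
(* Ten errors: two each in [A1] and [A2], one each in [A4] and [A5], and four in [B1]. *)
pose e1 := e / 10; have e10 : 0 < e1 by rewrite divr_gt0.
pose G y := walk_law t (fun x => g (x + y + (2 * k)%:Z)).
have GE y : G y = walk_law t (fun x => g (x + (y + (2 * k)%:Z))).
  by congr (walk_mean _ _ _ _ _ _ _); apply/funext => x; rewrite addrA.
have Gn y : `|G y| <= 1 by rewrite GE; apply: walk_mean_norm => x; exact: gn.
pose D T : R := T%:R * (4 * Lambda + 4) * growth Lambda r T%:R.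
have [N1 HN1] := remote_small (D (s + t)%N) e10.
have [N2 HN2] := remote_small (D s) e10.
have [N3 HN3] := remote_small (D t) e10.
have [K HK] : exists K : nat, 2^-1 ^+ K * expR (Lambda * s%:R) <= e1.
  have /cvgrPdist_le/(_ (e1 / expR (Lambda * s%:R)))[|N _ HN] : (2^-1 : R) ^+ n @[n --> \oo] --> (0 : R).
  - by apply: cvg_expr; rewrite ger0_norm ?invr_ge0// invf_lt1// ltr1n.
  - by rewrite divr_gt0// expR_gt0.
  exists N; have := HN N (leqnn N); rewrite sub0r normrN ger0_norm ?exprn_ge0 ?invr_ge0//.
  by rewrite ler_pdivlMr// expR_gt0.
(* The summand K + 2 k keeps both ends far from the origin after the shift by any y' in the list [l]
   below. *)
pose N := (N1 + N2 + N3 + K + 2 * k)%N; pose a : int := - N%:Z; pose n := (2 * N)%N.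
have [J1 HJ1] := @law_approx R alpha beta Lambda p rho r delta mod dd Omega P eta Pi SE PP IN (s + t)%N a n e1 e10.
have [J2 HJ2] := @law_approx R alpha beta Lambda p rho r delta mod dd Omega P eta Pi SE PP IN s a n e1 e10.
have /choice[J3 HJ3] : forall y : int, exists J, forall j, (J <= j)%N -> small_step Lambda n (mesh j : R) /\
    forall g, (forall x, `|g x| <= 1) ->
    `|euler_law j t g - chain_law (a - y) n j t g 0| <= D t * remote r (a - y) n + e1.
  by move=> y; exact: (@law_approx R alpha beta Lambda p rho r delta mod dd Omega P eta Pi SE PP IN t (a - y) n e1 e10).
have [J4 HJ4] := walk_mean_near mod EW (s + t)%N 1 e10.
have [J5 HJ5] := walk_mean_near mod EW s 1 e10.
have [J6 HJ6] := walk_mean_near mod EW t 1 e10.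
pose l := win (- K%:Z + (2 * k)%:Z) (2 * K).
pose j := (J1 + (J2 + (J4 + (J5 + (J6 + \max_(y <- l) J3 y)))))%N.
have jJ3 y : y \in l -> (J3 y <= j)%N.
  by move=> yl; do 5 (apply: leq_trans (leq_addl _ _)); exact: leq_bigmax_seq.
have [|hs A1] := HJ1 j; first by exact: leq_addr.
have {}A1 := A1 g gn0.
have [|_ A2] := HJ2 j; first by rewrite /j; clear; lia.
have A4 : `|euler_law j (s + t) g - walk_law (s + t)%N g| <= e1.
  by apply: HJ4 => //; rewrite /j; move: (\max_(y <- l) _)%N; clear; lia.
have A5 : `|euler_law j s G - walk_law s G| <= e1.
  by apply: HJ5 => //; rewrite /j; move: (\max_(y <- l) _)%N; clear; lia.
have A6 y : `|euler_law j t (fun x => g (x + y)) - walk_law t (fun x => g (x + y))| <= e1.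
  by apply: HJ6 => //; rewrite /j; move: (\max_(y <- l) _)%N; clear; lia.
pose Gj (x : int) : R := chain_law a n j t g (x + (2 * k)%:Z).
have rho01 := model_rho mod.
have Gjn x : `|Gj x| <= 1.
  rewrite ler_norml /Gj /chain_mean -{1}(window_mean_cst rho a n (- 1)) -{2}(window_mean_cst rho a n 1).
  by rewrite !window_mean_le// => z; have := @evolve_norm R alpha beta Lambda p rho r delta mod a n (mesh j) (t * 2 ^ j) g 1 hs gn0 z (x + (2 * k)%:Z); rewrite ler_norml => /andP[].
have {}A2 := A2 Gj Gjn.
have dec : chain_law a n j (s + t) g 0 <= chain_law a n j s Gj 0 + 2 * (3 + tail_cst Lambda r delta) * r ^+ k.
  have := @evolve_decouple R alpha beta Lambda p rho r delta mod a n (mesh j) (s * 2 ^ j) (t * 2 ^ j) g 1 k _ hs gn0 gi.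
  rewrite -mulnDl => H; apply: (le_trans (H _)); first by rewrite /a; clear; lia.
  by rewrite lerD2l; rewrite le_eqVlt; apply/orP; left; apply/eqP; ring.
have GG (y : int) : Gj y <= G y + (3 * e1 + ((K <= absz y)%N)%:R).
  case: leqP => yK /=.
    have := Gn y; have := Gjn y; rewrite !ler_norml => /andP[_ H1] /andP[H2 _].
    have : 0 <= G y.
      rewrite GE -(walk_mean_cst t 0); apply: (@walk_mean_le t _ _ 1) => x; rewrite ?normr0//.
      by have /andP[] := g01 (x + (y + (2 * k)%:Z)).
    lra.
  set y' := y + (2 * k)%:Z.
  have yl : y' \in l by rewrite mem_win /in_window /y'; move: yK; clear; lia.
  have [_ H] := HJ3 y' j (jJ3 _ yl); have {}H := H (fun x => g (x + y')) (gn y').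
  have := HN3 (a - y') n; rewrite /Gj -/y' chain_mean_shift => H'.
  have {}H' := H' (ltac:(rewrite /a /N /y'; move: yK; clear; lia)).
  have {}H' := H' (ltac:(rewrite /n /a /N /y'; move: yK; clear; lia)).
  have := A6 y'; rewrite /y' -GE -/y'; move: H; rewrite !ler_norml => /andP[? ?] /andP[? ?]; lra.
have tl : euler_law j s (fun y => ((K <= absz y)%N)%:R) <= e1.
  apply: le_trans HK; apply: (@le_trans _ _ (euler_law j s (fun y => 2^-1 ^+ K * 2 ^+ absz y + 0 * 1))).
    apply: euler_mean_le => y; rewrite mul0r addr0; case: leqP => Ky /=.
      by rewrite -(subnK Ky) exprD mulrCA -exprMn mulVf// expr1n mulr1 exprn_ege1// ler1n.
    by rewrite mulr_ge0// exprn_ge0// invr_ge0.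
  by rewrite euler_mean_lin mul0r addr0 ler_wpM2l ?exprn_ge0 ?invr_ge0// euler_mean_exp.
have B1 : euler_law j s Gj <= euler_law j s G + 4 * e1.
  apply: (@le_trans _ _ (euler_law j s (fun y => 1 * G y + 1 * (3 * e1 * 1 + 1 * ((K <= absz y)%N)%:R)))).
    by apply: euler_mean_le => y; rewrite !mul1r mulr1.
  rewrite euler_mean_lin euler_mean_lin euler_mean_cst !mul1r mulr1 lerD2l.
  by rewrite (_ : 4 * e1 = 3 * e1 + e1) ?lerD2l//; ring.
have R1 := HN1 a n (ltac:(rewrite /a /N; clear; lia)) (ltac:(rewrite /n /a /N; clear; lia)).
have R2 := HN2 a n (ltac:(rewrite /a /N; clear; lia)) (ltac:(rewrite /n /a /N; clear; lia)).
move: A1 A2 A4 A5; rewrite !ler_norml -/(D s) -/(D (s + t)%N) => /andP[? ?] /andP[? ?] /andP[? ?] /andP[? ?].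
rewrite -/G; have ee : e = 10 * e1 by rewrite /e1; field.
lra.
Qed.

End walk_laws.

Section walk_additive.
Context {R : realType}.
Variables (alpha beta : bool -> R) (Lambda p rho r delta : R).
Hypothesis mod : model alpha beta Lambda p rho r delta.

(** Chosen so that 2^-B exp(Lambda) <= 1 / 2, by B < 2^B. *)
Definition tail_base : nat := (Num.truncn (2 * expR Lambda)).+1.

Lemma tail_baseP (t : nat) : 2^-1 ^+ (tail_base * t) * expR (Lambda * t%:R) <= 2^-1 ^+ t :> R.
Proof.
rewrite exprM expRM_natr -exprMn lerXn2r//.
- by rewrite nnegrE mulr_ge0 ?expR_ge0// exprn_ge0// invr_ge0.
- by rewrite nnegrE invr_ge0.
rewrite exprVn mulrC ler_pdivrMr ?exprn_gt0// ler_pdivlMl//.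
apply: (@le_trans _ _ tail_base%:R); last by rewrite -natrX ler_nat ltnW// ltn_expl.
exact: ltW (truncnS_gt _).
Qed.

Section one_space.
Context {dd : measure_display} {Omega : measurableType dd}.
Variables (P : probability Omega R) (eta : R -> Omega -> config)
  (Pi : Omega -> set (int * R * R)) (X : R -> Omega -> int).
Hypothesis EW : exclusion_walk alpha beta Lambda p rho P eta Pi X.
Local Notation euler_law := (euler_mean alpha beta P eta Pi).
Local Notation walk_law := (walk_mean alpha beta P eta Pi).

Lemma euler_mean_tail j t : euler_law j t (fun x => 2^-1 ^+ (tail_base * t) * 2 ^+ absz x) <= 2^-1 ^+ t.
Proof.
have := @euler_mean_lin R alpha beta dd Omega P eta Pi j t (2^-1 ^+ (tail_base * t)) 0
  (fun x => 2 ^+ absz x) (fun=> 0).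
under [X in euler_mean _ _ _ _ _ _ _ X]eq_fun do rewrite mulr0 addr0.
rewrite mul0r addr0 => ->; apply: le_trans (tail_baseP t).
by rewrite ler_wpM2l ?exprn_ge0 ?invr_ge0// (euler_mean_exp mod EW).
Qed.

Lemma walk_mean_tail t : walk_law t (fun x => (((tail_base * t)%:Z < x)%R%:R)) <= 2^-1 ^+ t.
Proof.
apply: (walk_mean_le_of mod EW (M := 1)) => [x|e e0].
  by case: (_ < _); rewrite ?normr1 ?normr0.
exists 0%N => j _; apply: (@le_trans _ _ (2^-1 ^+ t)); last by rewrite lerDl ltW.
apply: le_trans (euler_mean_tail j t); apply: euler_mean_le => x; case: ltP => /= H.
  have Hx : (tail_base * t <= absz x)%N by move: H; clear; lia.
  by rewrite -(subnK Hx) exprD mulrCA -exprMn mulVf// expr1n mulr1 exprn_ege1// ler1n.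
by rewrite mulr_ge0// exprn_ge0// invr_ge0.
Qed.

(** Clipping loses something only for x > n, and then x - n < 2^(x - n). *)
Lemma clip_ge n (x : int) : x%:~R - 2^-1 ^+ n * 2 ^+ absz x <= clip n x :> R.
Proof.
have q0 : 0 <= 2^-1 ^+ n * 2 ^+ absz x :> R by rewrite mulr_ge0// exprn_ge0// invr_ge0.
have [xn|nx] := leP x n%:Z.
  have : x%:~R <= clip n x :> R by rewrite /clip ler_int; move: xn; clear; lia.
  by lra.
have -> : clip n x = n%:R :> R by rewrite /clip -[n%:R]/((n%:Z)%:~R); congr _%:~R; move: nx; clear; lia.
have nx' : (n <= absz x)%N by move: nx; clear; lia.
have -> : x%:~R = (absz x)%:R :> R by rewrite -[(absz x)%:R]/(((absz x)%:Z)%:~R); congr _%:~R; move: nx; clear; lia.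
rewrite -{2}(subnK nx') exprD mulrCA -exprMn mulVf// expr1n mulr1 lerBlDr.
by rewrite -natrX -natrD ler_nat -leq_subLR ltnW// ltn_expl.
Qed.

Lemma walk_mean_clip t : (1 + delta) * t%:R - 1 <= walk_law t (clip (tail_base * t)).
Proof.
have cn x : `|clip (tail_base * t) x| <= (tail_base * t)%:R :> R.
  by have /andP[? ?] := @clip01 R (tail_base * t) x; rewrite ger0_norm.
apply/ler_addgt0Pr => e e0; have e2 : 0 < e / 2 by rewrite divr_gt0.
have [J HJ] := walk_mean_near mod EW t (tail_base * t)%:R e2.
have [J' HJ'] : exists J, forall j, (J <= j)%N -> mesh j * (t%:R * Lambda ^+ 2) <= e / 2.
  have c0 : 0 <= t%:R * Lambda ^+ 2 by rewrite mulr_ge0// sqr_ge0.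
  apply: (@near_mesh R (fun h => h * (t%:R * Lambda ^+ 2) <= e / 2)).
  near=> h; apply: (@le_trans _ _ (h * (t%:R * Lambda ^+ 2 + 1))).
    by rewrite ler_wpM2l//; lra.
  have C0 : 0 < t%:R * Lambda ^+ 2 + 1 by lra.
  by rewrite -ler_pdivlMr//; near: h; apply: nbhs_right_le; rewrite divr_gt0//; lra.
pose j := maxn J J'.
have := HJ j (leq_maxl _ _) _ cn; have := HJ' j (leq_maxr _ _).
have := mean_pos mod (walk_environment EW) (walk_driving EW) (walk_independent EW) (@mesh_gt0 R j) (t * 2 ^ j).
have -> : (t * 2 ^ j)%:R * (mesh j * (1 + delta) - (mesh j * Lambda) ^+ 2) =
    t%:R * (1 + delta) - mesh j * (t%:R * Lambda ^+ 2).
  by rewrite -(@mesh_grid R t j 0).1; ring.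
move=> H1 H2; rewrite ler_norml => /andP[_ H3].
have H4 : steps_mean alpha beta P eta Pi (mesh j) (t * 2 ^ j) (fun l => (pos l)%:~R) <=
    euler_law j t (clip (tail_base * t)) + 2^-1 ^+ t.
  apply: (@le_trans _ _ (euler_law j t (fun x => 1 * clip (tail_base * t) x +
      1 * (2^-1 ^+ (tail_base * t) * 2 ^+ absz x)))).
    by apply: steps_mean_le => l; rewrite !mul1r; have := clip_ge (tail_base * t) (pos l); lra.
  by rewrite euler_mean_lin !mul1r lerD2l euler_mean_tail.
have : 2^-1 ^+ t <= 1 :> R by rewrite exprn_ile1 ?invr_ge0 ?invf_le1 ?ler1n.
lra.
Unshelve. all: by end_near. Qed.

Lemma walk_additive : additive_laws walk_law tail_base (2 * (3 + tail_cst Lambda r delta)) r delta.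
Proof.
split.
- by move=> t a f g M; exact: (walk_mean_lin mod EW).
- by move=> t f g M; exact: (walk_mean_le mod EW).
- by move=> t; exact: (walk_mean_cst mod EW).
- by move=> s t k g; exact: (walk_mean_decouple mod EW).
- exact: walk_mean_tail.
- exact: walk_mean_clip.
Qed.

End one_space.

(** Both laws are close to the same [chain_mean], which does not involve the probability space. *)
Lemma walk_mean_same
    (d1 : measure_display) (O1 : measurableType d1) (P1 : probability O1 R) (eta1 : R -> O1 -> config)
    (Pi1 : O1 -> set (int * R * R)) (X1 : R -> O1 -> int)
    (d2 : measure_display) (O2 : measurableType d2) (P2 : probability O2 R) (eta2 : R -> O2 -> config)
    (Pi2 : O2 -> set (int * R * R)) (X2 : R -> O2 -> int) :
  exclusion_walk alpha beta Lambda p rho P1 eta1 Pi1 X1 ->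
  exclusion_walk alpha beta Lambda p rho P2 eta2 Pi2 X2 ->
  forall t f, (forall x, `|f x| <= 1) ->
    walk_mean alpha beta P1 eta1 Pi1 t f = walk_mean alpha beta P2 eta2 Pi2 t f.
Proof.
move=> E1 E2 t f f1; apply: (walk_mean_close mod E1 f1) => e e0.
have e5 : 0 < e / 5 by rewrite divr_gt0.
have [N HN] := remote_small mod (t%:R * (4 * Lambda + 4) * growth Lambda r t%:R) e5.
have {}HN := HN (- N%:Z) (2 * N)%N (lexx _) (ltac:(clear; lia)).
have [J1 H1] := @law_approx R alpha beta Lambda p rho r delta mod d1 O1 P1 eta1 Pi1
  (walk_environment E1) (walk_driving E1) (walk_independent E1) t (- N%:Z) (2 * N)%N _ e5.
have [J2 H2] := @law_approx R alpha beta Lambda p rho r delta mod d2 O2 P2 eta2 Pi2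
  (walk_environment E2) (walk_driving E2) (walk_independent E2) t (- N%:Z) (2 * N)%N _ e5.
have [J3 H3] := walk_mean_near mod E2 t 1 e5.
exists (maxn J1 (maxn J2 J3)) => j; rewrite !geq_max => /and3P[/H1[_ {}H1] /H2[_ {}H2] /H3 {}H3].
move: (H1 f f1) (H2 f f1) (H3 f f1).
set a := euler_mean _ _ _ _ _ _ _ _; set b := chain_mean _ _ _ _ _ _ _ _ _ _ _.
set c := euler_mean _ _ _ _ _ _ _ _; set v := walk_mean _ _ _ _ _ _ _.
rewrite !ler_norml => /andP[? ?] /andP[? ?] /andP[? ?]; apply/andP; split; lra.
Qed.

End walk_additive.

(** * Hammersley's argument *)

Section real_sequences.
Context {R : realType}.
Implicit Types (u a b : nat -> R) (q E : R).

(** Summing the recursion, [b] telescopes and half of the sum of [a] is absorbed; the [suff] carries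
    this as a potential that also contains the remaining geometric errors. *)
Lemma quasi_contraction a b q E : 0 <= q < 1 -> 0 <= E -> (forall j, 0 <= a j) -> (forall j, 0 <= b j) ->
  (forall j, a j.+1 <= a j / 2 + b j - b j.+1 + E * q ^+ j) ->
  forall n, \sum_(j < n) a j <= 2 * (a 0%N + b 0%N + E / (1 - q)).
Proof.
move=> /andP[q0 q1] E0 a0 b0 H n; have q1' : 0 < 1 - q by lra.
suff S : (\sum_(j < n) a j) / 2 + a n + b n + E * q ^+ n / (1 - q) <= a 0%N + b 0%N + E / (1 - q).
  have := a0 n; have := b0 n.
  have : 0 <= E * q ^+ n / (1 - q) by rewrite !mulr_ge0 ?exprn_ge0 ?invr_ge0 ?(ltW q1').
  lra.
elim: n => [|n IH]; first by rewrite big_ord0 mul0r add0r expr0 mulr1.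
apply: le_trans IH; rewrite big_ord_recr /=.
have -> : E * q ^+ n / (1 - q) = E * q ^+ n + E * q ^+ n.+1 / (1 - q).
  by rewrite exprS; field; rewrite gt_eqF.
by have := H n; lra.
Qed.

(** Adding the sum E q^j / (1 - q) of the future errors makes the sequence nonincreasing. *)
Lemma quasi_decreasing_cvg u q E : 0 <= q < 1 -> (forall j, 0 <= u j) ->
  (forall j, u j.+1 <= u j + E * q ^+ j) -> cvg (u j @[j --> \oo]).
Proof.
move=> /andP[q0 q1] u0 H; have q1' : 1 - q != 0 by rewrite gt_eqF//; lra.
have g0 : (fun j => E / (1 - q) * q ^+ j) j @[j --> \oo] --> (0 : R).
  rewrite -[X in _ --> X](mulr0 (E / (1 - q))).
  by apply: cvgM; [exact: cvg_cst|apply: cvg_expr; rewrite ger0_norm].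
pose v j := u j + E / (1 - q) * q ^+ j.
have vd : nonincreasing_seq v.
  apply/nonincreasing_seqP => j; rewrite /v exprS.
  have -> : u j + E / (1 - q) * q ^+ j = u j + E * q ^+ j + E / (1 - q) * (q * q ^+ j).
    by field.
  by rewrite lerD2r.
have [M HM] : exists M, forall j, M <= v j.
  exists (- `|E / (1 - q)|) => j; rewrite /v.
  have : `|E / (1 - q) * q ^+ j| <= `|E / (1 - q)|.
    by rewrite normrM ler_piMr// ger0_norm ?exprn_ge0// exprn_ile1// ltW.
  by rewrite ler_norml => /andP[H1 _]; have := u0 j; lra.
have cv : cvgn v by apply: nonincreasing_is_cvgn => //; exists M => _ [j _ <-].
have -> : u = (fun j => v j - E / (1 - q) * q ^+ j) by apply/funext => j; rewrite /v addrK.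
by apply: is_cvgB => //; apply/cvg_ex; exists 0.
Qed.

(** By j <= 2 (3 / 2)^j and 3 / 2 <= 2 q. *)
Lemma nat_geometric q j : 3 / 4 <= q -> j%:R / 2 ^+ j <= 2 * q ^+ j.
Proof.
move=> q34; rewrite ler_pdivrMr ?exprn_gt0// -mulrA -exprMn.
apply: (@le_trans _ _ (2 * (3 / 2) ^+ j)).
  elim: j => [|j IH]; first by rewrite expr0; lra.
  rewrite exprS -natr1; have : 1 <= (3 / 2 : R) ^+ j by rewrite exprn_ege1//; lra.
  by case: j IH => [|j] IH H; [rewrite expr0; lra|lra].
by rewrite ler_wpM2l// lerXn2r ?nnegrE; lra.
Qed.

End real_sequences.

Section hammersley.
Context {R : realType}.
Variables (L : nat -> (int -> R) -> R) (B : nat) (C r delta : R).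
Hypothesis laws : additive_laws L B C r delta.
Hypothesis r01 : 0 < r < 1.
Hypothesis C_ge0 : 0 <= C.
Hypothesis delta_gt0 : 0 < delta.
Implicit Types (f g : int -> R) (s t k : nat) (x y : int).

Definition bdd f := exists M, forall x, `|f x| <= M.

Lemma bdd_cst c : bdd (fun=> c). Proof. by exists `|c|. Qed.

Lemma bddD f g : bdd f -> bdd g -> bdd (fun x => f x + g x).
Proof.
by move=> [M fM] [N gN]; exists (M + N) => x; apply: (le_trans (ler_normD _ _)); rewrite lerD.
Qed.

Lemma bddM f g : bdd f -> bdd g -> bdd (fun x => f x * g x).
Proof.
by move=> [M fM] [N gN]; exists (M * N) => x; rewrite normrM ler_pM.
Qed.

Lemma bdd_bool (b : pred int) : bdd (fun x => (b x)%:R).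
Proof. by exists 1 => x; case: (b x); rewrite ?normr1 ?normr0. Qed.

Lemma bdd_clip n z : bdd (fun x => clip n (x + z)).
Proof.
by exists n%:R => x; have /andP[? ?] := @clip01 R n (x + z); rewrite ger0_norm.
Qed.

Lemma bdd_clip0 n : bdd (clip n).
Proof.
by exists n%:R => x; have /andP[? ?] := @clip01 R n x; rewrite ger0_norm.
Qed.

Lemma lawD t a b f g : bdd f -> bdd g -> L t (fun x => a * f x + b * g x) = a * L t f + b * L t g.
Proof.
have lin0 c h h' : bdd h -> bdd h' -> L t (fun x => c * h x + h' x) = c * L t h + L t h'.
  move=> [M fM] [N gN]; apply: (laws_lin laws) (Num.max M N) _ _ => x; rewrite le_max ?fM// ?gN ?orbT//.
have L0 : L t (fun=> 0) = 0.
  have := lin0 1 (fun=> 0) (fun=> 0) (bdd_cst 0) (bdd_cst 0).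
  under [X in L t X]eq_fun do rewrite mulr0 addr0.
  by rewrite mul1r; lra.
move=> bf bg; rewrite (lin0 a f (fun x => b * g x))//; last exact: bddM (bdd_cst b) bg.
congr (_ + _); have := lin0 b g (fun=> 0) bg (bdd_cst 0).
by under [X in L t X]eq_fun do rewrite addr0; rewrite L0 addr0.
Qed.

Lemma law_cst t c : L t (fun=> c) = c.
Proof.
have := lawD t c 0 (bdd_cst 1) (bdd_cst 1).
under [X in L t X]eq_fun do rewrite mulr1 mul0r addr0.
by rewrite (laws_cst1 laws) mulr1 mul0r addr0.
Qed.

Lemma law_le t f g : bdd f -> bdd g -> (forall x, f x <= g x) -> L t f <= L t g.
Proof.
move=> [M fM] [N gN]; apply: (laws_le laws) (Num.max M N) _ _ => x; rewrite le_max ?fM// ?gN ?orbT//.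
Qed.

Lemma lawZ t a f : bdd f -> L t (fun x => a * f x) = a * L t f.
Proof.
move=> bf; have := lawD t a 0 bf bf.
by under [X in L t X]eq_fun do rewrite mul0r addr0; rewrite mul0r addr0.
Qed.

Lemma law_bdd t (F : int -> int -> R) M : (forall x y, `|F y x| <= M) -> bdd (fun y => L t (F y)).
Proof.
move=> FM; exists M => y; have bF : bdd (F y) by exists M => x; exact: FM.
rewrite ler_norml -{1}(law_cst t (- M)) -{2}(law_cst t M).
by rewrite !law_le//; try exact: bdd_cst; move=> x; have := FM x y; rewrite ler_norml => /andP[].
Qed.

Lemma law_decouple s t k g M : 0 < M -> (forall x, 0 <= g x <= M) -> (forall x, g x <= g (x + 1)) ->
  L (s + t)%N g <= L s (fun y => L t (fun x => g (x + y + (2 * k)%:Z))) + M * (C * r ^+ k).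
Proof.
move=> M0 gM gi; have Mi : 0 < M^-1 by rewrite invr_gt0.
have gn x : `|g x| <= M by have /andP[? ?] := gM x; rewrite ger0_norm.
have := laws_decouple laws s t k (g := fun x => M^-1 * g x).
rewrite lawZ; last by exists M.
have -> : (fun y => L t (fun x => M^-1 * g (x + y + (2 * k)%:Z))) =
    (fun y => M^-1 * L t (fun x => g (x + y + (2 * k)%:Z))).
  by apply/funext => y; rewrite lawZ//; exists M => x; exact: gn.
rewrite lawZ; last by apply: (@law_bdd t (fun y x => g (x + y + (2 * k)%:Z)) M).
move=> H; rewrite -(ler_pM2l Mi) mulrDr mulKf ?gt_eqF//; apply: H => x.
  by have /andP[? ?] := gM x; rewrite mulr_ge0 ?(ltW Mi)//= ler_pdivrMl// mulr1.
by rewrite ler_pM2l.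
Qed.

Definition far n x : R := ((n%:Z < x)%R)%:R.

Lemma bdd_far n : bdd (far n).
Proof. exact: (bdd_bool (fun x => n%:Z < x)). Qed.

Lemma far_ge0 n x : 0 <= far n x. Proof. exact: ler0n. Qed.

(** When neither y nor x is far, clipping acts at 0 only and the positive part is subadditive;
    otherwise the trivial bound n + n' is paid. *)
Lemma clip_add n n' k x y : clip (n + n') (x + y + (2 * k)%:Z) <=
  clip n y + clip n' x + (2 * k)%:R + (n + n')%:R * (far n y + far n' x) :> R.
Proof.
have /andP[c1 _] := @clip01 R n y; have /andP[c2 _] := @clip01 R n' x.
have /andP[_ c3] := @clip01 R (n + n') (x + y + (2 * k)%:Z).
have k0 : 0 <= (2 * k)%:R :> R by [].
have N0 : 0 <= (n + n')%:R :> R by [].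
have f1 := far_ge0 n y; have f2 := far_ge0 n' x.
have [ny|yn] := ltP n%:Z y.
  have : (n + n')%:R * 1 <= (n + n')%:R * (far n y + far n' x).
    by rewrite ler_wpM2l// {1}/far ny /=; lra.
  lra.
have [nx|xn] := ltP n'%:Z x.
  have : (n + n')%:R * 1 <= (n + n')%:R * (far n y + far n' x).
    by rewrite ler_wpM2l// {2}/far nx /=; lra.
  lra.
have : clip (n + n') (x + y + (2 * k)%:Z) <= clip n y + clip n' x + (2 * k)%:R :> R.
  rewrite /clip -[(2 * k)%:R]/(((2 * k)%:Z)%:~R) -!rmorphD/= ler_int.
  by move: xn yn; clear; lia.
have : 0 <= (n + n')%:R * (far n y + far n' x) by rewrite mulr_ge0// addr_ge0.
lra.
Qed.

Lemma clip_add_sqr n k x y : clip (n + n) (x + y + (2 * k)%:Z) ^+ 2 <=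
  (8 * k%:R * n%:R + 4 * k%:R ^+ 2) + clip n y ^+ 2 + clip n x ^+ 2 + 2 * clip n y * clip n x +
  (n + n)%:R ^+ 2 * (far n y + far n x) :> R.
Proof.
have /andP[c1 c1'] := @clip01 R n y; have /andP[c2 c2'] := @clip01 R n x.
have /andP[c3 c3'] := @clip01 R (n + n) (x + y + (2 * k)%:Z).
have k0 : 0 <= k%:R :> R by [].
have H := clip_add n n k x y; rewrite (natrM _ 2 k) in H.
have p0 : 0 <= 8 * k%:R * n%:R + 4 * k%:R ^+ 2 + clip n y ^+ 2 + clip n x ^+ 2 + 2 * clip n y * clip n x :> R.
  by rewrite !addr_ge0 ?mulr_ge0 ?exprn_ge0.
have far01 z : far n z = 0 \/ far n z = 1 by rewrite /far; case: (_ < _); [right|left].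
set c := clip _ _ in c3 c3' H *.
have cN : c ^+ 2 <= (n + n)%:R ^+ 2 by rewrite lerXn2r ?nnegrE.
have N20 : 0 <= (n + n)%:R ^+ 2 :> R by rewrite exprn_ge0.
case: (far01 y) H => ->; case: (far01 x) => -> H; rewrite ?addr0 ?add0r ?mulr1; try lra.
rewrite mulr0 addr0; rewrite addr0 mulr0 addr0 in H.
apply: (@le_trans _ _ ((clip n y + clip n x + 2 * k%:R) ^+ 2)).
  by rewrite lerXn2r ?nnegrE//; lra.
have h1 : k%:R * clip n y <= k%:R * n%:R :> R by rewrite ler_wpM2l.
have h2 : k%:R * clip n x <= k%:R * n%:R :> R by rewrite ler_wpM2l.
have -> : (clip n y + clip n x + 2 * k%:R) ^+ 2 = clip n y ^+ 2 + clip n x ^+ 2 +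
  2 * clip n y * clip n x + 4 * (k%:R * clip n y) + 4 * (k%:R * clip n x) + 4 * k%:R ^+ 2 :> R by ring.
lra.
Qed.

Lemma law_lin3 t a b c d f g h : bdd f -> bdd g -> bdd h ->
  L t (fun x => a + b * f x + c * g x + d * h x) = a + b * L t f + c * L t g + d * L t h.
Proof.
move=> bf bg bh.
have b1 : bdd (fun x => b * f x + c * g x) by apply: bddD; apply: bddM => //; exact: bdd_cst.
have b2 : bdd (fun x => 1 * (b * f x + c * g x) + d * h x).
  by apply: bddD; apply: bddM => //; exact: bdd_cst.
have -> : (fun x => a + b * f x + c * g x + d * h x) =
    (fun x => a * 1 + 1 * (1 * (b * f x + c * g x) + d * h x)).
  by apply/funext => x; ring.
rewrite (lawD t a 1 (bdd_cst 1) b2) (lawD t 1 d b1 bh) lawD// law_cst; ring.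
Qed.

Definition mean t := L t (clip (B * t)).
Definition sqmean t := L t (fun x => clip (B * t) x ^+ 2).

Lemma bdd_sqr f : bdd f -> bdd (fun x => f x ^+ 2).
Proof. by move=> bf; have := bddM bf bf. Qed.

Lemma far_tail t : L t (far (B * t)) <= 2^-1 ^+ t.
Proof. exact: (laws_tail laws). Qed.

Hypothesis B_gt0 : (0 < B)%N.

Lemma mean_add s t k : (0 < s)%N -> (0 < t)%N ->
  mean (s + t) <= mean s + mean t + (2 * k)%:R +
    (B * (s + t))%:R * (2^-1 ^+ s + 2^-1 ^+ t) + (B * (s + t))%:R * (C * r ^+ k).
Proof.
move=> s0 t0; rewrite /mean mulnDr; set n := (B * s)%N; set n' := (B * t)%N.
have N0 : 0 < (n + n')%:R :> R by rewrite ltr0n addn_gt0 muln_gt0 B_gt0 s0.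
have N0' := ltW N0.
apply: (le_trans (law_decouple s t k N0 (clip01 _) (clip_mono _))); rewrite lerD2r.
have bc m z : bdd (fun x => clip m (x + z)) by exact: bdd_clip.
have in_le y : L t (fun x => clip (n + n') (x + y + (2 * k)%:Z)) <=
    ((2 * k)%:R + L t (clip n') + (n + n')%:R * L t (far n')) + 1 * clip n y + (n + n')%:R * far n y + 0 * far n y.
  apply: (@le_trans _ _ (L t (fun x => (clip n y + (2 * k)%:R + (n + n')%:R * far n y) +
      1 * clip n' x + (n + n')%:R * far n' x + 0 * far n' x))).
    apply: law_le.
    - by under eq_fun do rewrite -addrA; exact: bc.
    - by do 3 (apply: bddD; last by apply: bddM; [exact: bdd_cst|first [exact: bdd_far|exact: bdd_clip0]]); exact: bdd_cst.
    - by move=> x; have := clip_add n n' k x y; lra.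
  rewrite law_lin3; [lra|exact: bdd_clip0|exact: bdd_far|exact: bdd_far].
apply: (@le_trans _ _ (L s (fun y => ((2 * k)%:R + L t (clip n') + (n + n')%:R * L t (far n')) +
    1 * clip n y + (n + n')%:R * far n y + 0 * far n y))).
  apply: law_le => //.
  - apply: (@law_bdd t (fun y x => clip (n + n') (x + y + (2 * k)%:Z)) (n + n')%:R) => x y.
    by have /andP[? ?] := @clip01 R (n + n') (x + y + (2 * k)%:Z); rewrite ger0_norm.
  - by do 3 (apply: bddD; last by apply: bddM; [exact: bdd_cst|first [exact: bdd_far|exact: bdd_clip0]]); exact: bdd_cst.
rewrite law_lin3; [|exact: bdd_clip0|exact: bdd_far|exact: bdd_far].
have h1 := ler_wpM2l N0' (far_tail s); have h2 := ler_wpM2l N0' (far_tail t).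
by rewrite -/n -/n' in h1 h2 *; lra.
Qed.

Lemma sqmean_double s k : (0 < s)%N ->
  sqmean (s + s) <= 2 * sqmean s + 2 * mean s ^+ 2 +
    (8 * k%:R * (B * s)%:R + 4 * k%:R ^+ 2) +
    8 * (B * s)%:R ^+ 2 * 2^-1 ^+ s + 4 * (B * s)%:R ^+ 2 * (C * r ^+ k).
Proof.
move=> s0; rewrite /sqmean /mean mulnDr; set n := (B * s)%N.
have n0 : 0 < n%:R :> R by rewrite ltr0n muln_gt0 B_gt0.
have N0 : 0 < (n + n)%:R ^+ 2 :> R by rewrite exprn_gt0// natrD addr_gt0.
have N0' := ltW N0.
have NE : (n + n)%:R ^+ 2 = 4 * n%:R ^+ 2 :> R by rewrite natrD; ring.
have g01 x : 0 <= (clip (n + n) x : R) ^+ 2 <= (n + n)%:R ^+ 2.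
  have /andP[c0 c1] := @clip01 R (n + n) x; apply/andP; split; first exact: exprn_ge0.
  by rewrite lerXn2r ?nnegrE ?ler0n.
have gi x : clip (n + n) x ^+ 2 <= clip (n + n) (x + 1) ^+ 2 :> R.
  have /andP[? ?] := @clip01 R (n + n) x; have /andP[? ?] := @clip01 R (n + n) (x + 1).
  by rewrite lerXn2r ?nnegrE//; exact: clip_mono.
apply: (le_trans (@law_decouple s s k (fun x => clip (n + n) x ^+ 2) _ N0 g01 gi)); rewrite -NE lerD2r.
set D : R := 8 * k%:R * n%:R + 4 * k%:R ^+ 2.
have bs : bdd (fun x => clip n x ^+ 2) by apply: bdd_sqr; exact: bdd_clip0.
have in_le y : L s (fun x => clip (n + n) (x + y + (2 * k)%:Z) ^+ 2) <=
    (D + L s (fun x => clip n x ^+ 2) + (n + n)%:R ^+ 2 * L s (far n)) + 1 * clip n y ^+ 2 +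
    2 * L s (clip n) * clip n y + (n + n)%:R ^+ 2 * far n y.
  apply: (@le_trans _ _ (L s (fun x => (D + clip n y ^+ 2 + (n + n)%:R ^+ 2 * far n y) +
      1 * clip n x ^+ 2 + 2 * clip n y * clip n x + (n + n)%:R ^+ 2 * far n x))).
    apply: law_le.
    - by apply: bdd_sqr; under eq_fun do rewrite -addrA; exact: bdd_clip.
    - by do 3 (apply: bddD; last by apply: bddM; [exact: bdd_cst|first [exact: bdd_far|exact: bdd_clip0|exact: bs]]); exact: bdd_cst.
    - by move=> x; have := clip_add_sqr n k x y; rewrite -/D; lra.
  rewrite law_lin3; [lra|exact: bs|exact: bdd_clip0|exact: bdd_far].
apply: (@le_trans _ _ (L s (fun y => (D + L s (fun x => clip n x ^+ 2) + (n + n)%:R ^+ 2 * L s (far n)) +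
    1 * clip n y ^+ 2 + 2 * L s (clip n) * clip n y + (n + n)%:R ^+ 2 * far n y))).
  apply: law_le => //.
  - apply: (@law_bdd s (fun y x => clip (n + n) (x + y + (2 * k)%:Z) ^+ 2) ((n + n)%:R ^+ 2)) => x y.
    by have /andP[? ?] := g01 (x + y + (2 * k)%:Z); rewrite ger0_norm.
  - by do 3 (apply: bddD; last by apply: bddM; [exact: bdd_cst|first [exact: bdd_far|exact: bdd_clip0|exact: bs]]); exact: bdd_cst.
rewrite law_lin3; [|exact: bs|exact: bdd_clip0|exact: bdd_far].
have h1 := ler_wpM2l N0' (far_tail s); rewrite -/n NE in h1 *; lra.
Qed.

(** A common geometric rate for the decoupling errors r^j, for j / 2^j and for the tails. *)
Definition ratio : R := Num.max (3 / 4) r.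

Lemma ratioP : [/\ 3 / 4 <= ratio, r <= ratio, 0 <= ratio & ratio < 1].
Proof.
have /andP[r0 r1] := r01; rewrite /ratio.
by split; rewrite ?le_max ?gt_max ?lexx ?orbT//; [rewrite (ltW r0) orbT|rewrite r1 andbT; lra].
Qed.

Lemma ratioX j : [/\ 0 <= ratio ^+ j, ratio ^+ j <= 1, r ^+ j <= ratio ^+ j &
  forall l, (0 < l)%N -> 2^-1 ^+ (2 ^ j * l) <= ratio ^+ j].
Proof.
have /andP[r0 r1] := r01; have [q1 q2 q3 q4] := ratioP.
split; [exact: exprn_ge0|by rewrite exprn_ile1// ltW|by rewrite lerXn2r ?nnegrE// ltW|].
move=> l l0; apply: (@le_trans _ _ (2^-1 ^+ j)).
  apply: ler_wiXn2l; rewrite ?invr_ge0 ?invf_le1 ?ler1n//.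
  by apply: (@leq_trans (2 ^ j)); [exact: ltnW (ltn_expl _ _)|rewrite leq_pmulr].
by rewrite lerXn2r ?nnegrE ?invr_ge0//; lra.
Qed.

(** The division is by 2^j and not by the time 2^j l, so that the limit is additive in l. *)
Definition dyadic_mean l j : R := mean (2 ^ j * l) / 2 ^+ j.

Let F : R := 4 + 2 * B%:R + B%:R * C.

Lemma dyadic_mean_ge0 l j : 0 <= dyadic_mean l j.
Proof.
rewrite divr_ge0 ?exprn_ge0// /mean -(law_cst (2 ^ j * l) 0); apply: law_le.
- exact: bdd_cst.
- exact: bdd_clip0.
- by move=> x; have /andP[] := @clip01 R (B * (2 ^ j * l)) x.
Qed.

(** [mean_add] with k = j: the shift 2 j is negligible against 2^j, and the other errors are
    geometric relative to the time. *)
Lemma dyadic_mean_add l l' j : (0 < l)%N -> (0 < l')%N ->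
  dyadic_mean (l + l') j <= dyadic_mean l j + dyadic_mean l' j + F * (l + l')%:R * ratio ^+ j.
Proof.
move=> l0 l0'; have [x1 x2 x3 x4] := ratioX j; have [q1 _ _ _] := ratioP.
have p0 : 0 < 2 ^+ j :> R by rewrite exprn_gt0.
have := @mean_add (2 ^ j * l) (2 ^ j * l') j; rewrite !muln_gt0 expn_gt0 l0 l0' -mulnDr.
move=> /(_ isT isT) H; rewrite -(ler_pM2r p0) !mulrDl /dyadic_mean !divfK ?gt_eqF//.
apply: (le_trans H); rewrite -!addrA !lerD2l.
have ll : 1 <= (l + l')%:R :> R by rewrite ler1n addn_gt0 l0.
have E1 : (2 * j)%:R <= 4 * ratio ^+ j * 2 ^+ j.
  have := nat_geometric j q1; rewrite ler_pdivrMr// => H1; rewrite natrM; lra.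
have E2 : 4 * ratio ^+ j * 2 ^+ j <= 4 * ratio ^+ j * 2 ^+ j * (l + l')%:R.
  by rewrite ler_peMr// !mulr_ge0// ltW.
have -> : (B * (2 ^ j * (l + l')))%:R = B%:R * (l + l')%:R * 2 ^+ j :> R.
  by rewrite !natrM natrX; ring.
have P0 : 0 <= B%:R * (l + l')%:R * 2 ^+ j :> R by rewrite !mulr_ge0// ltW.
have E3 := ler_wpM2l P0 (lerD (x4 l l0) (x4 l' l0')).
have E4 := ler_wpM2l P0 (ler_wpM2l C_ge0 x3).
set A := B%:R * (l + l')%:R * 2 ^+ j in E3 E4 *; apply: (@le_trans _ _ (4 * ratio ^+ j * 2 ^+ j * (l + l')%:R + A * (ratio ^+ j + ratio ^+ j) + A * (C * ratio ^+ j))); first by lra.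
by rewrite le_eqVlt; apply/orP; left; apply/eqP; rewrite /F /A; ring.
Qed.

Lemma dyadic_mean_double l j : dyadic_mean (l + l) j = 2 * dyadic_mean l j.+1.
Proof.
rewrite /dyadic_mean; have -> : (2 ^ j * (l + l) = 2 ^ j.+1 * l)%N.
  by rewrite expnS mulnDr -mulnA mul2n addnn.
by rewrite exprS; field; rewrite expf_neq0.
Qed.

Lemma dyadic_mean_cvg l : (0 < l)%N -> cvg (dyadic_mean l j @[j --> \oo]).
Proof.
move=> l0; have [q1 _ q3 q4] := ratioP.
apply: (@quasi_decreasing_cvg R _ ratio (F * l%:R)); rewrite ?q3//.
  by move=> j; exact: dyadic_mean_ge0.
move=> j; have := dyadic_mean_add j l0 l0; rewrite dyadic_mean_double natrD; lra.
Qed.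

Definition dyadic_limit l : R := lim (dyadic_mean l j @[j --> \oo]).

Lemma dyadic_limit_add l l' : (0 < l)%N -> (0 < l')%N ->
  dyadic_limit (l + l') <= dyadic_limit l + dyadic_limit l'.
Proof.
move=> l0 l0'; have [q1 _ q3 q4] := ratioP.
have H : (fun j => dyadic_mean l j + dyadic_mean l' j + F * (l + l')%:R * ratio ^+ j) j @[j --> \oo] -->
    dyadic_limit l + dyadic_limit l' + F * (l + l')%:R * 0.
  apply: cvgD; first by apply: cvgD; exact: dyadic_mean_cvg.
  by apply: cvgM; [exact: cvg_cst|apply: cvg_expr; rewrite ger0_norm].
rewrite mulr0 addr0 in H; rewrite -(cvg_lim _ H)//; apply: ler_lim.
- by apply: dyadic_mean_cvg; rewrite addn_gt0 l0.
- by apply/cvg_ex; eexists; exact: H.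
- by near=> j; exact: dyadic_mean_add.
Unshelve. all: by end_near. Qed.

Lemma dyadic_limit_double l : (0 < l)%N -> dyadic_limit (l + l) = 2 * dyadic_limit l.
Proof.
move=> l0; apply: cvg_lim => //; under eq_fun do rewrite dyadic_mean_double.
apply: cvgM; first exact: cvg_cst.
by rewrite (cvg_shiftS (dyadic_mean l)); exact: dyadic_mean_cvg.
Qed.

Definition speed : R := dyadic_limit 1.

(** Subadditivity gives the upper bound. Equality holds for powers of two, and splitting a larger
    power of two into l and the rest gives the lower bound. *)
Lemma dyadic_limit_linear l : (0 < l)%N -> dyadic_limit l = l%:R * speed.
Proof.
have le_lin n : dyadic_limit n.+1 <= n.+1%:R * speed.
  elim: n => [|n IH]; first by rewrite mul1r.
  rewrite -addn1 natrD mulrDl mul1r; apply: (le_trans (dyadic_limit_add _ _)) => //.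
  by rewrite lerD2r.
have pow n : dyadic_limit (2 ^ n) = 2 ^+ n * speed.
  elim: n => [|n IH]; first by rewrite mul1r.
  by rewrite expnS mul2n -addnn dyadic_limit_double ?expn_gt0// IH exprS mulrA.
case: l => // l _; apply: le_anti; rewrite le_lin /=.
have ll : (l.+1 < 2 ^ l.+1)%N by exact: ltn_expl.
have := pow l.+1; rewrite -{1}(subnK (ltnW ll)) => E.
have D0 : (0 < 2 ^ l.+1 - l.+1)%N by rewrite subn_gt0.
have := dyadic_limit_add D0 (ltn0Sn l); rewrite E.
have := le_lin (2 ^ l.+1 - l.+1).-1; rewrite prednK// natrB; last exact: ltnW.
by rewrite natrX mulrBl; lra.
Qed.

Lemma speed_ge : 1 + delta <= speed.
Proof.
have H : (fun j => 1 + delta - 2^-1 ^+ j) j @[j --> \oo] --> 1 + delta - 0.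
  apply: cvgB; first exact: cvg_cst.
  by apply: cvg_expr; rewrite ger0_norm ?invr_ge0// invf_lt1// ltr1n.
rewrite subr0 in H; rewrite -(cvg_lim _ H)//; apply: ler_lim.
- by apply/cvg_ex; eexists; exact: H.
- exact: dyadic_mean_cvg.
- near=> j; have p0 : 0 < 2 ^+ j :> R by rewrite exprn_gt0.
  rewrite /dyadic_mean ler_pdivlMr// mulrBl -exprMn mulVf// expr1n muln1.
  by have := laws_mean laws (2 ^ j); rewrite natrX.
Unshelve. all: by end_near. Qed.

Definition variance t : R := sqmean t - mean t ^+ 2.

Lemma law_sqr_dev t c : L t (fun x => (clip (B * t) x - c) ^+ 2) = variance t + (mean t - c) ^+ 2.
Proof.
have -> : (fun x => (clip (B * t) x - c) ^+ 2) = (fun x => c ^+ 2 + 1 * clip (B * t) x ^+ 2 +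
    (- 2 * c) * clip (B * t) x + 0 * clip (B * t) x) by apply/funext => x; ring.
rewrite law_lin3; [|apply: bdd_sqr| |]; try exact: bdd_clip0.
rewrite /variance /sqmean /mean; ring.
Qed.

Lemma variance_ge0 t : 0 <= variance t.
Proof.
have <- : L t (fun x => (clip (B * t) x - mean t) ^+ 2) = variance t.
  by rewrite law_sqr_dev subrr expr0n/= addr0.
rewrite -(law_cst t 0); apply: law_le; first exact: bdd_cst; last by move=> x; exact: sqr_ge0.
by apply: bdd_sqr; apply: bddD; [exact: bdd_clip0|exact: bdd_cst].
Qed.

Definition relvar l j : R := variance (2 ^ j * l) / (2 ^ j * l)%:R ^+ 2.

(** By [sqmean_double] second moments behave as for a sum of two independent copies. So doubling the
    time halves the relative variance up to the decrease of the squared normalised mean, which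
    telescopes in [quasi_contraction]. *)
Lemma relvar_summable l : (0 < l)%N -> exists K, forall n, \sum_(j < n) relvar l j <= K.
Proof.
move=> l0; have [q1 q2 q3 q4] := ratioP.
pose T j := (2 ^ j * l)%N.
have T0 j : (0 < T j)%N by rewrite muln_gt0 expn_gt0.
have Tr j : 0 < (T j)%:R :> R by rewrite ltr0n.
pose b j : R := (mean (T j) / (T j)%:R) ^+ 2.
(* The coefficients of [ratio ^+ j] in the four error terms below. *)
pose E : R := 4 * B%:R + 4 + 2 * B%:R ^+ 2 + B%:R ^+ 2 * C.
exists (2 * (relvar l 0 + b 0%N + E / (1 - ratio))).
apply: quasi_contraction; rewrite ?q3//.
- by rewrite !addr_ge0 ?mulr_ge0 ?exprn_ge0.
- by move=> j; rewrite divr_ge0 ?variance_ge0 ?exprn_ge0.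
- by move=> j; exact: sqr_ge0.
move=> j; have [x1 x2 x3 x4] := ratioX j.
have TS : T j.+1 = (T j + T j)%N by rewrite /T expnS -mulnA mul2n addnn.
have := sqmean_double j (T0 j); rewrite -TS.
rewrite /relvar -/(T j) -/(T j.+1) /variance.
set S' := sqmean (T j.+1); set m' := mean (T j.+1); set S := sqmean (T j); set m := mean (T j) => H.
rewrite /b -/m -/m' TS natrD; set t : R := (T j)%:R in H *.
have t0 : 0 < t by exact: Tr.
have jt : j%:R / t <= 2 * ratio ^+ j.
  apply: le_trans (nat_geometric j q1); rewrite ler_wpM2l// lef_pV2 ?posrE ?exprn_gt0//.
  by rewrite /t -natrX ler_nat leq_pmulr.
have jt0 : 0 <= j%:R / t by rewrite divr_ge0// ltW.
have jt2 : (j%:R / t) ^+ 2 <= 4 * ratio ^+ j.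
  apply: (@le_trans _ _ ((2 * ratio ^+ j) ^+ 2)); first by rewrite lerXn2r ?nnegrE// mulr_ge0.
  by rewrite exprMn; have := ler_wpM2l x1 x2; rewrite expr2; lra.
have BT : (B * T j)%:R = B%:R * t :> R by rewrite natrM.
rewrite BT in H.
have E3 := x4 l l0; rewrite -/(T j) in E3.
have B2 : 0 <= B%:R ^+ 2 :> R by rewrite exprn_ge0.
have tn0 : t != 0 by rewrite gt_eqF.
have h1 : B%:R * (j%:R / t) <= B%:R * (2 * ratio ^+ j) by rewrite ler_wpM2l.
have h2 := ler_wpM2l B2 E3.
have h3 := ler_wpM2l B2 (ler_wpM2l C_ge0 x3).
have t4 : 0 < (t + t) ^+ 2 by rewrite exprn_gt0// addr_gt0.
apply: (@le_trans _ _ ((S - m ^+ 2) / t ^+ 2 / 2 + (m / t) ^+ 2 - (m' / (t + t)) ^+ 2 +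
    (2 * (B%:R * (j%:R / t)) + (j%:R / t) ^+ 2 + 2 * (B%:R ^+ 2 * 2^-1 ^+ T j) + B%:R ^+ 2 * (C * r ^+ j)))).
  rewrite -(ler_pM2r t4).
  have -> : (S' - m' ^+ 2) / (t + t) ^+ 2 * (t + t) ^+ 2 = S' - m' ^+ 2.
    by rewrite divfK// gt_eqF.
  have -> : ((S - m ^+ 2) / t ^+ 2 / 2 + (m / t) ^+ 2 - (m' / (t + t)) ^+ 2 +
    (2 * (B%:R * (j%:R / t)) + (j%:R / t) ^+ 2 + 2 * (B%:R ^+ 2 * 2^-1 ^+ T j) + B%:R ^+ 2 * (C * r ^+ j))) *
    (t + t) ^+ 2 = 2 * S + 2 * m ^+ 2 + (8 * j%:R * (B%:R * t) + 4 * j%:R ^+ 2) +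
      8 * (B%:R * t) ^+ 2 * 2^-1 ^+ T j + 4 * (B%:R * t) ^+ 2 * (C * r ^+ j) - m' ^+ 2.
    have -> : t + t = 2 * t by ring.
    by field.
  by rewrite lerD2r.
rewrite lerD2l /E; lra.
Qed.

(** Chebyshev's inequality for the clipped position as soon as its mean is close to the limit; the
    earlier terms are bounded by 1. For x < 0 the clipped position is 0, and eps <= 1 < [speed]
    makes this a deviation too. *)
Lemma deviation_summable l (eps : R) : (0 < l)%N -> 0 < eps <= 1 -> exists K, forall n,
  \sum_(j < n) L (2 ^ j * l) (fun x => (eps * (2 ^ j * l)%:R <= `|x%:~R - speed * (2 ^ j * l)%:R|)%R%:R) <= K.
Proof.
move=> l0 /andP[e0 e1]; have [K HK] := relvar_summable l0.
have lr : 0 < l%:R :> R by rewrite ltr0n.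
have e2 : 0 < eps / 2 * l%:R by rewrite mulr_gt0// divr_gt0.
have /cvgrPdist_lt/(_ _ e2)[J _ HJ] : dyadic_mean l j @[j --> \oo] --> l%:R * speed.
  by rewrite -dyadic_limit_linear//; exact: dyadic_mean_cvg.
have [q1 q2 q3 q4] := ratioP; have vd := speed_ge; have d0 := delta_gt0.
have q4' : 0 < 1 - ratio by lra.
pose ind j (x : int) := eps * (2 ^ j * l)%:R <= `|x%:~R - speed * (2 ^ j * l)%:R|.
have term j : L (2 ^ j * l) (fun x => (ind j x)%:R) <=
    ((j < J)%N)%:R + ratio ^+ j + 4 / eps ^+ 2 * relvar l j.
  have [x1 x2 x3 x4] := ratioX j.
  have rv0 : 0 <= 4 / eps ^+ 2 * relvar l j.
    by rewrite mulr_ge0// ?divr_ge0 ?exprn_ge0 ?variance_ge0// ltW.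
  case: ltnP => jJ /=.
    apply: (@le_trans _ _ 1); last by lra.
    rewrite -[leRHS](law_cst (2 ^ j * l)); apply: law_le; [exact: bdd_bool|exact: bdd_cst|].
    by move=> x; rewrite lern1; case: (ind j x).
  set T := (2 ^ j * l)%N; have T0 : 0 < T%:R :> R by rewrite ltr0n muln_gt0 expn_gt0.
  have p0 : 0 < 2 ^+ j :> R by rewrite exprn_gt0.
  have mT : `|speed * T%:R - mean T| < eps / 2 * T%:R.
    have -> : speed * T%:R - mean T = (l%:R * speed - dyadic_mean l j) * 2 ^+ j.
      by rewrite mulrBl divfK ?gt_eqF// natrM natrX; ring.
    rewrite normrM (gtr0_norm p0).
    have -> : eps / 2 * T%:R = eps / 2 * l%:R * 2 ^+ j by rewrite natrM natrX; ring.
    by rewrite ltr_pM2r//; exact: HJ.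
  have c0 : 0 <= 4 / (eps * T%:R) ^+ 2 by rewrite divr_ge0// exprn_ge0// mulr_ge0// ltW.
  have pw x : (ind j x)%:R <= 0 + 1 * far (B * T) x +
      4 / (eps * T%:R) ^+ 2 * (clip (B * T) x - mean T) ^+ 2 + 0 * far (B * T) x.
    have q0 : 0 <= 4 / (eps * T%:R) ^+ 2 * (clip (B * T) x - mean T) ^+ 2.
      by rewrite mulr_ge0// sqr_ge0.
    have f0 := far_ge0 (B * T) x.
    case: (boolP (ind j x)) => [|_] /=; last by lra.
    rewrite /ind -/T => ix.
    have [xf|xf] := ltP ((B * T)%N%:Z) x.
      have -> : far (B * T) x = 1 by rewrite /far xf.
      lra.
    have dev : eps / 2 * T%:R <= `|clip (B * T) x - mean T|.
      have [x0|x0] := ltP x 0.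
        have -> : clip (B * T) x = 0 :> R.
          by rewrite /clip -[RHS]/((0 : int)%:~R); congr _%:~R; move: x0; clear; lia.
        have := ler_norm (speed * T%:R - mean T); have := ler_norm (mean T); rewrite sub0r normrN.
        have : 1 * T%:R <= speed * T%:R by rewrite ler_pM2r//; lra.
        have : eps * T%:R <= 1 * T%:R by rewrite ler_pM2r.
        lra.
      have -> : clip (B * T) x = x%:~R :> R by congr _%:~R; move: x0 xf; clear; lia.
      have := ler_normD (x%:~R - mean T) (mean T - speed * T%:R).
      rewrite (distrC (mean T)) addrA subrK; lra.
    have h0 : 0 < eps / 2 * T%:R by rewrite mulr_gt0// divr_gt0.
    have : (eps / 2 * T%:R) ^+ 2 <= (clip (B * T) x - mean T) ^+ 2.
      by rewrite -[leRHS]real_normK ?num_real// lerXn2r ?nnegrE// ltW.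
    move=> /(ler_wpM2l c0).
    have -> : 4 / (eps * T%:R) ^+ 2 * (eps / 2 * T%:R) ^+ 2 = 1 by field; rewrite !gt_eqF.
    lra.
  have bs : bdd (fun x => (clip (B * T) x - mean T) ^+ 2).
    by apply: bdd_sqr; apply: bddD; [exact: bdd_clip0|exact: bdd_cst].
  apply: (@le_trans _ _ (L T (fun x => 0 + 1 * far (B * T) x +
      4 / (eps * T%:R) ^+ 2 * (clip (B * T) x - mean T) ^+ 2 + 0 * far (B * T) x))).
    apply: law_le => //; first exact: bdd_bool.
    by do 3 (apply: bddD; last by apply: bddM; [exact: bdd_cst|first [exact: bdd_far|exact: bs]]); exact: bdd_cst.
  rewrite law_lin3; [|exact: bdd_far|exact: bs|exact: bdd_far].
  rewrite law_sqr_dev subrr expr0n/= addr0 /relvar -/T.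
  have -> : 4 / (eps * T%:R) ^+ 2 * variance T = 4 / eps ^+ 2 * (variance T / T%:R ^+ 2).
    by field; rewrite !gt_eqF.
  by have := far_tail T; have := x4 l l0; rewrite -/T; lra.
exists (J%:R + 1 / (1 - ratio) + 4 / eps ^+ 2 * K) => n.
apply: (le_trans (ler_sum _ (fun (j : 'I_n) _ => term j))).
rewrite !big_split /= -mulr_sumr !lerD//.
- have -> : \sum_(j < n) ((j < J)%N)%:R = (minn n J)%:R :> R.
    elim: n => [|n IH]; first by rewrite big_ord0 min0n.
    by rewrite big_ord_recr /= IH -natrD; congr _%:R; clear; case: ltnP; lia.
  by rewrite ler_nat geq_minr.
- rewrite ler_pdivlMr//.
  have -> : (\sum_(j < n) ratio ^+ j) * (1 - ratio) = 1 - ratio ^+ n.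
    elim: n => [|n IH]; first by rewrite big_ord0 mul0r expr0 subrr.
    by rewrite big_ord_recr /= mulrDl IH exprS; ring.
  by have := exprn_ge0 n q3; lra.
- by apply: ler_wpM2l; [rewrite divr_ge0 ?exprn_ge0 ?(ltW e0)|exact: HK].
Qed.

End hammersley.

(** * Almost sure convergence *)

Lemma borel_cantelli (R : realType) (dd : measure_display) (Omega : measurableType dd)
    (P : probability Omega R) (F : nat -> set Omega) (K : R) :
  (forall j, measurable (F j)) -> (forall n, \sum_(j < n) prob P (F j) <= K) ->
  {ae P, forall w, exists j0, forall j, (j0 <= j)%N -> ~ F j w}.
Proof.
move=> mF FK; exists (lim_sup_set F); split.
- by apply: bigcap_measurable => // k _; exact: bigcup_measurable.
- apply: lim_sup_set_cvg0 => //; apply: (@le_lt_trans _ _ K%:E); last exact: ltry.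
  apply: lime_le; first by apply: is_cvg_nneseries.
  near=> n; rewrite big_mkord (eq_bigr (fun j : 'I_n => (prob P (F j))%:E)) => [|j _]; last exact: prE.
  by rewrite sumEFin lee_fin FK.
- move=> w /= H n _; apply: contrapT => nF; apply: H; exists n => j nj Fj.
  by apply: nF; exists j.
Unshelve. all: by end_near. Qed.

Section windows.
Context {R : realType}.
Variables (alpha beta : bool -> R) (Lambda p rho r delta : R).
Hypothesis mod : model alpha beta Lambda p rho r delta.
Context {dd : measure_display} {Omega : measurableType dd}.
Variables (P : probability Omega R) (eta : R -> Omega -> config)
  (Pi : Omega -> set (int * R * R)) (X : R -> Omega -> int).
Hypothesis EW : exclusion_walk alpha beta Lambda p rho P eta Pi X.
Let SE := walk_environment EW.
Let PP := walk_driving EW.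
Let IN := walk_independent EW.
Local Notation pr := (prob P).
Local Notation steps := (steps alpha beta eta Pi).
Local Notation walk_law := (walk_mean alpha beta P eta Pi).
Local Notation B := (tail_base Lambda).
Local Notation v := (speed walk_law B).

Lemma steps_cat (h : R) i d w : exists2 s, size s = d & steps h (i + d) w = s ++ steps h i w.
Proof.
elim: d => [|d [s sd E]]; first by exists [::]; rewrite ?addn0.
by rewrite addnS /= E; eexists (_ :: s); rewrite ?cat_cons//= sd.
Qed.

Lemma jumps_cat s s' : jumps (s ++ s') = (jumps s + jumps s')%N.
Proof. by rewrite /jumps big_cat. Qed.

Lemma pos_cat s s' : pos (s ++ s') = pos s + pos s'.
Proof. by rewrite /pos big_cat. Qed.

Lemma steps_window (h : R) i d k w : (d <= k)%N ->
  `|pos (steps h (i + d) w) - pos (steps h i w)| <= (jumps (take k (steps h (i + k) w)))%:Z.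
Proof.
move=> dk; have [s1 s1d E1] := steps_cat h i d w.
have [s2 s2d] := steps_cat h (i + d) (k - d) w.
rewrite -addnA subnKC// => ->; rewrite E1 catA take_cat size_cat s1d s2d subnK// ltnn subnn take0 cats0.
rewrite pos_cat addrK jumps_cat; have := pos_jumps s1.
by move: (pos s1) (jumps s1) (jumps s2); clear; lia.
Qed.

Lemma grid_find (h t : R) i k : i%:R * h <= t <= (i + k.+1)%:R * h ->
  exists2 d, (d <= k)%N & (i + d)%:R * h <= t <= (i + d).+1%:R * h.
Proof.
elim: k => [|k IH] /andP[t1 t2]; first by exists 0%N => //; rewrite addn0 t1 -addn1.
have [tk|kt] := leP t ((i + k.+1)%:R * h).
  by have [|d dk H] := IH; [rewrite t1|exists d => //; exact: leqW].
by exists k.+1 => //; rewrite ltW//= -addnS.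
Qed.

(** The exceptional set is built from an Euler scheme, which is measurable, with a mesh depending on
    j. The three terms 2^-j pay for the matching with the walk, for the approximation of its law,
    and for more than B 2^j jumps in the window. *)
Lemma window_event l (eps : R) j : (0 < l)%N -> exists E : set Omega, [/\ measurable E,
  pr E <= 3 * 2^-1 ^+ j + walk_law (2 ^ j * l)
    (fun x => (eps * (2 ^ j * l)%:R <= `|x%:~R - v * (2 ^ j * l)%:R|)%R%:R) &
  forall w, good_path alpha beta eta Pi X w -> ~ E w ->
  forall t, (2 ^ j * l)%:R <= t <= (2 ^ j * l.+1)%:R ->
  `|(X t w)%:~R - v * (2 ^ j * l)%:R| <= eps * (2 ^ j * l)%:R + (B * 2 ^ j)%:R].
Proof.
move=> l0; set T := (2 ^ j * l)%N; pose tau := (2 ^ j)%N.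
have TT : (2 ^ j * l.+1 = T + tau)%N by rewrite mulnS addnC.
have p0 : 0 < 2^-1 ^+ j :> R by rewrite exprn_gt0// invr_gt0.
pose ind (x : int) := eps * T%:R <= `|x%:~R - v * T%:R|.
have ind1 x : `|(ind x)%:R| <= 1 :> R by case: (ind x); rewrite ?normr1 ?normr0.
have [J1 H1] := path_match mod EW (T + tau) p0.
have [J2 H2] := walk_mean_near mod EW T 1 p0.
pose m := maxn J1 J2; have [Bad [mB pB HB]] := H1 m (leq_maxl _ _).
have {}H2 := H2 m (leq_maxr _ _) _ ind1.
have m0 := @mesh_gt0 R m; set h := mesh m in m0 HB H2 *.
pose n := (T * 2 ^ m)%N; pose k := (tau * 2 ^ m)%N.
have nk : ((T + tau) * 2 ^ m = n + k)%N by rewrite mulnDl.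
have [mA pA] := @pr_steps R alpha beta Lambda p rho dd Omega P eta Pi SE PP h m0 n (fun s => ind (pos s)).
pose far (s : seq (bool * bool)) := (B * tau < jumps (take k s))%N.
have [mW _] := @pr_steps R alpha beta Lambda p rho dd Omega P eta Pi SE PP h m0 (n + k) far.
have pW : pr [set w | far (steps h (n + k) w)] <= 2^-1 ^+ j.
  apply: (@le_trans _ _ (steps_mean alpha beta P eta Pi h (n + k)
      (fun s => 2^-1 ^+ (B * tau) * 2 ^+ jumps (take k s) + 0 * 1))).
    apply: (@pr_steps_le R alpha beta Lambda p rho dd Omega P eta Pi SE PP h m0) => s.
    rewrite mul0r addr0 /far; case: ltnP => H /=; last by rewrite mulr_ge0// exprn_ge0// invr_ge0.
    by rewrite -(subnK (ltnW H)) exprD mulrCA -exprMn mulVf// expr1n mulr1 exprn_ege1// ler1n.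
  rewrite steps_mean_lin mul0r addr0.
  have := exp_jumps mod SE PP IN m0 n k (ler1n R 2).
  have -> : (2 - 1) * Lambda * h * k%:R = Lambda * tau%:R.
    by rewrite -(mesh_grid tau m 0).1 -/k -/h; ring.
  have q0 : 0 <= 2^-1 ^+ (B * tau) :> R by rewrite exprn_ge0// invr_ge0.
  move=> /(ler_wpM2l q0) H; apply: (le_trans H); apply: (le_trans (tail_baseP Lambda tau)).
  apply: ler_wiXn2l; rewrite ?invr_ge0 ?invf_le1 ?ler1n//; exact: ltnW (ltn_expl _ _).
exists (Bad `|` ([set w | ind (pos (steps h n w))] `|` [set w | far (steps h (n + k) w)])); split.
- by apply: measurableU => //; exact: measurableU.
- have u1 := pr_leU P mA mW; have u2 := pr_leU P mB (measurableU _ _ mA mW).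
  move: H2; rewrite /euler_mean -/h -/n -pA ler_norml => /andP[_ H2]; rewrite -/ind in u1 u2 H2 *.
  lra.
move=> w gw nE t; rewrite TT => tt.
have [|X1 X2] := HB w gw; first by move=> b; apply: nE; left.
have nh : n%:R * h = T%:R := (mesh_grid T m 0).1.
have nkh : (n + k)%:R * h = (T + tau)%:R by rewrite -nk; exact: (mesh_grid (T + tau) m 0).1.
have k0 : (0 < k)%N by rewrite muln_gt0 !expn_gt0.
have [d dk dt] : exists2 d, (d <= k.-1)%N & (n + d)%:R * h <= t <= (n + d).+1%:R * h.
  by apply: grid_find; rewrite prednK// nh nkh.
have dn : (n + d < (T + tau) * 2 ^ m)%N by rewrite nk ltn_add2l -(prednK k0) ltnS.
clearbody k n.
have [e ek Xe] : exists2 e, (e <= k)%N & X t w = pos (steps h (n + e) w).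
  have [H|H] := X2 _ dn t dt; first by exists d; [exact: leq_trans dk (leq_pred _)|exact: H].
  by exists d.+1; [rewrite -(prednK k0) ltnS|rewrite addnS; exact: H].
have A1 : `|(pos (steps h n w))%:~R - v * T%:R| < eps * T%:R.
  by rewrite ltNge; apply/negP => H; apply: nE; right; left.
have A2 : (jumps (take k (steps h (n + k) w)) <= B * tau)%N.
  by rewrite leqNgt; apply/negP => H; apply: nE; right; right.
have A3 := steps_window h n w ek.
have A4 : `|(X t w)%:~R - (pos (steps h n w))%:~R| <= (B * tau)%:R :> R.
  rewrite Xe -rmorphB/= -intr_norm -[(B * tau)%:R]/(((B * tau)%:Z)%:~R) ler_int.
  by apply: (le_trans A3); rewrite lez_nat.
have := ler_normD ((X t w)%:~R - (pos (steps h n w))%:~R) ((pos (steps h n w))%:~R - v * T%:R).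
rewrite addrA subrK; rewrite -/tau; lra.
Qed.

End windows.

Section dyadic_windows.
Context {R : realType}.

(** Here j + 1 is the least exponent n with t < 2^n M. With l confined to [M, 2 M), finitely many
    sequences 2^j l cover all large times. *)
Lemma dyadic_find j0 M (t : R) : (0 < M)%N -> (2 ^ j0 * M)%:R <= t ->
  exists j l, [/\ (j0 <= j)%N, (M <= l < 2 * M)%N & (2 ^ j * l)%:R <= t <= (2 ^ j * l.+1)%:R].
Proof.
move=> M0 tM; have t0 : 0 <= t by apply: le_trans tM.
have ex : exists n, t < (2 ^ n * M)%:R.
  exists (Num.truncn t).+1; apply: (lt_le_trans (truncnS_gt t)); rewrite ler_nat.
  by apply: (@leq_trans (2 ^ (Num.truncn t).+1)); [exact: ltnW (ltn_expl _ _)|rewrite leq_pmulr].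
case: (ex_minnP ex) => n nt nmin.
have jn : (j0 < n)%N.
  rewrite ltnNge; apply/negP => nj; have := lt_le_trans nt (le_trans _ tM).
  by rewrite ltxx => H; apply: (notF (H _)); rewrite ler_nat leq_mul2r leq_exp2l// nj orbT.
case: n jn nt nmin => // j jj nt nmin; exists j.
have p0 : 0 < (2 ^ j)%:R :> R by rewrite ltr0n expn_gt0.
have tj : (2 ^ j * M)%:R <= t by rewrite leNgt; apply/negP => /nmin; rewrite ltnn.
have td0 : 0 <= t / (2 ^ j)%:R by rewrite divr_ge0// ltW.
exists (Num.truncn (t / (2 ^ j)%:R)); split=> //.
  rewrite truncn_ge_nat// ler_pdivlMr// -natrM mulnC tj/=.
  by rewrite truncn_lt_nat// ltr_pdivrMr// -natrM; have -> : (2 * M * 2 ^ j = 2 ^ j.+1 * M)%N by rewrite expnS mulnAC.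
apply/andP; split.
  by rewrite natrM mulrC -ler_pdivlMr// truncn_le.
by rewrite natrM -ler_pdivrMl// mulrC; exact: ltW (truncnS_gt _).
Qed.

Lemma limit_of_windows (Y : R -> int) (v : R) (B : nat) : 0 <= v ->
  (forall N l, (0 < l)%N -> exists j0, forall j, (j0 <= j)%N ->
    forall t, (2 ^ j * l)%:R <= t <= (2 ^ j * l.+1)%:R ->
    `|(Y t)%:~R - v * (2 ^ j * l)%:R| <= N.+1%:R^-1 * (2 ^ j * l)%:R + (B * 2 ^ j)%:R) ->
  (Y t)%:~R / t @[t --> +oo] --> v.
Proof.
move=> v0 H; apply/cvgrPdist_le => e e0.
have e2 : 0 < e / 2 by rewrite divr_gt0.
pose N := Num.truncn (2 / e); have hN : N.+1%:R^-1 <= e / 2.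
  rewrite -[e / 2]invrK lef_pV2 ?posrE ?invr_gt0// invf_div.
  exact: ltW (truncnS_gt _).
(* A window has relative length at most 1 / M, so the gaps contribute at most (B + v) / M <= e /
   2. *)
pose M := (Num.truncn ((B%:R + v) / (e / 2))).+1.
have hM : B%:R + v <= e / 2 * M%:R.
  by rewrite mulrC -ler_pdivrMr//; exact: ltW (truncnS_gt _).
have /choice[J HJ] : forall l, exists j0, (0 < l)%N -> forall j, (j0 <= j)%N ->
    forall t, (2 ^ j * l)%:R <= t <= (2 ^ j * l.+1)%:R ->
    `|(Y t)%:~R - v * (2 ^ j * l)%:R| <= N.+1%:R^-1 * (2 ^ j * l)%:R + (B * 2 ^ j)%:R.
  by case=> [|l]; [exists 0%N|have [j0 Hj] := H N l.+1 isT; exists j0].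
pose j0 := \max_(l < 2 * M) J l.
near=> t.
have tM : (2 ^ j0 * M)%:R <= t by near: t; apply: nbhs_pinfty_ge; rewrite num_real.
have [j [l [jj /andP[Ml lM] tl]]] := dyadic_find (isT : (0 < M)%N) tM.
have l0 : (0 < l)%N by exact: leq_trans Ml.
have Jj : (J l <= j)%N by apply: leq_trans jj; exact: (leq_bigmax (Ordinal lM)).
have := HJ l l0 j Jj t tl; have /andP[t1 t2] := tl.
set T : R := (2 ^ j * l)%:R in t1 *; have p0 : 0 < (2 ^ j)%:R :> R by rewrite ltr0n expn_gt0.
have T0 : 0 < T by rewrite ltr0n muln_gt0 expn_gt0.
have t0 : 0 < t by exact: lt_le_trans t1.
have tT : t <= T + (2 ^ j)%:R by move: t2; rewrite mulnS addnC natrD.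
have MT : (2 ^ j)%:R * M%:R <= T by rewrite -natrM ler_nat leq_mul2l Ml orbT.
have E1 : N.+1%:R^-1 * T <= e / 2 * T by rewrite ler_pM2r.
have E2 : (B%:R + v) * (2 ^ j)%:R <= e / 2 * T.
  apply: (@le_trans _ _ (e / 2 * M%:R * (2 ^ j)%:R)); first by rewrite ler_pM2r.
  by rewrite -mulrA ler_pM2l// mulrC.
have E3 : `|v * T - v * t| <= v * (2 ^ j)%:R.
  by rewrite -mulrBr normrM ger0_norm// ler_wpM2l// distrC ger0_norm ?subr_ge0// lerBlDl.
have E4 : e * T <= e * t by rewrite ler_pM2l.
rewrite natrM => E5.
have -> : v - (Y t)%:~R / t = (v * t - (Y t)%:~R) / t by field; rewrite gt_eqF.
rewrite normrM [X in _ * X]gtr0_norm ?invr_gt0// ler_pdivrMr// distrC.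
have := ler_normD ((Y t)%:~R - v * T) (v * T - v * t); rewrite addrA subrK => E6.
apply: (le_trans E6); apply: (le_trans (lerD E5 E3)); apply: le_trans E4.
have -> : e * T = e / 2 * T + e / 2 * T by rewrite -mulrDl -splitr.
by rewrite -addrA -mulrDl; exact: lerD.
Unshelve. all: by end_near. Qed.

End dyadic_windows.

Section law_of_large_numbers.
Context {R : realType}.
Variables (alpha beta : bool -> R) (Lambda p rho r delta : R).
Hypothesis mod : model alpha beta Lambda p rho r delta.
Local Notation B := (tail_base Lambda).
Local Notation C := (2 * (3 + tail_cst Lambda r delta)).

Let C_ge0 : 0 <= C.
Proof.
have := tail_cst_ge0 (model_Lambda mod) (model_r mod) (model_delta mod); lra.
Qed.

Section one_space.
Context {dd : measure_display} {Omega : measurableType dd}.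
Variables (P : probability Omega R) (eta : R -> Omega -> config)
  (Pi : Omega -> set (int * R * R)) (X : R -> Omega -> int).
Hypothesis EW : exclusion_walk alpha beta Lambda p rho P eta Pi X.
Local Notation walk_law := (walk_mean alpha beta P eta Pi).
Local Notation v := (speed walk_law B).

Lemma walk_speed_ge : 1 + delta <= v.
Proof.
exact: (speed_ge (walk_additive mod EW) (model_r mod) C_ge0 (isT : (0 < B)%N)).
Qed.

Lemma window_ae N l : (0 < l)%N -> {ae P, forall w, exists j0, forall j, (j0 <= j)%N ->
    forall t, (2 ^ j * l)%:R <= t <= (2 ^ j * l.+1)%:R ->
    `|(X t w)%:~R - v * (2 ^ j * l)%:R| <= N.+1%:R^-1 * (2 ^ j * l)%:R + (B * 2 ^ j)%:R}.
Proof.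
move=> l0; have /choice[E HE] := window_event mod EW N.+1%:R^-1 ^~ l0.
have N01 : 0 < (N.+1%:R^-1 : R) <= 1 by rewrite invr_gt0 ltr0n/= invf_le1 ?ler1n.
have [K HK] := deviation_summable (walk_additive mod EW) (model_r mod) C_ge0 (model_delta mod) (isT : (0 < B)%N) l0 N01.
have mE j : measurable (E j) by have [] := HE j.
have sE n : \sum_(j < n) prob P (E j) <= 6 + K.
  apply: (@le_trans _ _ (\sum_(j < n) (3 * 2^-1 ^+ j + walk_law (2 ^ j * l)
    (fun x => (N.+1%:R^-1 * (2 ^ j * l)%:R <= `|x%:~R - v * (2 ^ j * l)%:R|)%R%:R)))).
    by apply: ler_sum => j _; have [] := HE j.
  rewrite big_split; apply: lerD; last exact: HK.
  rewrite -mulr_sumr.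
  have -> : \sum_(j < n) 2^-1 ^+ j = 2 - 2 * 2^-1 ^+ n :> R.
    elim: n => [|n IH]; first by rewrite big_ord0 expr0; ring.
    by rewrite big_ord_recr /= IH exprS; field.
  have q0 : 0 <= 2^-1 ^+ n :> R by rewrite exprn_ge0 ?invr_ge0.
  lra.
apply: filterS2 (borel_cantelli mE sE) (good_path_ae EW) => w [j0 Hj] gw.
exists j0 => j /Hj nE t tt; have [_ _] := HE j; exact.
Qed.

Lemma walk_lln : {ae P, forall w, (X t w)%:~R / t @[t --> +oo] --> v}.
Proof.
have H : {ae P, forall w, forall N l, exists j0, forall j, (j0 <= j)%N ->
    forall t, (2 ^ j * l.+1)%:R <= t <= (2 ^ j * l.+2)%:R ->
    `|(X t w)%:~R - v * (2 ^ j * l.+1)%:R| <= N.+1%:R^-1 * (2 ^ j * l.+1)%:R + (B * 2 ^ j)%:R}.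
  by apply/ae_foralln => N; apply/ae_foralln => l; exact: window_ae.
apply: filterS H => w H; apply: (@limit_of_windows R (X ^~ w) v B).
  by have := walk_speed_ge; have := model_delta mod; lra.
by move=> N [//|l] _; exact: H.
Qed.

End one_space.

Lemma walk_speed_same
    (d1 : measure_display) (O1 : measurableType d1) (P1 : probability O1 R) (eta1 : R -> O1 -> config)
    (Pi1 : O1 -> set (int * R * R)) (X1 : R -> O1 -> int)
    (d2 : measure_display) (O2 : measurableType d2) (P2 : probability O2 R) (eta2 : R -> O2 -> config)
    (Pi2 : O2 -> set (int * R * R)) (X2 : R -> O2 -> int) :
  exclusion_walk alpha beta Lambda p rho P1 eta1 Pi1 X1 ->
  exclusion_walk alpha beta Lambda p rho P2 eta2 Pi2 X2 ->
  speed (walk_mean alpha beta P1 eta1 Pi1) B = speed (walk_mean alpha beta P2 eta2 Pi2) B.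
Proof.
move=> E1 E2; rewrite /speed /dyadic_limit.
suff -> : dyadic_mean (walk_mean alpha beta P1 eta1 Pi1) B 1 =
    dyadic_mean (walk_mean alpha beta P2 eta2 Pi2) B 1 by [].
apply/funext => j.
rewrite /dyadic_mean /mean; congr (_ / _); set t := (2 ^ j * 1)%N; set n := (B * t)%N.
have n0 : n%:R != 0 :> R by rewrite pnatr_eq0 muln_eq0 negb_or /t muln1 expn_eq0.
have b1 x : `|n%:R^-1 * clip n x| <= 1 :> R.
  have /andP[c0 c1] := @clip01 R n x; rewrite ger0_norm ?mulr_ge0 ?invr_ge0//.
  by rewrite ler_pdivrMl ?mulr1// lt_def n0 ler0n.
(* Rescaled to a function bounded by 1, to which [walk_mean_same] applies. *)
have -> : clip n = (fun x => n%:R * (n%:R^-1 * clip n x)) :> (int -> R).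
  by apply/funext => x; rewrite mulVKf.
have b : bdd (fun x => n%:R^-1 * clip n x : R) by exists 1.
rewrite (lawZ (walk_additive mod E1))// (lawZ (walk_additive mod E2))//; congr (_ * _).
exact: walk_mean_same mod _ _ _ _ _ _ _ _ _ _ _ _ E1 E2 _ _ b1.
Qed.

End law_of_large_numbers.

Theorem corollary2p7 (R : realType) (alpha beta : bool -> R) (Lambda : R)
    (alpha_ge0 : forall xi, 0 <= alpha xi)
    (beta_ge0 : forall xi, 0 <= beta xi)
    (Lambda_ge1 : 1 <= Lambda)
    (rates_le : forall xi, alpha xi + beta xi <= Lambda)
    (drift_gt1 : 1 < inf (range (fun xi => alpha xi - beta xi))) :
  exists v : R -> R -> R,
    (forall p rho, 0 <= p <= 1 -> 0 <= rho <= 1 -> 1 < v p rho) /\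
    (forall p rho, 0 <= p <= 1 -> 0 <= rho <= 1 ->
      forall (d : measure_display) (Omega : measurableType d)
        (P : probability Omega R) (eta : R -> Omega -> config)
        (Pi : Omega -> set (int * R * R)) (X : R -> Omega -> int),
      exclusion_walk alpha beta Lambda p rho P eta Pi X ->
      {ae P, forall w, (X t w)%:~R / t @[t --> +oo] --> v p rho}).
Proof.
(* The excess of the drift over 1 is 2 delta. As alpha <= Lambda, passing from alpha to r alpha
   costs at most delta, and the other half remains for [r_drift]. *)
set D := inf _ in drift_gt1; pose delta := (D - 1) / 2; pose r := 1 - delta / Lambda.
have L0 : 0 < Lambda by lra.
have drift xi : beta xi + D <= alpha xi.
  have : D <= alpha xi - beta xi.
    apply: ge_inf; last by exists xi.
    exists (Num.min (alpha true - beta true) (alpha false - beta false)) => _ [b _ <-].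
    by case: b; rewrite ge_min lexx ?orbT.
  lra.
have d0 : 0 < delta by rewrite divr_gt0//; lra.
have dL : delta < Lambda.
  by have := drift true; have := beta_ge0 true; have := rates_le true; rewrite /delta; lra.
have r01 : 0 < r < 1.
  rewrite /r subr_gt0 ltr_pdivrMr// mul1r dL/= ltrBlDr ltrDl divr_gt0//.
have r_drift xi : beta xi + 1 + delta <= r * alpha xi.
  have : delta / Lambda * alpha xi <= delta.
    rewrite mulrAC ler_pdivrMr// ler_pM2l//.
    by have := beta_ge0 xi; have := rates_le xi; lra.
  have := drift xi; rewrite /r mulrBl mul1r.
  have -> : D = 1 + 2 * delta by rewrite /delta; field.
  lra.
have mod p rho : 0 <= p <= 1 -> 0 <= rho <= 1 -> model alpha beta Lambda p rho r delta by split.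
(* The speed is picked among those realised on some probability space, which all coincide by
   [walk_speed_same]. *)
pose speeds p rho : set R := [set s | exists (d : measure_display) (Omega : measurableType d)
  (P : probability Omega R) (eta : R -> Omega -> config)
  (Pi : Omega -> set (int * R * R)) (X : R -> Omega -> int),
  exclusion_walk alpha beta Lambda p rho P eta Pi X /\
  s = speed (walk_mean alpha beta P eta Pi) (tail_base Lambda)].
(* The default 2 keeps the value above 1 in case no space carries the walk. *)
exists (fun p rho => xget 2 (speeds p rho)); split=> p rho p01 rho01.
  case: xgetP => [s _ ss|_]; last by rewrite ltr1n.
  case: ss => d [Om [P [eta [Pi [X [EW ->]]]]]].
  by have := walk_speed_ge (mod p rho p01 rho01) EW; lra.
move=> d Omega P eta Pi X EW.
have -> : xget 2 (speeds p rho) = speed (walk_mean alpha beta P eta Pi) (tail_base Lambda).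
  case: xgetP => [s _ ss|H].
    case: ss => d2 [Om2 [P2 [eta2 [Pi2 [X2 [EW2 ->]]]]]].
    exact: (@walk_speed_same R alpha beta Lambda p rho r delta (mod p rho p01 rho01) d2 Om2 P2 eta2 Pi2 X2 d Omega P eta Pi X EW2 EW).
  by case: (H (speed (walk_mean alpha beta P eta Pi) (tail_base Lambda))); exists d, Omega, P, eta, Pi, X.
exact: (walk_lln (mod p rho p01 rho01) EW).
Qed.
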